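(* Let $L_1$ be a pre-lamination of $S^1$. Then there exists a $\mathfrak P$-pre-lamination $L_2\supset L_1$ such that the image of $L_1$ in $\mathrm{Leaf}^*(L_2)$ is dense if and only if $L_1$ satisfies the following properties: (1) $L_1$ is a dense pre-lamination; (2) every complementary region of $L_1$ has at least one boundary component which is not a leaf of $L_1$; (3) $L_1$ has no bad accumulation; (4) $L_1$ has few common ends.
   Context: $D^2$ is the closed unit disc, $S^1=\partial D^2$, and a geodesic is an open Euclidean chord $]x,y[\subset\mathrm{Int}(D^2)$, $x\neq y\in S^1$. Two pairs $(x,y),(z,w)$ of distinct points of $S^1$ cross if the four points are distinct and the chords intersect. A pre-lamination is a set $L$ of pairs $(x,y)\in S^1\times S^1$, $x\ne y$, invariant under $(x,y)\mapsto(y,x)$ and no two elements of which cross; its leaves are identified with the geodesics $]x,y[$. $L$ is dense if the set of endpoints of its leaves is dense in $S^1$. A complementary region of $L$ is a connected component of the complement in $\mathrm{Int}(D^2)$ of the union of the leaves; if it has empty interior it is a single geodesic that is not a leaf (and it then satisfies (2) by convention, as its own boundary); otherwise its boundary components (in $\mathrm{Int}(D^2)$) are geodesics, each a leaf or a geodesic accumulated by leaves. Convergence of regions toward a geodesic is Hausdorff convergence of closures in $D^2$. If a sequence of complementary regions $\Delta_n$ with non-empty interior of a dense pre-lamination converges to a geodesic $\gamma$, then for large $n$ exactly two boundary components of $\Delta_n$ are long (they converge to $\gamma$), the supremum of the lengths of the others tending to $0$. A bad accumulation of $L$ is such a sequence $(\Delta_n)$ converging to a geodesic for which the two long boundary components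 of $\Delta_n$ are both leaves of $L$. For $\theta\in S^1$ let $E_L(\theta)=\{\theta'\in S^1\setminus\{\theta\}: (\theta,\theta')\in L\}$, ordered as a subset of the oriented interval $S^1\setminus\{\theta\}$; $L$ has few common ends if for every $\theta$, $E_L(\theta)$ is empty or order-isomorphic to an interval of $\mathbb Z$ (finite, $\mathbb N$, $-\mathbb N$ or $\mathbb Z$). A shell is a complementary region with non-empty interior having exactly one boundary component that is not a leaf (its root). A $\mathfrak P$-pre-lamination is a pre-lamination $L$ that is dense, such that at most countably many leaves end at each given point of $S^1$, all of whose complementary regions are shells, and without bad accumulation (equivalently, whenever a sequence of complementary shells converges to a geodesic, so do their roots). For a $\mathfrak P$-pre-lamination $L$, $\mathrm{Leaf}^*(L)$ is the set of leaves of $L$ (as unordered pairs) with the topology generated by open $L$-intervals. A leaf $h$ separates $f$ from $g$ if $f,g$ lie in distinct components of $\mathrm{Int}(D^2)\setminus h$. A non-empty set $\mathcal I$ of leaves is an open $L$-interval if: among any three distinct leaves in $\mathcal I$ one separates the other two; any leaf of $L$ separating two elements of $\mathcal I$ is in $\mathcal I$; each $f\in\mathcal I$ separates two elements of $\mathcal I$; and any two distinct elements of $\mathcal I$ are separated by some leaf of $L$. The image of $L_1$ in $\mathrm{Leaf}^*(L_2)$ is given by the inclusion $L_1\subset L_2$. *)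

(* Defs.v *)
From HB Require Import structures.
From mathcomp Require Import all_boot all_order all_algebra.
From mathcomp Require Import all_classical all_reals all_analysis.

Set Implicit Arguments.
Unset Strict Implicit.
Unset Printing Implicit Defensive.

Import Order.TTheory GRing.Theory Num.Theory.
Import numFieldNormedType.Exports.

Local Open Scope classical_set_scope.
Local Open Scope ring_scope.

Definition plane (R : realType) : Type := (R * R)%type.
HB.instance Definition _ (R : realType) := NormedModule.on (plane R).

(* The library's norm on a product is the sup norm; lengths are Euclidean. *)
Definition edist (R : realType) (p q : plane R) : R :=
  Num.sqrt ((p.1 - q.1) ^+ 2 + (p.2 - q.2) ^+ 2).

Definition circle (R : realType) : set (plane R) :=
  [set p | p.1 ^+ 2 + p.2 ^+ 2 = 1].

Definition int_disc (R : realType) : set (plane R) :=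
  [set p | p.1 ^+ 2 + p.2 ^+ 2 < 1].

Definition chord (R : realType) (x y : plane R) : set (plane R) :=
  [set p | exists t : R, 0 < t < 1 /\ p = (1 - t) *: x + t *: y].

Definition geodesic (R : realType) (g : set (plane R)) : Prop :=
  exists x y : plane R, [/\ circle x, circle y, x <> y & g = chord x y].

Definition is_component (T : topologicalType) (A C : set T) : Prop :=
  exists x, A x /\ C = connected_component A x.

Definition cross (R : realType) (a b : plane R * plane R) : Prop :=
  uniq [:: a.1; a.2; b.1; b.2] /\
  chord a.1 a.2 `&` chord b.1 b.2 !=set0.

Definition pre_lamination (R : realType) (L : set (plane R * plane R)) : Prop :=
  [/\ forall x y, L (x, y) -> [/\ circle x, circle y & x <> y],
      forall x y, L (x, y) -> L (y, x) &
      forall a b, L a -> L b -> ~ cross a b].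

(* A leaf is the geodesic ]x,y[, as a set of points: this identifies (x,y) with
   (y,x), and two distinct unordered pairs on the circle give distinct sets. *)
Definition leaves (R : realType) (L : set (plane R * plane R)) :
    set (set (plane R)) :=
  [set g | exists x y, L (x, y) /\ g = chord x y].

Definition dense_lamination (R : realType) (L : set (plane R * plane R)) : Prop :=
  @circle R `<=` closure [set x | exists y, L (x, y) \/ L (y, x)].

Definition complementary_region (R : realType) (L : set (plane R * plane R))
    (A : set (plane R)) : Prop :=
  is_component (@int_disc R `\` \bigcup_(g in leaves L) g) A.

(* When A is a complementary region with empty interior, hence a single geodesic
   which is not a leaf, the topological boundary of A in the open disc is A
   itself, so A is its own and only boundary component. *)
Definition boundary_component (R : realType) (A B : set (plane R)) : Prop :=
  is_component (@int_disc R `&` (closure A `\` A^°)) B.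

(* Convergence of the closures; for subsets of the open disc, the closure in the
   plane is the closure in the closed disc. *)
Definition hausdorff_cvg (R : realType) (A : nat -> set (plane R))
    (B : set (plane R)) : Prop :=
  forall e : R, 0 < e -> \forall n \near \oo,
    (forall p, closure (A n) p -> exists q, closure B q /\ edist p q < e) /\
    (forall q, closure B q -> exists p, closure (A n) p /\ edist p q < e).

(* For large n, [a n] and [b n] are the two long boundary components of [D n]:
   both converge to g, and the supremum of the lengths of the others tends to 0. *)
Definition long_boundary (R : realType) (D : nat -> set (plane R))
    (g : set (plane R)) (a b : nat -> set (plane R)) : Prop :=
  [/\ \forall n \near \oo, [/\ boundary_component (D n) (a n),
        boundary_component (D n) (b n) & a n <> b n],
      hausdorff_cvg a g, hausdorff_cvg b g &
      forall e : R, 0 < e -> \forall n \near \oo, forall x y,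
        circle x -> circle y -> boundary_component (D n) (chord x y) ->
        chord x y <> a n -> chord x y <> b n -> edist x y < e].

Definition bad_accumulation (R : realType) (L : set (plane R * plane R))
    (D : nat -> set (plane R)) : Prop :=
  (forall n, complementary_region L (D n) /\ (D n)^° !=set0) /\
  exists g, [/\ geodesic g, hausdorff_cvg D g &
    exists a b, long_boundary D g a b /\
      \forall n \near \oo, leaves L (a n) /\ leaves L (b n)].

Definition circle_pt (R : realType) (t : R) : plane R := (cos t, sin t).

(* The order of the oriented (counterclockwise) interval S^1 \ {th}. *)
Definition arc_lt (R : realType) (th y z : plane R) : Prop :=
  exists a s t : R, [/\ 0 < s, s < t & t < pi *+ 2] /\
    [/\ th = circle_pt a, y = circle_pt (a + s) & z = circle_pt (a + t)].

Definition common_ends (R : realType) (L : set (plane R * plane R))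
    (th : plane R) : set (plane R) :=
  [set th' | th' <> th /\ L (th, th')].

(* The interval J may be empty, which covers the case of an empty set of ends. *)
Definition few_common_ends (R : realType) (L : set (plane R * plane R)) : Prop :=
  forall th, circle th ->
    exists (J : set int) (f : plane R -> int),
      [/\ is_interval J, set_bij (common_ends L th) J f &
          forall y z, common_ends L th y -> common_ends L th z ->
            (arc_lt th y z <-> f y < f z)].

Definition shell (R : realType) (L : set (plane R * plane R))
    (A : set (plane R)) : Prop :=
  [/\ complementary_region L A, A^° !=set0 &
      exists! B, boundary_component A B /\ ~ leaves L B].

Definition P_pre_lamination (R : realType) (L : set (plane R * plane R)) : Prop :=
  [/\ pre_lamination L,
      dense_lamination L,
      forall th, circle th -> countable (common_ends L th),
      forall A, complementary_region L A -> shell L A &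
      forall D, ~ bad_accumulation L D].

Definition separates (R : realType) (h f g : set (plane R)) : Prop :=
  exists C1 C2, [/\ is_component (@int_disc R `\` h) C1,
    is_component (@int_disc R `\` h) C2, C1 <> C2, f `<=` C1 & g `<=` C2].

Definition open_interval (R : realType) (L : set (plane R * plane R))
    (I : set (set (plane R))) : Prop :=
  [/\ I !=set0 /\ I `<=` leaves L,
      forall f g h, I f -> I g -> I h -> f <> g -> g <> h -> f <> h ->
        [\/ separates f g h, separates g f h | separates h f g],
      forall h f g, leaves L h -> I f -> I g -> separates h f g -> I h,
      forall f, I f -> exists g h, [/\ I g, I h & separates f g h] &
      forall f g, I f -> I g -> f <> g ->
        exists h, leaves L h /\ separates h f g].

Definition leaf_space (R : realType) (L : set (plane R * plane R)) : Type :=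
  {l : set (plane R) | l \in leaves L}.

HB.instance Definition _ (R : realType) (L : set (plane R * plane R)) :=
  Choice.copy (leaf_space L) {l : set (plane R) | l \in leaves L}.

HB.instance Definition _ (R : realType) (L : set (plane R * plane R)) :=
  isSubBaseTopological.Build (leaf_space L)
    (@open_interval R L)
    (fun I : set (set (plane R)) => [set l : leaf_space L | I (sval l)]).

Definition leaf_image (R : realType) (L1 L2 : set (plane R * plane R)) :
    set (leaf_space L2) :=
  [set l | leaves L1 (sval l)].
Arguments leaf_image {R} L1 L2 _.

(* Main.v *)
Require Import Defs.
From mathcomp Require Import all_boot all_order all_algebra.
From mathcomp Require Import all_classical all_reals all_analysis.
From mathcomp Require Import finmap.
From mathcomp Require Import ring lra zify.

(** Two points of the open disc lying on no leaf are in the same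
    complementary region exactly when no leaf separates them. That two
    chords do not cross says that the ends of one lie weakly on the same
    side of the other, which is a closed condition; so the limits of leaves
    of a pre-lamination L (the set [cl L]) are again pairwise noncrossing
    chords, and the geometry of L is read off them. A region with non-empty
    interior is, up to its boundary, an intersection of half-discs; its
    boundary components are the chords of [cl L] adjacent to it; and each
    side of a chord of [cl L] is either accumulated by leaves or adjacent to
    such a region (compactness of the circle, [accum_or_adj]). A region with
    empty interior is a single chord of [cl L].

    The leaf space. Let L be a P-pre-lamination and f a leaf. On a given
    side of f, let the exit r be f itself if leaves accumulate on f from
    that side, and otherwise the far side of the root of the shell that f
    borders there. In both cases leaves accumulate on r from beyond. Two
    leaves with no leaf between them bound a common region, so pairs of this
    kind arbitrarily close to r would give a bad accumulation; hence the
    leaves close to r are densely ordered ([accum_dense]). Doing this on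
    both sides of f puts f in an open interval ([interval_through]).
    Conversely an open interval through f contains all leaves that lie
    beyond an exit of f and close to it ([interval_near]).

    From L2 to L1. If L1 is dense in the leaf space of L2, every open
    interval contains a leaf of L1, hence every side of a chord accumulated
    by leaves of L2 is accumulated by leaves of L1 ([accum_transfer]). So
    the root of a shell of L2 is a limit of leaves of L1, and as every
    region of L1 with interior contains a shell of L2 sharing that root, it
    has a boundary component that is not a leaf ([sub_nonleaf_boundary]). A
    region of L1 with two leaves a, b on its boundary contains a shell of L2
    bounded by a and by another leaf that is b or separates a from b; so a
    bad accumulation of L1 yields one of L2 ([sub_no_bad]). For the density
    of endpoints, suppose that no leaf of L1 ends in some arc. Then no leaf
    of L2 has both ends in it, and no chord ending in it is accumulated; a
    leaf of L2 ending in the arc that is extreme among the leaves with the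
    same end there borders a shell, and the boundary leaf of this shell next
    to it would have the same end ([cap_absurd]). Finally, an open interval
    contains at most one leaf ending at a given point th: otherwise the
    parameters of the leaves ending at th would contain a countable densely
    ordered set, whose gaps give a limit chord that the axioms of L2 exclude
    ([one_end_per_interval]). Therefore the leaves ending at th do not
    accumulate between two of them, and their order is that of an interval
    of integers ([sub_few_common_ends]).

    From L1 to L2. Add to L1 all the chords of [cl L1] that are not leaves,
    except one root for each region with non-empty interior. The limits of
    leaves stay the same, hence so do the interiors and the closures of the
    regions with interior; each of these becomes a shell and no region with
    empty interior survives. If the root is chosen of at least half the
    maximal length of the nonleaf boundary chords, a long boundary leaf of a
    shell that is not in L1 would force the root to be long too; thus a bad
    accumulation of the completion is one of L1 ([completion_no_bad]). An
    added chord ending at th either borders a region with interior, which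
    leaves countably many possibilities, or is accumulated on both sides;
    between two other limit chords ending at th the accumulating leaves end
    at th as well, so that few common ends allow at most two chords of the
    second kind ([completion_countable]). Finally an added chord is
    accumulated by leaves of L1, and these enter all the open intervals
    through it ([completion_dense]). *)

Set Implicit Arguments.
Unset Strict Implicit.
Unset Printing Implicit Defensive.

Import Order.TTheory GRing.Theory Num.Theory.
Import numFieldNormedType.Exports.

Local Open Scope classical_set_scope.
Local Open Scope ring_scope.

(** * Oriented chords *)

Section Geometry.
Variable R : realType.
Implicit Types (p q w z : plane R) (l m : plane R * plane R).

(** Twice the signed area of the triangle l.1, l.2, p: it is positive when p is
    on the left of the line directed from l.1 to l.2, and affine in p. All the
    plane geometry below is done with its sign. *)
Definition side l p : R :=
  (l.2.1 - l.1.1) * (p.2 - l.1.2) - (l.2.2 - l.1.2) * (p.1 - l.1.1).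
Definition flip l : plane R * plane R := (l.2, l.1).
Definition ch l : set (plane R) := chord l.1 l.2.
Definition geo l := [/\ circle l.1, circle l.2 & l.1 <> l.2].
Definition seg p q (t : R) : plane R := (1 - t) *: p + t *: q.

Lemma seg1E p q t : (seg p q t).1 = (1 - t) * p.1 + t * q.1.
Proof. by []. Qed.
Lemma seg2E p q t : (seg p q t).2 = (1 - t) * p.2 + t * q.2.
Proof. by []. Qed.

Lemma conv_pos (x y t : R) : 0 < x -> 0 < y -> 0 <= t <= 1 -> 0 < (1 - t) * x + t * y.
Proof.
move=> x0 y0 /andP[t0]; rewrite le_eqVlt => /predU1P[->|t1].
  by rewrite subrr mul0r add0r mul1r.
by rewrite ltr_pwDl ?mulr_gt0 ?subr_gt0// mulr_ge0// ltW.
Qed.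
Lemma pos_trans (a b c : R) : 0 < a * b -> 0 < b * c -> 0 < a * c.
Proof.
case: (ltrgt0P b) => [b0|b0|->]; last by rewrite mulr0 ltxx.
  by rewrite pmulr_lgt0// pmulr_rgt0// => a0 c0; exact: mulr_gt0.
by rewrite nmulr_lgt0// nmulr_rgt0// => a0 c0; rewrite nmulr_rgt0.
Qed.
Lemma pos_ge_trans (a b c : R) : 0 < a * b -> 0 <= b * c -> 0 <= a * c.
Proof.
case: (ltrgt0P b) => [b0|b0|->]; last by rewrite mulr0 ltxx.
  by rewrite pmulr_lgt0// pmulr_rge0// => a0 c0; rewrite mulr_ge0// ltW.
by rewrite nmulr_lgt0// nmulr_rge0// => a0 c0; rewrite nmulr_rge0.
Qed.

Lemma plane_eq p q : p.1 = q.1 -> p.2 = q.2 -> p = q.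
Proof. by case: p q => [? ?] [? ?] /= -> ->. Qed.

Lemma seg0 p q : seg p q 0 = p.
Proof. by apply: plane_eq; rewrite ?seg1E ?seg2E; ring. Qed.
Lemma seg_1 p q : seg p q 1 = q.
Proof. by apply: plane_eq; rewrite ?seg1E ?seg2E; ring. Qed.
Lemma segC p q t : seg p q t = seg q p (1 - t).
Proof. by apply: plane_eq; rewrite ?seg1E ?seg2E; ring. Qed.

Lemma sub_seg p q t : p - seg p q t = t *: (p - q).
Proof.
by rewrite /seg scalerBl scale1r scalerBr -addrA opprD addrA subrr add0r opprD opprK.
Qed.

Lemma side_seg l p q t : side l (seg p q t) = (1 - t) * side l p + t * side l q.
Proof. by rewrite /side seg1E seg2E; ring. Qed.
Lemma side_flip l p : side (flip l) p = - side l p.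
Proof. by rewrite /side /=; ring. Qed.
Lemma flipK l : flip (flip l) = l. Proof. by case: l. Qed.
Lemma geo_flip l : geo l -> geo (flip l).
Proof. by case=> a b c; split => // /esym. Qed.
Lemma side_1 l : side l l.1 = 0. Proof. by rewrite /side; ring. Qed.
Lemma side_2 l : side l l.2 = 0. Proof. by rewrite /side; ring. Qed.

Lemma chP l p : ch l p <-> exists2 t, 0 < t < 1 & p = seg l.1 l.2 t.
Proof.
by split=> [[t [t01 ->]]|[t t01 ->]]; exists t.
Qed.
Lemma ch_flip l : ch (flip l) = ch l.
Proof.
have sub k : ch k `<=` ch (flip k).
  move=> p /chP [t t01 ->]; apply/chP; exists (1 - t); first lra.
  by rewrite segC.
by apply/seteqP; split => //; rewrite -{2}(flipK l); exact: sub.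
Qed.
Lemma side_ch l p : ch l p -> side l p = 0.
Proof. by case/chP => t _ ->; rewrite side_seg side_1 side_2; ring. Qed.

Lemma circleP p : circle p -> p.1 ^+ 2 + p.2 ^+ 2 = 1. Proof. by []. Qed.

Definition d2 l : R := (l.2.1 - l.1.1) ^+ 2 + (l.2.2 - l.1.2) ^+ 2.
Lemma d2_gt0 l : geo l -> 0 < d2 l.
Proof.
move=> [_ _ ne]; rewrite lt_neqAle; apply/andP; split; last first.
  by rewrite addr_ge0// sqr_ge0.
apply/eqP => /esym/eqP; rewrite paddr_eq0 ?sqr_ge0// !sqrf_eq0 => /andP[/eqP a /eqP b].
by apply: ne; apply: plane_eq; lra.
Qed.

Definition n2 p : R := p.1 ^+ 2 + p.2 ^+ 2.
Lemma discP p : int_disc p <-> n2 p < 1. Proof. by []. Qed.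
Lemma circ_n2 p : circle p <-> n2 p = 1. Proof. by []. Qed.

(** The power of a point of the chord with respect to the circle. It identifies
    the points of a line through two points of the circle that are in the disc,
    in the closed disc or on the circle. *)
Lemma n2_seg l t : geo l -> n2 (seg l.1 l.2 t) = 1 - t * (1 - t) * d2 l.
Proof.
move=> [/circleP a /circleP b _]; rewrite /n2 /d2 seg1E seg2E.
have e : 1 - t * (1 - t) * ((l.2.1 - l.1.1) ^+ 2 + (l.2.2 - l.1.2) ^+ 2) =
  1 - t * (1 - t) * ((l.2.1 ^+2 + l.2.2 ^+ 2) + (l.1.1 ^+ 2 + l.1.2 ^+ 2)
     - 2 * l.2.1 * l.1.1 - 2 * l.2.2 * l.1.2) by ring.
rewrite e a b.
have -> : ((1 - t) * l.1.1 + t * l.2.1) ^+ 2 + ((1 - t) * l.1.2 + t * l.2.2) ^+ 2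
 = (1 - t) ^+ 2 * (l.1.1 ^+ 2 + l.1.2 ^+ 2) + t ^+2 * (l.2.1 ^+2 + l.2.2 ^+ 2)
  + 2 * t * (1 - t) * (l.2.1 * l.1.1 + l.2.2 * l.1.2) by ring.
by rewrite a b; ring.
Qed.

Lemma ch_disc l p : geo l -> ch l p -> int_disc p.
Proof.
move=> gl /chP [t /andP[t0 t1] ->]; apply/discP; rewrite n2_seg//.
have := d2_gt0 gl => d.
have : 0 < t * (1 - t) * d2 l by rewrite !mulr_gt0// subr_gt0.
by lra.
Qed.

(** The parameter is that of the orthogonal projection of p on the line. *)
Lemma side_line l p : geo l -> side l p = 0 ->
  exists t, p = seg l.1 l.2 t.
Proof.
move=> gl; have d := d2_gt0 gl => e.
exists (((p.1 - l.1.1) * (l.2.1 - l.1.1) + (p.2 - l.1.2) * (l.2.2 - l.1.2)) / d2 l).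
have dn : d2 l != 0 by rewrite gt_eqF.
apply: plane_eq; rewrite ?(seg1E, seg2E); apply: (mulIf dn).
  rewrite mulrDl mulrAC mulrBl mul1r divfK// [X in _ = _ + X]mulrAC divfK//.
  have -> : p.1 * d2 l = (d2 l - ((p.1 - l.1.1) * (l.2.1 - l.1.1) + (p.2 - l.1.2) * (l.2.2 - l.1.2))) *
   l.1.1 +
   ((p.1 - l.1.1) * (l.2.1 - l.1.1) + (p.2 - l.1.2) * (l.2.2 - l.1.2)) * l.2.1
     - (l.2.2 - l.1.2) * side l p by rewrite /side /d2; ring.
  by rewrite e; ring.
rewrite mulrDl mulrAC mulrBl mul1r divfK// [X in _ = _ + X]mulrAC divfK//.
have -> : p.2 * d2 l = (d2 l - ((p.1 - l.1.1) * (l.2.1 - l.1.1) + (p.2 - l.1.2) * (l.2.2 - l.1.2))) *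
   l.1.2 +
   ((p.1 - l.1.1) * (l.2.1 - l.1.1) + (p.2 - l.1.2) * (l.2.2 - l.1.2)) * l.2.2
     + (l.2.1 - l.1.1) * side l p by rewrite /side /d2; ring.
by rewrite e; ring.
Qed.

Lemma disc_ch l p : geo l -> int_disc p -> side l p = 0 -> ch l p.
Proof.
move=> gl ip /(side_line gl)[t pE]; apply/chP; exists t => //.
move: ip => /discP; rewrite pE n2_seg// => h.
have d := d2_gt0 gl.
have : 0 < t * (1 - t) * d2 l by lra.
rewrite pmulr_lgt0// => {}h; apply/andP; split; nra.
Qed.

Lemma circle_ends l p : geo l -> circle p -> side l p = 0 -> p = l.1 \/ p = l.2.
Proof.
move=> gl ip /(side_line gl)[t pE].
move: ip => /circ_n2; rewrite pE n2_seg// => h.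
have d := d2_gt0 gl.
have /eqP : t * (1 - t) * d2 l = 0 by lra.
rewrite !mulf_eq0 (gt_eqF d) orbF => /orP[/eqP ->|/eqP t1]; first by left; rewrite seg0.
by right; rewrite (_ : t = 1) ?seg_1//; lra.
Qed.

Lemma n2_segle p q t : 0 <= t <= 1 ->
  n2 (seg p q t) <= (1 - t) * n2 p + t * n2 q.
Proof.
move=> /andP[t0 t1]; rewrite /n2 seg1E seg2E -subr_ge0.
have -> : (1 - t) * (p.1 ^+ 2 + p.2 ^+ 2) + t * (q.1 ^+ 2 + q.2 ^+ 2) -
  (((1 - t) * p.1 + t * q.1) ^+ 2 + ((1 - t) * p.2 + t * q.2) ^+ 2) =
  t * (1 - t) * ((p.1 - q.1)^+2 + (p.2 - q.2)^+2) by ring.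
by rewrite !mulr_ge0 ?subr_ge0// addr_ge0// sqr_ge0.
Qed.

Lemma disc_seg_cl p q t : int_disc p -> n2 q <= 1 -> 0 <= t < 1 -> int_disc (seg p q t).
Proof.
move=> /discP ip iq /andP[t0 t1]; apply/discP.
have t01 : 0 <= t <= 1 by rewrite t0 ltW.
apply: le_lt_trans (n2_segle _ _ t01) _; nra.
Qed.

Lemma disc_seg p q t : int_disc p -> int_disc q -> 0 <= t <= 1 -> int_disc (seg p q t).
Proof.
move=> ip iq /andP[t0]; rewrite le_eqVlt => /predU1P[->|t1]; first by rewrite seg_1.
by apply: disc_seg_cl => //; [apply/ltW/discP|rewrite t0].
Qed.

Lemma affine_zero l p q : side l p * side l q < 0 ->
  exists2 t, 0 < t < 1 & side l (seg p q t) = 0.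
Proof.
move=> h; have d : side l p - side l q != 0.
  by rewrite subr_eq0; apply/eqP => e; move: h; rewrite e -expr2 ltNge sqr_ge0.
exists (side l p / (side l p - side l q)); last first.
  by rewrite side_seg; field.
case: (ltrgt0P (side l p)) h => [pp|pn|->]; last by rewrite mul0r ltxx.
  rewrite pmulr_rlt0// => qn; apply/andP; split; first by rewrite divr_gt0//; lra.
  by rewrite ltr_pdivrMr; lra.
rewrite nmulr_rlt0// => qn; apply/andP; split.
  by rewrite -mulrNN -invrN mulr_gt0// ?oppr_gt0// invr_gt0; lra.
by rewrite -mulrNN -invrN ltr_pdivrMr; lra.
Qed.

Definition same l m := m = l \/ m = flip l.
Lemma same_refl l : same l l. Proof. by left. Qed.
Lemma same_sym l m : same l m -> same m l.
Proof. by case=> ->; [left|right; rewrite flipK]. Qed.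
Lemma same_trans l m k : same l m -> same m k -> same l k.
Proof. by case=> ->; case=> ->; rewrite ?flipK; [left|right|right|left]. Qed.
Lemma same_flipl l m : same (flip l) m <-> same l m.
Proof. by split=> -[->|->]; rewrite ?flipK; [right|left|right; rewrite flipK|left]. Qed.
Lemma same_flipr l m : same l (flip m) <-> same l m.
Proof. by split=> /same_sym h; apply: same_sym; apply/same_flipl; rewrite ?flipK. Qed.
Lemma same_ch l m : same l m -> ch m = ch l.
Proof. by case=> ->; rewrite ?ch_flip. Qed.
Lemma same_sd0 l m p : same l m -> side l p = 0 -> side m p = 0.
Proof. by case=> ->; rewrite ?side_flip// => ->; rewrite oppr0. Qed.

Definition mid l := seg l.1 l.2 (2^-1).
Lemma ch_mid l : ch l (mid l).
Proof. by apply/chP; exists (2^-1) => //; lra. Qed.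

Lemma two_points_same l m p q : geo l -> geo m -> ch l p -> ch l q -> p <> q ->
  side m p = 0 -> side m q = 0 -> same m l.
Proof.
move=> gl gm /chP[s _ pE] /chP[t _ qE] ne e1 e2.
have st : s - t != 0.
  by rewrite subr_eq0; apply/eqP => e; apply: ne; rewrite pE qE e.
have D : side m l.2 - side m l.1 = 0.
  have : (s - t) * (side m l.2 - side m l.1) = 0.
    move: e1 e2; rewrite pE qE !side_seg => e1 e2; lra.
  by move/eqP; rewrite mulf_eq0 (negbTE st) => /eqP.
have z1 : side m l.1 = 0 by move: e1; rewrite pE side_seg; nra.
have z2 : side m l.2 = 0 by lra.
case: gl => c1 c2 n.
case: (circle_ends gm c1 z1) => E1; case: (circle_ends gm c2 z2) => E2; case: l E1 E2 n {pE qE D z1 z2 c1 c2} => a b /= -> ->.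
- by [].
- by left; case: (m).
- by right; case: (m).
- by [].
Qed.

Lemma ch_inj l m : geo l -> geo m -> ch l = ch m -> same m l.
Proof.
move=> gl gm e.
have z p : ch l p -> side m p = 0 by rewrite e; exact: side_ch.
pose p := seg l.1 l.2 (3^-1); pose q := mid l.
have hp : ch l p by apply/chP; exists (3^-1) => //; lra.
have hq : ch l q by exact: ch_mid.
apply: (two_points_same gl gm hp hq) => //; [|exact: z|exact: z].
move=> pq; case: gl => _ _; apply; move: pq => /(congr1 (fun z => (z.1, z.2))).
rewrite /p /q /mid !seg1E !seg2E => -[a b]; apply: plane_eq; lra.
Qed.

(** The ends of m are weakly on one side of l. Contrary to the disjointness of
    chords this is a closed condition: it passes to limits. *)
Definition noncross l m := 0 <= side l m.1 * side l m.2.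

Definition left_of l : set (plane R) := [set p | int_disc p /\ 0 < side l p].

Lemma noncross_sides l m : geo l -> geo m -> noncross l m ->
  [\/ same l m, ch m `<=` left_of l | ch m `<=` left_of (flip l)].
Proof.
move=> gl gm h; have [c1 c2 n] := gm.
have [/eqP z1|z1] := boolP (side l m.1 == 0).
  have [/eqP z2|z2] := boolP (side l m.2 == 0).
    apply: Or31; case: (circle_ends gl c1 z1) => E1; case: (circle_ends gl c2 z2) => E2;
      case: m E1 E2 n {z1 z2 h c1 c2 gm} => a b /= -> ->.
    - by [].
    - by left; case: (l).
    - by right; case: (l).
    - by [].
  have := lt_total z2; case/orP => z2'; [apply: Or33|apply: Or32] => p hp;
  split; (try exact: (ch_disc gm hp)); case/chP: hp => t /andP[t0 t1] ->; rewrite ?side_flip side_seg z1; nra.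
have [/eqP z2|z2] := boolP (side l m.2 == 0).
  have := lt_total z1; case/orP => z1'; [apply: Or33|apply: Or32] => p hp;
  split; (try exact: (ch_disc gm hp)); case/chP: hp => t /andP[t0 t1] ->; rewrite ?side_flip side_seg z2; nra.
have hh : 0 < side l m.1 * side l m.2.
  by move: h; rewrite /noncross => h; rewrite lt_neqAle h andbT eq_sym mulf_neq0.
case/orP: (lt_total z1) => z1'.
  have z2' : side l m.2 < 0 by rewrite nmulr_rgt0 in hh.
  apply: Or33 => p hp; split; (try exact: (ch_disc gm hp)); case/chP: hp => t /andP[t0 t1] ->; rewrite ?side_flip side_seg; nra.
have z2' : 0 < side l m.2 by rewrite pmulr_rgt0 in hh.
apply: Or32 => p hp; split; (try exact: (ch_disc gm hp)); case/chP: hp => t /andP[t0 t1] ->; rewrite ?side_flip side_seg; nra.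
Qed.

Lemma noncross_of_not_cross l m : geo l -> geo m -> ~ cross l m -> noncross l m.
Proof.
move=> gl gm h; rewrite /noncross leNgt; apply/negP => neg; apply: h.
have [t t01 z] := affine_zero neg.
split; last first.
  exists (seg m.1 m.2 t); split; last by apply/chP; exists t.
  by apply: disc_ch => //; apply: (ch_disc gm); apply/chP; exists t.
have [_ _ n1] := gl; have [_ _ n2] := gm.
have F a b : b = l.1 \/ b = l.2 -> side l b = 0 by case=> ->; rewrite ?side_1 ?side_2.
have Z1 : m.1 <> l.1 /\ m.1 <> l.2.
  by split=> E; move: neg; rewrite E ?side_1 ?side_2 mul0r ltxx.
have Z2 : m.2 <> l.1 /\ m.2 <> l.2.
  by split=> E; move: neg; rewrite E ?side_1 ?side_2 mulr0 ltxx.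
rewrite /= !inE !negb_or !andbT; apply/and3P; split.
- by apply/and3P; split; apply/eqP => // E; [apply: Z1.1|apply: Z2.1].
- by apply/andP; split; apply/eqP => E; [apply: Z1.2|apply: Z2.2].
- by apply/eqP.
Qed.

End Geometry.

(** * Continuity, and the sides of a chord *)

Section Continuity.
Variable R : realType.

Lemma fst_cont0 : continuous (fun p : plane R => p.1).
Proof. by move=> x; apply: cvg_fst. Qed.
Lemma snd_cont0 : continuous (fun p : plane R => p.2).
Proof. by move=> x; apply: cvg_snd. Qed.
Lemma fst_cont (T : topologicalType) (f : T -> plane R) :
  continuous f -> continuous (fun x => (f x).1).
Proof. by move=> cf x; apply: continuous_comp; [exact: cf|exact: fst_cont0]. Qed.
Lemma snd_cont (T : topologicalType) (f : T -> plane R) :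
  continuous f -> continuous (fun x => (f x).2).
Proof. by move=> cf x; apply: continuous_comp; [exact: cf|exact: snd_cont0]. Qed.

Lemma cont_B (T : topologicalType) (f g : T -> R) :
  continuous f -> continuous g -> continuous (fun x => f x - g x).
Proof. by move=> cf cg x; apply: cvgB; [exact: cf|exact: cg]. Qed.
Lemma cont_D (T : topologicalType) (f g : T -> R) :
  continuous f -> continuous g -> continuous (fun x => f x + g x).
Proof. by move=> cf cg x; apply: cvgD; [exact: cf|exact: cg]. Qed.
Lemma cont_M (T : topologicalType) (f g : T -> R) :
  continuous f -> continuous g -> continuous (fun x => f x * g x).
Proof. by move=> cf cg x; apply: cvgM; [exact: cf|exact: cg]. Qed.
Lemma cont_c (T U : topologicalType) (a : U) : continuous (fun x : T => a).
Proof. by move=> x; exact: cvg_cst. Qed.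
Lemma cont_id (T : topologicalType) : continuous (fun x : T => x).
Proof. by move=> x; exact: cvg_id. Qed.

End Continuity.

Ltac cont := repeat (assumption || (apply: cont_B) || (apply: cont_D) ||
  (apply: cont_M) || (apply: fst_cont) || (apply: snd_cont) ||
  (apply: cont_id) || (apply: cont_c)).

Section Topology.
Variable R : realType.
Implicit Types (p q w z : plane R) (l m : plane R * plane R).

Lemma pl_cont (T : topologicalType) (f : T -> plane R) :
  continuous (fun x => (f x).1) -> continuous (fun x => (f x).2) -> continuous f.
Proof.
move=> c1 c2 x.
have := cvg_pair (c1 x) (c2 x).
have -> : (fun t => ((f t).1, (f t).2)) = f.
  by apply/funext => t; rewrite -surjective_pairing.
by move=> H; exact: H.
Qed.

Lemma side_cont (T : topologicalType) (f g h : T -> plane R) :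
  continuous f -> continuous g -> continuous h ->
  continuous (fun x => side (f x, g x) (h x)).
Proof.
move=> cf cg chh; rewrite /side /=.
by cont.
Qed.

Lemma cfst (T U : topologicalType) : continuous (@fst T U).
Proof. by move=> x; exact: cvg_fst. Qed.
Lemma csnd (T U : topologicalType) : continuous (@snd T U).
Proof. by move=> x; exact: cvg_snd. Qed.

Lemma side_cont_l p : continuous (fun l => side l p).
Proof.
have -> : (fun l => side l p) = (fun l => side (l.1, l.2) p) by apply/funext => -[].
by apply: side_cont; [exact: cfst|exact: csnd|exact: cont_c].
Qed.
Lemma side_cont_p l : continuous (fun p => side l p).
Proof.
by case: l => a b; apply: side_cont; [exact: cont_c|exact: cont_c|exact: cont_id].
Qed.

Lemma seg_cont (T : topologicalType) (f g : T -> plane R) (t : T -> R) :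
  continuous f -> continuous g -> continuous t ->
  continuous (fun x => seg (f x) (g x) (t x)).
Proof.
move=> cf cg ct; apply: pl_cont.
  rewrite (_ : (fun x => _) = (fun x => (1 - t x) * (f x).1 + t x * (g x).1)) //.
  by cont.
rewrite (_ : (fun x => _) = (fun x => (1 - t x) * (f x).2 + t x * (g x).2)) //.
by cont.
Qed.

Lemma n2_cont : continuous (@n2 R).
Proof.
have -> : @n2 R = (fun p => p.1 * p.1 + p.2 * p.2) by apply/funext => p; rewrite /n2 !expr2.
by cont.
Qed.

Section closedopen.
Variables (T : topologicalType) (f : T -> R).
Hypothesis cf : continuous f.
Lemma closed_ge0 : closed [set x | 0 <= f x].
Proof. by apply: (@preimage_closed _ _ f [set y | 0 <= y]) => //; move=> x _; exact: cf. Qed.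
Lemma closed_eq0 : closed [set x | f x = 0].
Proof. by apply: (@preimage_closed _ _ f [set y | y = 0]) => //; move=> x _; exact: cf. Qed.
Lemma open_gt0 : open [set x | 0 < f x].
Proof. by apply: (@open_comp _ _ f [set y | 0 < y]) => //; move=> x _; exact: cf. Qed.
Lemma near_gt0 x : 0 < f x -> \forall y \near x, 0 < f y.
Proof. by move=> h; apply: open_nbhs_nbhs; split=> //; exact: open_gt0. Qed.
End closedopen.

Lemma near_lt0 (T : topologicalType) (f : T -> R) (cf : continuous f) x :
  f x < 0 -> \forall y \near x, f y < 0.
Proof.
move=> h; have c : continuous (fun x => - f x) by move=> y; apply: cvgN; exact: cf.
have : 0 < - f x by rewrite oppr_gt0.
by move=> /(near_gt0 c); apply: filterS => y; rewrite oppr_gt0.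
Qed.

Lemma clos_min (T : topologicalType) (A F : set T) : closed F -> A `<=` F -> closure A `<=` F.
Proof. by move=> cF AF; rewrite [F](closure_id _).1//; exact: closureS. Qed.

Lemma disc_open : open (@int_disc R).
Proof.
rewrite (_ : @int_disc R = [set p | 0 < 1 - n2 p]).
  by apply: open_gt0; apply: cont_B; [exact: cont_c|exact: n2_cont].
by apply/seteqP; split=> p; rewrite /= subr_gt0.
Qed.

Lemma circle_closed : closed (@circle R).
Proof.
rewrite (_ : @circle R = [set p | n2 p - 1 = 0]).
  by apply: closed_eq0; apply: cont_B; [exact: n2_cont|exact: cont_c].
by apply/seteqP; split=> p /=; [rewrite -/(n2 p) => /circ_n2 ->; rewrite subrr|move/eqP; rewrite subr_eq0 => /eqP].
Qed.

Lemma cdisc_closed : closed [set p : plane R | n2 p <= 1].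
Proof.
rewrite (_ : [set p | _] = [set p : plane R | 0 <= 1 - n2 p]).
  by apply: closed_ge0; apply: cont_B; [exact: cont_c|exact: n2_cont].
by apply/seteqP; split=> p; rewrite /= subr_ge0.
Qed.

Lemma coord_le p : n2 p <= 1 -> (-1 <= p.1 <= 1) /\ (-1 <= p.2 <= 1).
Proof.
rewrite /n2 => h; have := sqr_ge0 p.1; have := sqr_ge0 p.2 => a b.
by split; rewrite -ler_norml -(@ler_pXn2r _ 2)// ?nnegrE// expr1n real_normK ?num_real//; lra.
Qed.

Lemma cdisc_compact : compact [set p : plane R | n2 p <= 1].
Proof.
apply: (subclosed_compact cdisc_closed (compact_setX (@segment_compact R (-1) 1) (@segment_compact R (-1) 1))).
by move=> p /coord_le [a b]; split; rewrite /= in_itv.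
Qed.

Lemma circle_compact : compact (@circle R).
Proof.
apply: (subclosed_compact circle_closed cdisc_compact).
by move=> p /circ_n2 h /=; rewrite h.
Qed.

Lemma plane_hausdorff : hausdorff_space (plane R).
Proof. exact: norm_hausdorff. Qed.

Lemma segment_conn p q : connected (seg p q @` `[0, 1]).
Proof.
apply: connected_continuous_connected; first exact: segment_connected.
by apply: continuous_subspaceT; apply: seg_cont; [exact: cont_c|exact: cont_c|exact: cont_id].
Qed.

(** A subset of S that is star-shaped at p and can be cut off from each other
    point of S by a set that is open and closed in S is the component of p. All
    components used below are recognised in this way. *)
Lemma comp_eq (S C : set (plane R)) p :
  (forall q, C q -> forall t, 0 <= t <= 1 -> C (seg p q t)) -> C `<=` S -> C p ->
  (forall q, S q -> ~ C q -> exists V F, [/\ open V, closed F, S `&` V = S `&` F, V p & ~ V q]) ->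
  connected_component S p = C.
Proof.
move=> star CS Cp sep; apply/seteqP; split; last first.
  move=> q Cq; exists (seg p q @` `[0, 1]); last first.
    by exists 1; [rewrite /= in_itv /= ler01 lexx|exact: seg_1].
  split; [by exists 0; [rewrite /= in_itv /= ler01 lexx|exact: seg0]| |exact: segment_conn].
  by move=> z [t + <-]; rewrite /= in_itv /= => t01; apply: CS; exact: star.
move=> q [B [Bp BS cB] Bq]; apply: contrapT => nCq.
have [V [F [oV cF VF Vp nVq]]] := sep q (BS _ Bq) nCq.
apply: nVq.
have E : B `&` V = B `&` F.
  by apply/seteqP; split=> x [Bx h]; split=> //; have : (S `&` V) x <-> (S `&` F) x by [rewrite VF]; have := BS _ Bx => Sx [a b]; [apply a|apply b].
have : B `&` V = B.
  apply: cB; first by exists p.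
  - by exists V.
  - by exists F.
by move=> EB; have : (B `&` V) q by [rewrite EB]; case.
Qed.

Lemma sep_side (S : set (plane R)) l p q : (forall z, S z -> side l z != 0) ->
  0 < side l p -> ~ 0 < side l q ->
  exists V F, [/\ open V, closed F, S `&` V = S `&` F, V p & ~ V q].
Proof.
move=> nz h1 h2; exists [set z | 0 < side l z], [set z | 0 <= side l z]; split=> //.
- exact/open_gt0/side_cont_p.
- exact/closed_ge0/side_cont_p.
apply/seteqP; split=> z [Sz /= hz]; split => //=; first exact: ltW.
by rewrite lt_neqAle hz andbT eq_sym; exact: nz.
Qed.

Lemma half_comp l p : geo l -> left_of l p ->
  connected_component (@int_disc R `\` ch l) p = left_of l.
Proof.
move=> gl hp; have [ip sp] := hp; apply: comp_eq => //.
- move=> q [iq sq] t t01; split; first exact: disc_seg.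
  by rewrite side_seg; case/andP: t01 => t0 t1; nra.
- by move=> q [iq sq]; split=> // /side_ch e; rewrite e ltxx in sq.
- move=> q [iq _] nq; apply: (sep_side (l := l)) => // [z [iz nz]|h]; last exact: nq.
  by apply/eqP => e; apply: nz; exact: disc_ch.
Qed.

Definition splits l a b := (a `<=` left_of l /\ b `<=` left_of (flip l)) \/
  (a `<=` left_of (flip l) /\ b `<=` left_of l).

Lemma half_ex l : geo l -> exists p, left_of l p.
Proof.
move=> gl; have [w hw] : exists w, w = mid l by exists (mid l).
have cw : ch l w by rewrite hw; exact: ch_mid.
pose n : plane R := (w.1 - (l.2.2 - l.1.2), w.2 + (l.2.1 - l.1.1)).
have d := d2_gt0 gl.
have sn : side l n = d2 l.
  have := side_ch cw; rewrite /side /n /d2 /= => e.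
  transitivity ((l.2.1 - l.1.1) * (w.2 - l.1.2) - (l.2.2 - l.1.2) * (w.1 - l.1.1)
   + (l.2.1 - l.1.1)^+2 + (l.2.2 - l.1.2)^+2); first by ring.
  by rewrite e; ring.
have : \forall t \near (0:R), int_disc (seg w n t).
  have c : {for 0, continuous (fun t => seg w n t)}.
    by apply: seg_cont; [exact: cont_c|exact: cont_c|exact: cont_id].
  apply: c; rewrite seg0; apply: open_nbhs_nbhs; split; first exact: disc_open.
  exact: ch_disc cw.
case/nbhs_ballP => e /= e0 h; exists (seg w n (e / 2)); split.
  by apply: h; rewrite /ball /= sub0r normrN gtr0_norm; lra.
by rewrite side_seg sn (side_ch cw) mulr0 add0r mulr_gt0//; lra.
Qed.

Lemma separatesP l (a b : set (plane R)) : geo l -> a !=set0 -> b !=set0 ->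
  separates (ch l) a b <-> splits l a b.
Proof.
move=> gl [pa ha] [pb hb].
have sideP p : int_disc p -> ~ ch l p -> left_of l p \/ left_of (flip l) p.
  move=> ip nc; have : side l p != 0 by apply/eqP => e; apply: nc; exact: disc_ch.
  case/lt_total/orP => h; [right|left]; split => //; by rewrite side_flip oppr_gt0.
have hc p : left_of (flip l) p -> connected_component (@int_disc R `\` ch l) p = left_of (flip l).
  by move=> h; rewrite -ch_flip; apply: half_comp => //; exact: geo_flip.
have disj p : left_of l p -> left_of (flip l) p -> False.
  by move=> [_ h1] [_]; rewrite side_flip => h2; lra.
split=> [[C1 [C2 [[x1 [[i1 n1] ->]] [x2 [[i2 n2] ->]] ne s1 s2]]]|].
  case: (sideP _ i1 n1) => h1; case: (sideP _ i2 n2) => h2.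
  - by case: ne; rewrite !half_comp.
  - by left; rewrite -(half_comp gl h1) -(hc _ h2).
  - by right; rewrite -(hc _ h1) -(half_comp gl h2).
  - by case: ne; rewrite !hc.
have inS p : left_of l p -> (@int_disc R `\` ch l) p.
  by move=> [ip h]; split=> // /side_ch e; rewrite e ltxx in h.
have inS' p : left_of (flip l) p -> (@int_disc R `\` ch l) p.
  by move=> [ip h]; split=> // /side_ch e; rewrite side_flip e oppr0 ltxx in h.
case=> -[s1 s2].
- exists (left_of l), (left_of (flip l)); split => //.
  + by exists pa; split; [apply: inS; exact: s1|rewrite half_comp//; exact: s1].
  + by exists pb; split; [apply: inS'; exact: s2|rewrite hc//; exact: s2].
  + by move=> E; apply: (disj pa); [exact: s1|rewrite -E; exact: s1].
- exists (left_of (flip l)), (left_of l); split => //.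
  + by exists pa; split; [apply: inS'; exact: s1|rewrite hc//; exact: s1].
  + by exists pb; split; [apply: inS; exact: s2|rewrite half_comp//; exact: s2].
  + by move=> E; apply: (disj pa); [rewrite -E; exact: s1|exact: s1].
Qed.

End Topology.

(** * Limits of leaves and complementary regions *)

Section Lam.
Variable R : realType.
Notation pl := (plane R).
Implicit Types (p q w z c : plane R) (l m : plane R * plane R) (L M : set (plane R * plane R)).

(** Limits of leaves that do not degenerate to a point of the circle. *)
Definition cl L := [set l | geo l /\ closure L l].
Definition region L p := [set q | int_disc q /\ forall m, L m -> 0 < side m p * side m q].
(** The points that lie on no limit of leaves are those in the interior of their
    region: see [interior_region]. *)
Definition inner L c := int_disc c /\ forall m, cl L m -> side m c != 0.
(** The limit chord l bounds the region of c, and is oriented so that this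
    region is on its left. Being stated with limits of leaves, this depends only
    on [cl L]. *)
Definition adj L c l := [/\ cl L l, 0 < side l c &
  forall m p, cl L m -> ch l p -> 0 <= side m c * side m p].
Definition beyond L l := [set m | L m /\ ch m `<=` left_of l].
Definition accum L l := closure (beyond L l) l.
Definition carrier M : set pl := \bigcup_(m in M) ch m.

(** The chords of M are parametrised by the closure of M and the unit interval,
    which is compact. A limit that degenerates to a point of the circle does not
    reach the open disc. *)
Lemma carrier_limit M w : M `<=` [set m | circle m.1 /\ circle m.2] ->
  int_disc w -> closure (carrier M) w -> exists m, [/\ closure M m, geo m & ch m w].
Proof.
move=> MC iw.
pose f := fun x : (pl * pl) * R => seg x.1.1 x.1.2 x.2.
have cf : continuous f.
  by apply: seg_cont => x; [apply: (continuous_comp (f := fst) (g := fst))|apply: (continuous_comp (f := fst) (g := snd))|]; exact: cfst || exact: csnd.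
have clC : closure M `<=` circle (R:=R) `*` circle (R:=R).
  apply: clos_min; last by move=> m /MC [].
  by apply: compact_closed; [exact: norm_hausdorff|apply: compact_setX; exact: circle_compact].
have cM : compact (closure M).
  apply: (subclosed_compact (@closed_closure _ M) (compact_setX (@circle_compact R) (@circle_compact R))).
  exact: clC.
have cK : compact (f @` (closure M `*` `[0, 1])).
  apply: continuous_compact; first exact: continuous_subspaceT.
  by apply: compact_setX => //; exact: segment_compact.
have cK' := compact_closed (@plane_hausdorff R) cK.
move=> /(clos_min cK') []; last first.
  move=> [m t] [/= Mm]; rewrite in_itv /= => /andP[t0 t1] E.
  have [c1 c2] := clC _ Mm.
  have nd p : circle p -> int_disc p -> False by move=> /circ_n2 a /discP; rewrite a ltxx.
  have n : m.1 <> m.2.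
    move=> e; apply: (nd w) => //; rewrite -E /f /= -e.
    by rewrite (_ : seg _ _ _ = m.1) //; apply: plane_eq; rewrite ?(seg1E, seg2E); ring.
  exists m; split => //; apply/chP; exists t => //; apply/andP; split.
    by rewrite lt_neqAle t0 andbT; apply/eqP => e; apply: (nd w) => //; rewrite -E /f /= -e seg0.
  by rewrite lt_neqAle t1 andbT; apply/eqP => e; apply: (nd w) => //; rewrite -E /f /= e seg_1.
move=> p [m Mm /chP [t /andP[t0 t1] ->]]; exists (m, t) => //; split => /=.
  exact: subset_closure.
by rewrite in_itv /= !ltW.
Qed.

Lemma limit_carrier M m w : closure M m -> ch m w -> closure (carrier M) w.
Proof.
move=> cm /chP [t t01 E] U nU.
have c : continuous (fun m : pl * pl => seg m.1 m.2 t).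
  by apply: seg_cont; [exact: cfst|exact: csnd|exact: cont_c].
have : \forall m' \near m, U (seg m'.1 m'.2 t) by apply: c; rewrite -E.
move=> /cm [m' [Mm' Um']]; exists (seg m'.1 m'.2 t); split => //.
by exists m' => //; apply/chP; exists t.
Qed.

Lemma flip_cont : continuous (@flip R).
Proof.
by move=> x; have H := cvg_pair (@csnd pl pl x) (@cfst pl pl x); exact: H.
Qed.

Lemma closure_flip L : (forall l, L l -> L (flip l)) -> forall l, closure L l -> closure L (flip l).
Proof.
move=> Lf l cl U /flip_cont nU; have [m [Lm Um]] := cl _ nU.
by exists (flip m); split => //; exact: Lf.
Qed.

Section Fixed.
Variable L : set (pl * pl).
Hypothesis PL : pre_lamination L.

Lemma pl_geo l : L l -> geo l.
Proof. by case: PL => h _ _; case: l => a b; apply: h. Qed.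
Lemma pl_flip l : L l -> L (flip l).
Proof. by case: PL => _ h _; case: l => a b; apply: h. Qed.
Lemma pl_same l m : same l m -> L l -> L m.
Proof. by case=> -> //; exact: pl_flip. Qed.
Lemma pl_noncross l m : L l -> L m -> noncross l m.
Proof.
by move=> Ll Lm; case: PL => _ _ h; apply: noncross_of_not_cross; [exact: pl_geo|exact: pl_geo|exact: h].
Qed.
Lemma cl_geo l : cl L l -> geo l. Proof. by case. Qed.
Lemma leaf_cl l : L l -> cl L l.
Proof. by move=> Ll; split; [exact: pl_geo|exact: subset_closure]. Qed.
Lemma cl_flip l : cl L l -> cl L (flip l).
Proof. by move=> [g c]; split; [exact: geo_flip|apply: closure_flip => //; exact: pl_flip]. Qed.

Lemma closure_noncross l m : closure L l -> closure L m -> noncross l m.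
Proof.
move=> cl; apply: (@clos_min _ L [set m | noncross l m]) => [|{}m Lm].
  apply: closed_ge0; apply: cont_M.
    by move=> x; apply: (continuous_comp (f := fst) (g := side l)); [exact: cfst|exact: side_cont_p].
  by move=> x; apply: (continuous_comp (f := snd) (g := side l)); [exact: csnd|exact: side_cont_p].
move: l cl; apply: (@clos_min _ L [set l | noncross l m]) => [|l Ll]; last exact: pl_noncross.
by apply: closed_ge0; apply: cont_M; exact: side_cont_l.
Qed.

Lemma cl_sides l m : cl L l -> cl L m ->
  [\/ same l m, ch m `<=` left_of l | ch m `<=` left_of (flip l)].
Proof. by move=> [gl c1] [gm c2]; apply: noncross_sides => //; exact: closure_noncross. Qed.

Lemma cl_sign l m p q : cl L l -> cl L m -> ~ same l m -> ch m p -> ch m q ->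
  0 < side l p * side l q.
Proof.
move=> cl cm ns hp hq; case: (cl_sides cl cm) => // s.
  by rewrite mulr_gt0//; [case: (s _ hp)|case: (s _ hq)].
by case: (s _ hp); case: (s _ hq); rewrite !side_flip; nra.
Qed.
Lemma cl_side_ne l m p : cl L l -> cl L m -> ~ same l m -> ch m p -> side l p != 0.
Proof.
move=> a b ns h; have := cl_sign a b ns h h; rewrite -expr2.
by rewrite lt_neqAle eq_sym sqrf_eq0 => /andP[].
Qed.
Lemma cl_meet l m p : cl L l -> cl L m -> ch l p -> ch m p -> same l m.
Proof.
move=> a b hl hm; apply: contrapT => ns.
by have := cl_side_ne a b ns hm; rewrite (side_ch hl) eqxx.
Qed.
Lemma cl_pos l m p : cl L l -> cl L m -> ch m p -> 0 < side l p -> ch m `<=` left_of l.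
Proof.
move=> a b hp h; case: (cl_sides a b) => // s.
  by move: h; rewrite (same_sd0 (same_sym s)) ?ltxx//; exact: side_ch.
by have := s _ hp; case; rewrite side_flip; lra.
Qed.
Lemma cl_neg l m p : cl L l -> cl L m -> ch m p -> side l p < 0 -> ch m `<=` left_of (flip l).
Proof.
by move=> a b hp h; apply: (cl_pos (cl_flip a) b hp); rewrite side_flip oppr_gt0.
Qed.

Lemma cl_ge0 c p : (forall m, L m -> 0 <= side m c * side m p) ->
  forall m, closure L m -> 0 <= side m c * side m p.
Proof.
move=> h; apply: clos_min => [|m /h //].
by apply: closed_ge0; apply: cont_M; exact: side_cont_l.
Qed.

Lemma inner_off c m : inner L c -> L m -> side m c != 0.
Proof. by move=> [_ h] /leaf_cl /h. Qed.

Lemma adjI c l : cl L l -> 0 < side l c ->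
  (forall m p, L m -> ch l p -> 0 <= side m c * side m p) -> adj L c l.
Proof.
move=> a b h; split=> // m p [_ cm] hp; apply: (@cl_ge0 c p) => // k Lk; exact: h.
Qed.

(** If points of leaves accumulated at w, then w would be on a limit of leaves
    by [carrier_limit]; and a ball that meets no leaf is on one side of each
    leaf. *)
Lemma free_nbhs w : inner L w -> \forall q \near w,
  int_disc q /\ forall m, L m -> 0 < side m w * side m q.
Proof.
move=> [iw ow].
have nc : ~ closure (carrier L) w.
  move=> h; have [|m [cm gm hw]] := carrier_limit _ iw h.
    by move=> m /pl_geo [].
  by have := ow m (conj gm cm); rewrite (side_ch hw) eqxx.
have [U [nU fU]] : exists U, nbhs w U /\ carrier L `&` U = set0.
  apply: contrapT => h; apply: nc => U nU; apply/set0P/eqP => e; apply: h; by exists U.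
have : nbhs w (U `&` @int_disc R).
  by apply: filterI => //; apply: open_nbhs_nbhs; split=> //; exact: disc_open.
case/nbhs_ballP => e /= e0 h; apply/nbhs_ballP; exists e => //= q bq.
split; first by case: (h q bq).
move=> m Lm; rewrite ltNge; apply/negP => neg.
have seg_in t : 0 <= t <= 1 -> ball w e (seg w q t).
  move=> /andP[t0 t1]; rewrite -ball_normE /ball_ /=.
  rewrite sub_seg normrZ ger0_norm//; move: bq; rewrite -ball_normE /ball_ /= => bq.
  by apply: le_lt_trans bq; rewrite ler_piMl.
have off t : 0 <= t <= 1 -> side m (seg w q t) != 0.
  move=> t01; apply/eqP => z.
  have [Ut it] := h _ (seg_in t t01).
  have : (carrier L `&` U) (seg w q t).
    by split => //; exists m => //; apply: disc_ch => //; exact: pl_geo.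
  by rewrite fU.
have o0 := off 0; have o1 := off 1; rewrite seg0 lexx ler01 in o0; rewrite seg_1 ler01 lexx in o1.
have neg' : side m w * side m q < 0.
  by rewrite lt_neqAle neg andbT mulf_neq0// ?o0 ?o1.
have [t /andP[t0 t1] z] := affine_zero neg'.
by have := off t; rewrite z eqxx !ltW// => /(_ isT).
Qed.

Lemma beyond_near l c : geo l -> 0 < side l c -> \forall m \near l,
  (geo m -> ch m `<=` left_of l -> 0 < side m c /\ forall w, ch l w -> side m w < 0).
Proof.
move=> gl h.
have [e [ie he]] := half_ex (geo_flip gl); rewrite side_flip oppr_gt0 in he.
have n1 : \forall m \near l, 0 < side m c by apply: near_gt0 => //; exact: side_cont_l.
have n2 : \forall m \near l, side m e < 0 by apply: near_lt0 => //; exact: side_cont_l.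
near=> m => gm s.
have m1 : 0 < side m c by near: m.
have m2 : side m e < 0 by near: m.
split=> // w hw; rewrite ltNge; apply/negP => ge.
have iw := ch_disc gl hw.
move: ge; rewrite le_eqVlt => /predU1P[z|ge].
  by have := s w (disc_ch gm iw (esym z)); case; rewrite (side_ch hw) ltxx.
have [t /andP[t0 t1] z] : exists2 t, 0 < t < 1 & side m (seg w e t) = 0.
  by apply: affine_zero; rewrite pmulr_rlt0.
have [_] : left_of l (seg w e t).
  apply: s; apply: disc_ch => //; apply: disc_seg => //; by rewrite !ltW.
by rewrite side_seg (side_ch hw); nra.
Unshelve. all: by end_near.
Qed.

Lemma accum_cl l : geo l -> accum L l -> cl L l.
Proof. by move=> g h; split => //; apply: closureS h => m []. Qed.

Lemma accum_near l c : geo l -> accum L l -> 0 < side l c -> forall U, nbhs l U ->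
  exists m, [/\ L m, ch m `<=` left_of l, U m, 0 < side m c & forall w, ch l w -> side m w < 0].
Proof.
move=> gl al h U nU.
have [m [[Lm s] [Um /(_ (pl_geo Lm) s) [a b]]]] := al _ (filterI nU (beyond_near gl h)).
by exists m.
Qed.

(** If leaves do not accumulate on the left of l, a small half-disc on the left
    of the midpoint of l meets no leaf, by [carrier_limit]. Its points are in
    one region, and this region is adjacent to l. *)
Lemma accum_or_adj l : cl L l -> accum L l \/ exists2 c, inner L c & adj L c l.
Proof.
move=> cll; have gl := cl_geo cll; have [al|nal] := pselect (accum L l); first by left.
right; pose w := mid l.
have hw : ch l w := ch_mid l.
have iw := ch_disc gl hw.
have nc : ~ closure (carrier (beyond L l)) w.
  move=> h; have [|m [cm gm hm]] := carrier_limit _ iw h.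
    by move=> m [/pl_geo []].
  have cm' : cl L m by split => //; apply: closureS cm => k [].
  have pf : forall k, beyond L l k -> beyond L l (flip k).
    by move=> k [a b]; split; [exact: pl_flip|rewrite ch_flip].
  case: (cl_meet cll cm' hw hm) => E; apply: nal; first by rewrite E in cm.
  by have := closure_flip pf cm; rewrite E flipK.
have [U [nU fU]] : exists U, nbhs w U /\ carrier (beyond L l) `&` U = set0.
  apply: contrapT => h; apply: nc => U nU; apply/set0P/eqP => e; apply: h; by exists U.
have : nbhs w (U `&` @int_disc R).
  by apply: filterI => //; apply: open_nbhs_nbhs; split=> //; exact: disc_open.
case/nbhs_ballP => e /= e0 h.
have [n hn] := half_ex gl.
have key q : ball w e q -> 0 < side l q -> forall m, L m -> side m q != 0.
  move=> bq sq m Lm; apply/eqP => z; have [Uq iq] := h _ bq.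
  have hq : ch m q by apply: disc_ch => //; exact: pl_geo.
  have : (carrier (beyond L l) `&` U) q.
    by split => //; exists m => //; split => //; apply: (cl_pos cll (leaf_cl Lm) hq sq).
  by rewrite fU.
have [s [s0 s1 bs]] : exists s, [/\ 0 < s, s < 1 & forall t, 0 <= t <= s -> ball w e (seg w n t)].
  have nz : 0 < `|w - n| + 1 by rewrite ltr_wpDl.
  exists (Num.min (2^-1) (e / (`|w - n| + 1) / 2)); split.
  - by rewrite lt_min; apply/andP; split; rewrite ?divr_gt0//; lra.
  - by rewrite gt_min; apply/orP; left; lra.
  move=> t /andP[t0]; rewrite le_min => /andP[_ t1]; rewrite -ball_normE /ball_ /=.
  rewrite sub_seg normrZ ger0_norm//.
  have : t * (`|w - n| + 1) <= e / 2.
    by rewrite -ler_pdivlMr// mulrAC.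
  by have := normr_ge0 (w - n); nra.
(* The point c is close enough to w for the segment from w to c to meet no leaf
   except perhaps l. *)
pose c := seg w n s.
have sc t : 0 < t -> 0 < side l (seg w n t).
  by move=> t0; rewrite side_seg (side_ch hw) mulr0 add0r mulr_gt0//; case: hn.
have bc : ball w e c by apply: bs; rewrite lexx ltW.
have ic : int_disc c by case: (h _ bc).
exists c.
  split => // m cm; apply/eqP => z.
  have hc : ch m c by apply: disc_ch => //; exact: cl_geo.
  have clc := limit_carrier cm.2 hc.
  have nU' : nbhs c [set q | ball w e q /\ 0 < side l q].
    apply: filterI; first by apply: open_nbhs_nbhs; split => //; exact: ball_open.
    by apply: (near_gt0 (@side_cont_p R l)); exact: sc.
  have [q [[k Lk hq] [bq sq]]] := clc _ nU'.
  by have := key q bq sq k Lk; rewrite (side_ch hq) eqxx.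
apply: adjI => //; first exact: sc.
move=> m p Lm hp.
have [s'|ns] := pselect (same l m).
  by rewrite (same_sd0 s' (side_ch hp)) mulr0.
have pos := cl_sign (leaf_cl Lm) cll (fun h => ns (same_sym h)) hw hp.
have wc : 0 < side m w * side m c.
  rewrite ltNge; apply/negP => neg.
  have wne := cl_side_ne (leaf_cl Lm) cll (fun h => ns (same_sym h)) hw.
  have cne := key c bc (sc s s0) m Lm.
  have neg' : side m w * side m c < 0.
    by rewrite lt_neqAle neg andbT mulf_neq0.
  have [t /andP[t0 t1] z] := affine_zero neg'.
  have E : seg w c t = seg w n (t * s).
    by apply: plane_eq; rewrite ?(seg1E, seg2E); ring.
  have ts : 0 < t * s by exact: mulr_gt0.
  have ts' : 0 <= t * s <= s by rewrite ltW//= ler_piMl// ltW.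
  by have := key _ (bs _ ts') (sc _ ts) m Lm; rewrite -E z eqxx.
apply: ltW; nra.
Qed.

(** A leaf close to l on its left separates l from c. *)
Lemma accum_not_adj l c : accum L l -> adj L c l -> False.
Proof.
move=> al [[gl cll] sc h].
have [m [Lm s _ mc mw]] := accum_near gl al sc filterT.
have := h m _ (leaf_cl Lm) (ch_mid l); have := mw _ (ch_mid l); nra.
Qed.

Lemma region_refl p : int_disc p -> (forall m, L m -> side m p != 0) -> region L p p.
Proof.
by move=> ip h; split => // m /h ne; rewrite -expr2 lt_neqAle sqr_ge0 eq_sym sqrf_eq0 ne.
Qed.

Lemma region_eq p q : region L p q -> region L q = region L p.
Proof.
move=> [iq h]; apply/seteqP; split=> z [iz hz]; split => // m Lm.
  exact: pos_trans (h m Lm) (hz m Lm).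
by apply: pos_trans (hz m Lm); rewrite mulrC; exact: h.
Qed.

Lemma regionP A : complementary_region L A <->
  exists p, [/\ int_disc p, forall m, L m -> side m p != 0 & A = region L p].
Proof.
set S := @int_disc R `\` \bigcup_(g in leaves L) g.
have SE p : S p <-> int_disc p /\ forall m, L m -> side m p != 0.
  split=> [[ip np]|[ip h]]; split => //.
    move=> m Lm; apply/eqP => z; apply: np; exists (ch m); last by apply: disc_ch => //; exact: pl_geo.
    by exists m.1, m.2; split => //; case: m Lm {z}.
  by move=> [g [x [y [Lxy ->]]] /(side_ch (l := (x, y))) z]; have := h _ Lxy; rewrite z eqxx.
have cE p : S p -> connected_component S p = region L p.
  move=> Sp; have [ip op] := (SE p).1 Sp; apply: comp_eq.
  - move=> q [iq hq] t t01; split; first exact: disc_seg.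
    move=> m Lm; rewrite side_seg mulrDr !mulrA ![side m p * _]mulrC -!mulrA.
    by apply: conv_pos => //; [have [_] := region_refl ip op; apply|exact: hq].
  - move=> q [iq hq]; apply/SE; split => // m Lm; apply/eqP => z.
    by have := hq m Lm; rewrite z mulr0 ltxx.
  - exact: region_refl.
  move=> q /SE [iq oq] nq.
  have [m [Lm hm]] : exists m, L m /\ ~ (0 < side m p * side m q).
    apply: contrapT => h; apply: nq; split => // m Lm; apply: contrapT => h'; apply: h; by exists m.
  have pos : forall z, S z -> side m z != 0 by move=> z /SE [_]; apply.
  have := op m Lm; case/lt_total/orP => sp.
    apply: (sep_side (l := flip m)) => [z /pos||].
    - by rewrite side_flip oppr_eq0.
    - by rewrite side_flip oppr_gt0.
    - rewrite side_flip oppr_gt0 => sq; apply: hm; nra.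
  apply: (sep_side (l := m)) => // sq; apply: hm; exact: mulr_gt0.
split=> [[p [Sp ->]]|[p [ip op ->]]].
  by exists p; have [a b] := (SE p).1 Sp; split => //; exact: cE.
have Sp : S p by apply/SE.
by exists p; split => //; rewrite cE.
Qed.

End Fixed.
End Lam.

(** * Boundary components *)

Section Reg.
Variable R : realType.
Notation pl := (plane R).
Implicit Types (p q w z c : plane R) (l m k : plane R * plane R) (L M : set (plane R * plane R)).

Definition open_region L c := [set q : pl | int_disc q /\ forall m, cl L m -> 0 < side m c * side m q].
Definition closed_region L c := [set q : pl | n2 q <= 1 /\ forall m, cl L m -> 0 <= side m c * side m q].

Lemma closed_limit (A : set pl) q c : (forall s, 0 < s <= 1 -> A (seg q c s)) -> closure A q.
Proof.
move=> h U nU.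
have cs : continuous (fun t => seg q c t) by apply: seg_cont; [exact: cont_c|exact: cont_c|exact: cont_id].
have : \forall t \near (0:R), U (seg q c t) by apply: cs; rewrite seg0.
case/nbhs_ballP => e /= e0 he; pose t := Num.min 1 (e / 2).
have t0 : 0 < t by rewrite lt_min ltr01 divr_gt0.
exists (seg q c t); split; first by apply: h; rewrite t0 ge_min lexx.
by apply: he; rewrite /ball /= sub0r normrN gtr0_norm// gt_min; apply/orP; right; lra.
Qed.

Lemma end_closure l : closure (ch l) l.1 /\ closure (ch l) l.2.
Proof.
have h (a b : pl) : closure (chord a b) a.
  apply: (@closed_limit _ _ (seg a b (2^-1))) => s /andP[s0 s1]; apply/(chP (a, b)).
  exists (s / 2); first by lra.
  by apply: plane_eq; rewrite ?(seg1E, seg2E) /= ?(seg1E, seg2E); ring.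
split; first by rewrite /ch; exact: h.
by rewrite -ch_flip /ch; exact: h.
Qed.

(** The right sides of two chords that are on the left of each other are
    disjoint: the segment from a point of l to a common point p would meet m at
    a point on the right of l. *)
Lemma facing_disjoint l m p : geo l -> geo m -> ch m `<=` left_of l -> ch l `<=` left_of m ->
  n2 p <= 1 -> side l p < 0 -> side m p < 0 -> False.
Proof.
move=> gl gm s1 s2 np l1 m1.
have [i0 m0] := s2 _ (ch_mid l).
have [t /andP[t0 t1] z] : exists2 t, 0 < t < 1 & side m (seg (mid l) p t) = 0.
  by apply: affine_zero; rewrite pmulr_rlt0.
have [_] : left_of l (seg (mid l) p t).
  by apply: s1; apply: disc_ch => //; apply: disc_seg_cl => //; rewrite t1 ltW.
by rewrite side_seg (side_ch (ch_mid l)); nra.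
Qed.

Lemma adj_cl L c l : adj L c l -> cl L l. Proof. by case. Qed.
Lemma adj_pos L c l : adj L c l -> 0 < side l c. Proof. by case. Qed.

Section Fixed.
Variable L : set (pl * pl).
Hypothesis PL : pre_lamination L.

Lemma inner_sq c m : inner L c -> cl L m -> 0 < side m c * side m c.
Proof. by move=> [_ h] /h ne; rewrite -expr2 lt_neqAle sqr_ge0 eq_sym sqrf_eq0 ne. Qed.

Lemma inner_region c : inner L c -> region L c c.
Proof.
by move=> ic; split; [case: ic|move=> m Lm; apply: inner_sq => //; exact: leaf_cl].
Qed.

Lemma interior_region p : int_disc p -> (forall m, L m -> side m p != 0) ->
  (region L p)° = [set q | region L p q /\ inner L q].
Proof.
move=> ip op; apply/seteqP; split=> q.
  move=> hq; have hA := interior_subset hq; split => //; split; first by case: hA.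
  move=> m cm; apply/eqP => z.
  have hm : ch m q by apply: disc_ch => //; [exact: cl_geo cm|case: hA].
  have [r [[k Lk hk] [_ /(_ k Lk)]]] := limit_carrier cm.2 hm hq.
  by rewrite (side_ch hk) mulr0 ltxx.
move=> [hA hi]; apply: filterS (free_nbhs PL hi) => r hr.
by rewrite -(region_eq hA).
Qed.

Lemma open_region_inner c q : inner L c -> open_region L c q -> inner L q.
Proof.
move=> ic [iq h]; split => // m cm; apply/eqP => z.
by have := h m cm; rewrite z mulr0 ltxx.
Qed.

Lemma interior_open_region c : inner L c -> (region L c)° = open_region L c.
Proof.
move=> ic; rewrite interior_region //; [|by case: ic|by move=> m; exact: inner_off].
apply/seteqP; split=> q.
  move=> [[iq h] [_ hq]]; split => // m cm.
  rewrite lt_neqAle (cl_ge0 _ cm.2) ?andbT; last by move=> k Lk; apply/ltW/h.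
  by rewrite eq_sym mulf_neq0 ?hq//; have [_] := ic; apply.
move=> hq; split; last exact: open_region_inner hq.
by case: hq => iq h; split => // m Lm; apply: h; exact: leaf_cl.
Qed.

(** Strict inequalities at c and weak ones at q give strict ones between them;
    so a closed region is the closure of its interior. *)
Lemma closed_region_seg c q s : inner L c -> closed_region L c q -> 0 < s <= 1 -> open_region L c (seg q c s).
Proof.
move=> ic [nq h] /andP[s0 s1]; split.
  by rewrite segC; apply: disc_seg_cl => //; [case: ic|lra].
move=> m cm; rewrite side_seg mulrDr.
have := h m cm; have := inner_sq ic cm; have : 0 <= 1 - s by lra.
move=> a b d; have -> : side m c * ((1 - s) * side m q) + side m c * (s * side m c) =
  (1 - s) * (side m c * side m q) + s * (side m c * side m c) by ring.
by apply: ltr_wpDl; [exact: mulr_ge0|exact: mulr_gt0].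
Qed.

Lemma open_region_region c : inner L c -> open_region L c `<=` region L c.
Proof. by move=> ic; rewrite -interior_open_region//; exact: interior_subset. Qed.

Lemma closed_region_closed c : closed (closed_region L c).
Proof.
have -> : closed_region L c = [set q : pl | n2 q <= 1] `&`
    \bigcap_(m in cl L) [set q | 0 <= side m c * side m q].
  by apply/seteqP; split=> q [a b]; split.
apply: closedI; first exact: cdisc_closed.
apply: closed_bigI => m cm; apply: closed_ge0; apply: cont_M; first exact: cont_c.
exact: side_cont_p.
Qed.

Lemma region_closed_region c : region L c `<=` closed_region L c.
Proof.
move=> q [iq h]; split; first exact/ltW/discP.
by move=> m [_ cm]; apply: cl_ge0 cm => k Lk; exact/ltW/h.
Qed.

Lemma closure_region c : inner L c -> closure (region L c) = closed_region L c.
Proof.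
move=> ic; apply/seteqP; split.
  by apply: clos_min; [exact: closed_region_closed|exact: region_closed_region].
move=> q hq; apply: (@closed_limit _ _ c) => s s01; apply: open_region_region => //.
exact: closed_region_seg.
Qed.

Definition bdry c := @int_disc R `&` (closure (region L c) `\` (region L c)°).

Lemma adj_closed_region c l : adj L c l -> ch l `<=` closed_region L c.
Proof.
move=> [cll _ h] q hq; split; last by move=> m cm; exact: h.
exact/ltW/discP/(ch_disc (cl_geo cll) hq).
Qed.

Lemma adj_cl_closed_region c l : adj L c l -> closure (ch l) `<=` closed_region L c.
Proof. by move=> a; apply: clos_min; [exact: closed_region_closed|exact: adj_closed_region]. Qed.

Lemma closed_region_adj c m z : inner L c -> cl L m -> ch m z -> closed_region L c z ->
  adj L c m \/ adj L c (flip m).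
Proof.
move=> ic cm hz [_ h].
have key l : cl L l -> ch l z -> 0 < side l c -> adj L c l.
  move=> cll hl sc; split => // k p ck hp.
  have [s|ns] := pselect (same k l).
    by rewrite (same_sd0 (same_sym s) (side_ch hp)) mulr0.
  rewrite mulrC; apply: pos_ge_trans (cl_sign PL ck cll ns hp hl) _.
  by rewrite mulrC; exact: h.
have := ic.2 m cm; case/lt_total/orP => sc.
  by right; apply: key; [exact: cl_flip|rewrite ch_flip|rewrite side_flip oppr_gt0].
by left; exact: key.
Qed.

Lemma bdryP c z : inner L c -> bdry c z <-> exists l, adj L c l /\ ch l z.
Proof.
move=> ic; rewrite /bdry closure_region// interior_open_region//; split.
  move=> [iz [hc ni]].
  have [m [cm e]] : exists m, cl L m /\ side m z = 0.
    apply: contrapT => h; apply: ni; split => // m cm.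
    rewrite lt_neqAle hc.2// andbT eq_sym mulf_neq0//; first by have [_] := ic; apply.
    by apply/eqP => z0; apply: h; exists m.
  have hz : ch m z by apply: disc_ch => //; exact: cl_geo cm.
  case: (closed_region_adj ic cm hz hc) => a; first by exists m.
  by exists (flip m); rewrite ch_flip.
move=> [l [a hz]]; split; first exact: ch_disc (cl_geo (adj_cl a)) hz.
split; first exact: adj_closed_region a _ hz.
by move=> [_ /(_ l)]; case: a => a _ _ /(_ a); rewrite (side_ch hz) mulr0 ltxx.
Qed.

(** A boundary point in the open triangle with base l and apex c lies on l:
    otherwise it would be on a segment from c to a point of l, and the boundary
    chord through it would separate them. So l is open and closed in the
    boundary. *)
Lemma bdry_comp c l z : inner L c -> adj L c l -> ch l z ->
  connected_component (bdry c) z = ch l.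
Proof.
move=> ic al hz; have [cll lc al3] := al; have gl := cl_geo cll.
(* V is the open angle with apex c and opening l. *)
pose V := [set w : pl | 0 < side (c, l.1) w] `&` [set w | 0 < side (l.2, c) w].
have chV w : ch l w -> V w.
  case/chP => t /andP[t0 t1] ->; rewrite /V /=; split; rewrite /= side_seg.
    have -> : side (c, l.1) l.1 = 0 by rewrite /side /=; ring.
    have -> : side (c, l.1) l.2 = side l c by rewrite /side /=; ring.
    by rewrite mulr0 add0r mulr_gt0.
  have -> : side (l.2, c) l.2 = 0 by rewrite /side /=; ring.
  have -> : side (l.2, c) l.1 = side l c by rewrite /side /=; ring.
  by rewrite mulr0 addr0 mulr_gt0// subr_gt0.
have VF : bdry c `&` V `<=` ch l.
  move=> w [/(bdryP _ ic)[k [ak hk]] [/= a b]].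
  have iw := ch_disc (cl_geo (adj_cl ak)) hk.
  apply: disc_ch => //; apply/eqP; rewrite eq_le; apply/andP; split; last first.
    by have [_ /(_ l cll)] := adj_closed_region ak hk; rewrite pmulr_rge0.
  rewrite leNgt; apply/negP => sw.
  (* The point of l in which the ray from c through w meets it; the two sides
     are barycentric coordinates of w. *)
  pose p := seg l.1 l.2 (side (c, l.1) w / (side (c, l.1) w + side (l.2, c) w)).
  have ab : 0 < side (c, l.1) w + side (l.2, c) w by exact: addr_gt0.
  have hp : ch l p.
    apply/chP; eexists; last reflexivity; rewrite divr_gt0//= ltr_pdivrMr// mul1r; lra.
  have E : side l c = side l w + (side (c, l.1) w + side (l.2, c) w) by rewrite /side /=; ring.
  have wE : w = seg c p ((side (c, l.1) w + side (l.2, c) w) / side l c).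
    have lc0 : side l c != 0 by rewrite gt_eqF.
    have ab0 : side (c, l.1) w + side (l.2, c) w != 0 by rewrite gt_eqF.
    have I1 : w.1 * side l c = side l w * c.1 + side (l.2, c) w * l.1.1 + side (c, l.1) w * l.2.1.
      by rewrite /side /=; ring.
    have I2 : w.2 * side l c = side l w * c.2 + side (l.2, c) w * l.1.2 + side (c, l.1) w * l.2.2.
      by rewrite /side /=; ring.
    have E' : side l w = side l c - (side (c, l.1) w + side (l.2, c) w) by lra.
    rewrite E' in I1 I2.
    apply: plane_eq; rewrite /p !(seg1E, seg2E); apply: (mulIf lc0); rewrite ?I1 ?I2;
    move: (side (c, l.1) w) (side (l.2, c) w) (side l c) lc0 ab0 => x y u u0 xy; field; by rewrite ?u0 ?xy.
  have [ck kc _] := ak.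
  have kw : side k w = 0 := side_ch hk.
  have kp : 0 <= side k p.
    by have := al3 k p ck hp; rewrite pmulr_rge0.
  have : 0 < side k w; last by rewrite kw ltxx.
  rewrite wE side_seg.
  have r0 : 0 < (side (c, l.1) w + side (l.2, c) w) / side l c by exact: divr_gt0.
  have r1 : 0 < 1 - (side (c, l.1) w + side (l.2, c) w) / side l c.
    by rewrite subr_gt0 ltr_pdivrMr// mul1r; lra.
  by rewrite ltr_pwDl ?mulr_gt0// mulr_ge0// ltW.
apply: comp_eq => //.
- move=> q hq t t01; apply: disc_ch => //.
    by apply: disc_seg => //; exact: (ch_disc gl).
  by rewrite side_seg (side_ch hz) (side_ch hq); ring.
- by move=> q hq; apply/bdryP => //; exists l.
- move=> q bq nq; exists V, [set w | side l w = 0]; split.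
  + by apply: openI; apply: open_gt0; exact: side_cont_p.
  + by apply: closed_eq0; exact: side_cont_p.
  + apply/seteqP; split=> w [bw hw]; split => //; first exact/side_ch/VF.
    by apply: chV; apply: disc_ch => //; case: bw.
  + exact: chV.
  + by move=> Vq; apply: nq; exact: VF.
Qed.

Lemma bcP c B : inner L c ->
  boundary_component (region L c) B <-> exists l, adj L c l /\ B = ch l.
Proof.
move=> ic; split.
  move=> [z [/(bdryP _ ic)[l [al hz]] ->]]; exists l; split => //; exact: bdry_comp.
move=> [l [al ->]]; exists (mid l); split.
  by apply/bdryP => //; exists l; split => //; exact: ch_mid.
by rewrite -(bdry_comp ic al (ch_mid l)).
Qed.

(** Each point q of the region lies on a limit of leaves. If q were off the
    chord m through p, the limit through the midpoint of p and q would separate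
    p from q, and so would a leaf close to it. *)
Lemma thin_region p : int_disc p -> (forall m, L m -> side m p != 0) ->
  (forall q, region L p q -> ~ inner L q) -> exists l, [/\ cl L l, ~ L l & region L p = ch l].
Proof.
move=> ip op no.
have ex q : region L p q -> exists m, cl L m /\ ch m q.
  move=> hq; have := no q hq; apply: contra_notP => h; split; first by case: hq.
  move=> m cm; apply/eqP => z; apply: h; exists m; split => //.
  by apply: disc_ch => //; [exact: cl_geo cm|case: hq].
have rp : region L p p := region_refl ip op.
have [m [cm hm]] := ex p rp.
have nsL k : L k -> ~ same k m.
  by move=> Lk s; have := op k Lk; rewrite (same_sd0 (same_sym s) (side_ch hm)) eqxx.
exists m; split => //; first by move=> Lm; apply: (nsL m Lm); exact: same_refl.
apply/seteqP; split=> q; last first.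
  move=> hq; split; first exact: ch_disc (cl_geo cm) hq.
  by move=> k Lk; exact: cl_sign (leaf_cl PL Lk) cm (nsL k Lk) hm hq.
move=> hq; apply: contrapT => nq.
have iq : int_disc q by case: hq.
have mq : side m q != 0 by apply/eqP => z; apply: nq; apply: disc_ch => //; exact: cl_geo cm.
have [m' [cm' hm']] := ex q hq.
have ns' : ~ same m m'.
  by move=> s; apply: nq; rewrite -(same_ch s).
pose z := seg p q (2^-1).
have rz : region L p z.
  split; first by apply: disc_seg => //; lra.
  move=> k Lk; rewrite side_seg mulrDr !mulrA ![side k p * _]mulrC -!mulrA.
  by apply: conv_pos; [case: rp => _; apply|case: hq => _; apply|lra].
have [k [ck hk]] := ex z rz.
have kz := side_ch hk.
have kp : side k p != 0.
  apply/eqP => e; have hp : ch k p by apply: disc_ch => //; exact: cl_geo ck.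
  have s := cl_meet PL cm ck hm hp.
  have := same_sd0 (same_sym s) kz; rewrite /z side_seg (side_ch hm) mulr0 add0r => /eqP.
  by rewrite mulf_eq0 (negbTE mq) orbF invr_eq0 pnatr_eq0.
have neg : side k p * side k q < 0.
  have E : side k q = - side k p by move: kz; rewrite /z side_seg; lra.
  by rewrite E mulrN oppr_lt0 -expr2 lt_neqAle sqr_ge0 eq_sym sqrf_eq0 kp.
have c : continuous (fun k => side k p * side k q) by apply: cont_M; exact: side_cont_l.
have [k' [Lk' h]] := ck.2 _ (near_lt0 c neg).
have [_ /(_ k' Lk')] := hq; move: h => /=; lra.
Qed.

Lemma thin_bc l B : geo l -> (ch l)° = set0 -> boundary_component (ch l) B <-> B = ch l.
Proof.
move=> gl e.
have S : @int_disc R `&` (closure (ch l) `\` (ch l)°) = ch l.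
  rewrite e setD0; apply/seteqP; split=> z.
    move=> [iz hz]; apply: disc_ch => //.
    have : closure (ch l) `<=` [set z | side l z = 0].
      by apply: clos_min; [apply: closed_eq0; exact: side_cont_p|move=> ?; exact: side_ch].
    exact.
  by move=> hz; split; [exact: ch_disc hz|exact: subset_closure].
have con z : ch l z -> connected_component (ch l) z = ch l.
  move=> hz; apply: comp_eq => //.
  move=> q hq t t01; apply: disc_ch => //; last by rewrite side_seg (side_ch hz) (side_ch hq); ring.
  by apply: disc_seg => //; exact: (ch_disc gl).
rewrite /boundary_component S; split; first by move=> [z [hz ->]]; exact: con.
by move=> ->; exists (mid l); split; [exact: ch_mid|rewrite con//; exact: ch_mid].
Qed.

(** The segment from c to z leaves the open region at a boundary point, and z is
    beyond the boundary chord through it. *)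
Lemma facing c z : inner L c -> int_disc z -> ~ open_region L c z ->
  exists l, adj L c l /\ side l z <= 0.
Proof.
move=> ic iz nz.
have [w [[t t01 tE] [cw nw]]] : exists w, (seg c z @` `[0, 1]) w /\ (closed_region L c w /\ ~ open_region L c w).
  apply: contrapT => h; apply: nz.
  have E : seg c z @` `[0, 1] `&` open_region L c = seg c z @` `[0, 1].
    apply: (@segment_conn _ c z).
    - exists c; split; first by exists 0; [rewrite /= in_itv /= lexx ler01|exact: seg0].
      by split; [case: ic|move=> m; exact: inner_sq].
    - by exists (open_region L c) => //; rewrite -interior_open_region//; exact: open_interior.
    exists (closed_region L c); first exact: closed_region_closed.
    apply/seteqP; split=> w [bw hw]; split => //.
      by apply: region_closed_region; exact: open_region_region.
    by apply: contrapT => n; apply: h; exists w.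
  have : (seg c z @` `[0, 1]) z by exists 1; [rewrite /= in_itv /= lexx ler01|exact: seg_1].
  by rewrite -E => -[].
move: t01; rewrite /= in_itv /= => t01.
have iw : int_disc w by rewrite -tE; apply: disc_seg => //; case: ic.
have [l [al hl]] : exists l, adj L c l /\ ch l w.
  by apply/bdryP => //; rewrite /bdry closure_region// interior_open_region.
exists l; split => //; rewrite leNgt; apply/negP => lz.
have := side_ch hl; rewrite -tE side_seg => e.
by have := conv_pos (adj_pos al) lz t01; case: al => _ ? _ ; rewrite e ltxx.
Qed.

Lemma facing_leaf c m : inner L c -> cl L m -> exists l, adj L c l /\ side l (mid m) <= 0.
Proof.
move=> ic cm; apply: (facing ic); first exact: (ch_disc (cl_geo cm) (ch_mid m)).
by move=> [_ /(_ _ cm)]; rewrite (side_ch (ch_mid m)) mulr0 ltxx.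
Qed.

(** m is in the closure of the region, hence weakly on the left of l, and it
    does not meet l. *)
Lemma adj_facing c l m : adj L c l -> adj L c m -> ~ same l m -> ch m `<=` left_of l.
Proof.
move=> [cll lc _] [cm _ h] ns.
have pm := ch_mid m.
apply: (cl_pos PL cll cm pm).
have := h l _ cll pm; rewrite pmulr_rge0// => h0.
by rewrite lt_neqAle h0 andbT eq_sym; exact: cl_side_ne cll cm ns pm.
Qed.

Lemma adj_same c l m : adj L c l -> adj L c m -> same l m -> l = m.
Proof.
move=> [_ lc _] [_ mc _] [->//|E]; by move: mc; rewrite E side_flip oppr_gt0 ltNge (ltW lc).
Qed.

(** Two of three chords would have the same end of the segment from e1 to e2 on
    their right, against [facing_disjoint]. So at most two boundary chords of a
    region are close to a given chord. *)
Lemma no_three_cut c l1 l2 l3 e1 e2 : adj L c l1 -> adj L c l2 -> adj L c l3 ->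
  ~ same l1 l2 -> ~ same l1 l3 -> ~ same l2 l3 -> n2 e1 <= 1 -> n2 e2 <= 1 ->
  side l1 e1 * side l1 e2 < 0 -> side l2 e1 * side l2 e2 < 0 -> side l3 e1 * side l3 e2 < 0 -> False.
Proof.
move=> a1 a2 a3 n12 n13 n23 d1 d2 h1 h2 h3.
have F l m e : adj L c l -> adj L c m -> ~ same l m -> n2 e <= 1 -> side l e < 0 -> side m e < 0 -> False.
  move=> al am ns; apply: facing_disjoint; [exact: cl_geo (adj_cl al)|exact: cl_geo (adj_cl am)| |].
    exact: adj_facing al am ns.
  by apply: adj_facing am al _ => /same_sym.
have D (x y : R) : x * y < 0 -> x < 0 \/ y < 0.
  by case: (ltrP x 0); [left|move=> x0 h; right; nra].
by case: (D _ _ h1) => f1; case: (D _ _ h2) => f2; case: (D _ _ h3) => f3;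
  solve [apply: (F l1 l2) f1 f2 => //|apply: (F l1 l3) f1 f3 => //|apply: (F l2 l3) f2 f3 => //].
Qed.

End Fixed.
End Reg.

(** * Long boundary components *)

Section Haus.
Variable R : realType.
Notation pl := (plane R).
Implicit Types (p q w z c : plane R) (l m k g : plane R * plane R) (L M : set (plane R * plane R)).

Lemma norm_ltP p q (e : R) : `|p - q| < e <-> `|p.1 - q.1| < e /\ `|p.2 - q.2| < e.
Proof.
rewrite prod_normE gt_max; split; first by case/andP.
by case=> a b; apply/andP.
Qed.

Lemma edist_norm p q (e : R) : Defs.edist p q < e -> `|p - q| < e.
Proof.
move=> h; apply/norm_ltP; split; apply: le_lt_trans h; rewrite /Defs.edist -sqrtr_sqr;
  apply: ler_wsqrtr; rewrite ?lerDl ?lerDr sqr_ge0//.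
Qed.

Lemma norm_edist p q (e : R) : `|p - q| < e -> Defs.edist p q < 2 * e.
Proof.
move=> /norm_ltP [a b].
have e0 : 0 < e by apply: le_lt_trans a; exact: normr_ge0.
rewrite /Defs.edist -(ger0_norm (_ : 0 <= 2 * e)) ?mulr_ge0 ?ltW// -sqrtr_sqr ltr_sqrt.
  have F (x : R) : `|x| < e -> x ^+ 2 < e ^+ 2.
    by move=> h; rewrite -real_normK ?num_real// ltrXn2r// ?nnegrE ?normr_ge0// ltW.
  have := F _ a; have := F _ b; have : 0 < e ^+ 2 by rewrite exprn_gt0.
  by rewrite exprMn; lra.
by rewrite exprn_gt0// mulr_gt0.
Qed.

Definition hnear (A B : set pl) (e : R) :=
  (forall p, closure A p -> exists q, closure B q /\ `|p - q| < e) /\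
  (forall q, closure B q -> exists p, closure A p /\ `|p - q| < e).

Lemma hcvgP (A : nat -> set pl) B :
  hausdorff_cvg A B <-> forall e, 0 < e -> \forall n \near \oo, hnear (A n) B e.
Proof.
split=> h e e0.
  apply: filterS (h _ e0) => n [h1 h2]; split=> p /[dup] hp.
    by move=> /h1 [q [a b]]; exists q; split => //; exact: edist_norm.
  by move=> /h2 [q [a b]]; exists q; split => //; exact: edist_norm.
have e2 : 0 < e / 2 by rewrite divr_gt0.
apply: filterS (h _ e2) => n [h1 h2]; split=> p /[dup] hp.
  by move=> /h1 [q [a b]]; exists q; split => //; have := norm_edist b; lra.
by move=> /h2 [q [a b]]; exists q; split => //; have := norm_edist b; lra.
Qed.

Lemma closure_chord l q : closure (ch l) q -> exists2 t, 0 <= t <= 1 & q = seg l.1 l.2 t.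
Proof.
have c : compact (seg l.1 l.2 @` `[0, 1]).
  apply: continuous_compact; last exact: segment_compact.
  by apply: continuous_subspaceT; apply: seg_cont; [exact: cont_c|exact: cont_c|exact: cont_id].
have cc := compact_closed (@plane_hausdorff R) c.
have : closure (ch l) `<=` seg l.1 l.2 @` `[0, 1].
  apply: (clos_min cc) => p /chP [t /andP[t0 t1] ->]; exists t => //.
  by rewrite /= in_itv /= !ltW.
by move=> /[apply] -[t]; rewrite /= in_itv /= => t01 <-; exists t.
Qed.

Lemma seg_norm p q z t (e : R) : 0 <= t <= 1 -> `|p - z| < e -> `|q - z| < e ->
  `|seg p q t - z| < e.
Proof.
move=> /andP[t0 t1] hp hq.
have -> : seg p q t - z = (1 - t) *: (p - z) + t *: (q - z).
  by rewrite !scalerBr addrACA -opprD -scalerDl subrK scale1r.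
apply: le_lt_trans (ler_normD _ _) _; rewrite !normrZ !ger0_norm ?subr_ge0//.
case: (ltrP 0 t) => t0'; last first.
  have -> : t = 0 by apply/eqP; rewrite eq_le t0 t0'.
  by rewrite subr0 mul1r mul0r addr0.
apply: (@lt_le_trans _ _ ((1 - t) * e + t * e)); last by rewrite -mulrDl subrK mul1r.
by rewrite ler_ltD// ?ltr_pM2l// ler_wpM2l ?subr_ge0// ltW.
Qed.

Lemma circle_le p : circle p -> n2 p <= 1.
Proof. by move=> /circ_n2 ->. Qed.

(** If s is within d of a point of parameter t of the chord, then t (1 - t) is
    at most of the order of d, since s is on the circle. *)
Lemma ends_near g (e : R) : geo g -> 0 < e -> exists d, 0 < d /\
  forall s q, circle s -> closure (ch g) q -> `|s - q| < d ->
    `|s - g.1| < e \/ `|s - g.2| < e.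
Proof.
move=> gg e0; have D := d2_gt0 gg; exists (Num.min (e / 4) (e * d2 g / 64)); split.
  by rewrite lt_min; apply/andP; split; rewrite divr_gt0 ?mulr_gt0.
set d := Num.min _ _ => s q cs /closure_chord [t t01 qE] h.
have d1 : d <= e / 4 by rewrite ge_min lexx.
have d2' : d <= e * d2 g / 64 by rewrite ge_min lexx orbT.
have [g1 g2 _] := gg.
have nq : n2 q = 1 - t * (1 - t) * d2 g by rewrite qE n2_seg.
case/andP: t01 => t0 t1.
have nq1 : n2 q <= 1 by rewrite nq gerBl !mulr_ge0 ?subr_ge0// ltW.
have ns : n2 s = 1 := (circ_n2 s).1 cs.
have [q1 q2] := coord_le nq1.
have [s1 s2] := coord_le (circle_le cs).
have [g11 g12] := coord_le (circle_le g1).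
have [g21 g22] := coord_le (circle_le g2).
move: h => /norm_ltP; rewrite !ltr_norml => -[/andP[a1 a2] /andP[b1 b2]].
have d0 : 0 < d by lra.
have F (x y : R) : -1 <= x <= 1 -> -1 <= y <= 1 -> - d < x - y -> x - y < d -> x ^+ 2 - y ^+ 2 <= 2 * d.
  move=> /andP[x0 x1] /andP[y0 y1] u v; rewrite subr_sqr.
  apply: le_trans (ler_norm _) _; rewrite normrM mulrC ler_pM ?normr_ge0//.
    by rewrite ler_norml; apply/andP; split; lra.
  by rewrite ler_norml; apply/andP; split; lra.
have B : t * (1 - t) * d2 g <= 4 * d.
  have : n2 s - n2 q <= 4 * d.
    have := F _ _ s1 q1 a1 a2; have := F _ _ s2 q2 b1 b2; rewrite /n2; lra.
  by rewrite ns nq; lra.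
have key (u : R) : 0 <= u -> u <= 2^-1 -> u * (1 - u) * d2 g <= 4 * d -> 2 * u <= e / 4.
  move=> u0 u1 h.
  have : u * 2^-1 * d2 g <= 4 * d.
    by apply: le_trans h; rewrite ler_wpM2r ?(ltW D)// ler_wpM2l//; lra.
  move=> h'; have : u * d2 g <= (e / 8) * d2 g by lra.
  by rewrite ler_pM2r//; lra.
have coord (x y u : R) : 0 <= u -> 2 * u <= e / 4 -> -1 <= x <= 1 -> -1 <= y <= 1 ->
   `|u * (x - y)| <= e / 4.
  move=> u0 h /andP[x0 x1] /andP[y0 y1]; rewrite normrM ger0_norm//.
  apply: le_trans h; rewrite mulrC ler_wpM2r// ler_norml; apply/andP; split; lra.
have fin (a b y u : R) : `|u| <= e / 4 -> b = y + u -> - d < a - b -> a - b < d -> `|a - y| < e.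
  clear -d1 e0; rewrite ler_norml ltr_norml => /andP[u1 u2] E v1 v2.
  by apply/andP; split; lra.
case: (lerP t (2^-1)) => tt.
  left; have k := key t t0 tt B; apply/norm_ltP; split.
    by apply: (fin _ _ _ _ (coord _ _ t t0 k g21 g11) _ a1 a2); rewrite qE seg1E; ring.
  by apply: (fin _ _ _ _ (coord _ _ t t0 k g22 g12) _ b1 b2); rewrite qE seg2E; ring.
right.
have t1' : 0 <= 1 - t by rewrite subr_ge0.
have t2' : 1 - t <= 2^-1 by clear -tt; lra.
have k : 2 * (1 - t) <= e / 4.
  by apply: key => //; have -> : (1 - t) * (1 - (1 - t)) = t * (1 - t) by ring.
apply/norm_ltP; split.
  by apply: (fin _ _ _ _ (coord _ _ _ t1' k g11 g21) _ a1 a2); rewrite qE seg1E; ring.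
by apply: (fin _ _ _ _ (coord _ _ _ t1' k g12 g22) _ b1 b2); rewrite qE seg2E; ring.
Qed.

(** Two points strictly on both sides of g, which all chords close to g
    separate. *)
Lemma near_refs g : geo g -> exists e1 e2 (h : R), [/\ n2 e1 <= 1, n2 e2 <= 1, 0 < h &
  forall l, `|l.1 - g.1| < h -> `|l.2 - g.2| < h -> 0 < side l e1 /\ side l e2 < 0].
Proof.
move=> gg; have [e1 [i1 p1]] := half_ex gg.
have [e2 [i2]] := half_ex (geo_flip gg); rewrite side_flip oppr_gt0 => p2.
have : \forall l \near g, 0 < side l e1 /\ side l e2 < 0.
  by apply: filterI; [apply: (near_gt0 (@side_cont_l R e1))|apply: (near_lt0 (@side_cont_l R e2))].
case/nbhs_ballP => h /= h0 H; exists e1, e2, h; split => //.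
- exact/ltW/discP.
- exact/ltW/discP.
by move=> l a b; apply: H; split; rewrite -ball_normE /ball_ /= distrC.
Qed.

Section Fixed.
Variable L : set (pl * pl).
Hypothesis PL : pre_lamination L.

(** The ends of a boundary chord of a region close to g are close to the ends of
    g. A chord joining both ends separates the points of [near_refs]; a and b do
    so already, so by [no_three_cut] the ends of l are close to the same end of
    g. *)
Lemma long_pair g (e : R) : geo g -> 0 < e -> exists d, 0 < d /\
  forall c a b l, inner L c -> adj L c a -> adj L c b -> ~ same a b ->
   hnear (region L c) (ch g) d -> hnear (ch a) (ch g) d -> hnear (ch b) (ch g) d ->
   adj L c l -> ~ same a l -> ~ same b l -> `|l.1 - l.2| < e.
Proof.
move=> gg e0; have [e1 [e2 [h [n1 n2' h0 H]]]] := near_refs gg.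
have gn : 0 < `|g.1 - g.2|.
  by case: gg => _ _ ne; rewrite normr_gt0 subr_eq0; apply/eqP.
pose h' := Num.min h (Num.min (e / 2) (`|g.1 - g.2| / 4)).
have h'0 : 0 < h' by rewrite !lt_min h0 !divr_gt0.
have hh : h' <= h by rewrite ge_min lexx.
have he : h' <= e / 2 by rewrite !ge_min lexx orbT.
have hg : h' <= `|g.1 - g.2| / 4 by rewrite !ge_min lexx !orbT.
have [d0 [d00 E]] := ends_near gg h'0.
exists (Num.min d0 h'); split; first by rewrite lt_min d00.
set d := Num.min _ _ => c a b l ic aa ab nab [hr _] [_ ha] [_ hb] al nal nbl.
have dd : d <= d0 by rewrite ge_min lexx.
have dh : d <= h' by rewrite ge_min lexx orbT.
have near_end x s : adj L c x -> circle s -> closure (ch x) s -> `|s - g.1| < h' \/ `|s - g.2| < h'.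
  move=> ax cs hs; have [|q [hq dq]] := hr s.
    by rewrite closure_region//; exact: (adj_cl_closed_region ax).
  by apply: (E s q) => //; exact: lt_le_trans dd.
have alt x : adj L c x -> side x e1 * side x e2 < 0 \/
   exists i, (i = g.1 \/ i = g.2) /\ `|x.1 - i| < h' /\ `|x.2 - i| < h'.
  move=> ax; have [gx1 gx2 _] := cl_geo (adj_cl ax).
  case: (near_end x _ ax gx1 (end_closure x).1) => u1;
  case: (near_end x _ ax gx2 (end_closure x).2) => u2.
  - by right; exists g.1; split; [left|split].
  - left; have [] := H x; [exact: lt_le_trans hh|exact: lt_le_trans hh|].
    by move=> v1 v2; rewrite pmulr_rlt0.
  - left; have [] := H (flip x); [exact: lt_le_trans hh|exact: lt_le_trans hh|].
    by rewrite !side_flip oppr_gt0 oppr_lt0 => v1 v2; rewrite nmulr_rlt0.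
  - by right; exists g.2; split; [right|split].
have long x : adj L c x -> (forall q, closure (ch g) q -> exists p, closure (ch x) p /\ `|p - q| < d) ->
   side x e1 * side x e2 < 0.
  move=> ax hx; case: (alt x ax) => // -[i [iE [u1 u2]]].
  have F q : closure (ch g) q -> `|i - q| < 2 * h'.
    move=> /hx [p [/closure_chord [t t01 ->] hp]].
    have := seg_norm t01 u1 u2 => hs.
    apply: le_lt_trans (ler_distD (seg x.1 x.2 t) _ _) _.
    by rewrite distrC; move: (lt_le_trans hp dh) hs; lra.
  have [F1 F2] := (F _ (end_closure g).1, F _ (end_closure g).2).
  by case: iE F1 F2 => ->; [move=> _|rewrite distrC => + _]; lra.
case: (alt l al) => [sl|[i [_ [u1 u2]]]].
  by have [] := no_three_cut PL aa ab al nab nal nbl n1 n2' (long _ aa ha) (long _ ab hb) sl.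
apply: le_lt_trans (ler_distD i _ _) _; rewrite [X in _ + X]distrC; lra.
Qed.

Lemma leafE (g : set pl) : leaves L g <-> exists l, L l /\ g = ch l.
Proof.
split=> [[x [y [h ->]]]|[[x y] [h ->]]]; first by exists (x, y).
by exists x, y.
Qed.

Lemma leaf_ch l : geo l -> leaves L (ch l) <-> L l.
Proof.
move=> gl; split=> [/leafE [m [Lm E]]|Ll]; last by apply/leafE; exists l.
exact: pl_same PL _ _ (ch_inj gl (pl_geo PL Lm) E) Lm.
Qed.

(** The condition on the other boundary components follows from the convergence
    of two of them, by [long_pair]. *)
Lemma long_boundaryI (c : nat -> pl) (a b : nat -> pl * pl) g : geo g ->
  (\forall n \near \oo, [/\ inner L (c n), adj L (c n) (a n), adj L (c n) (b n) & ~ same (a n) (b n)]) ->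
  hausdorff_cvg (fun n => region L (c n)) (ch g) ->
  hausdorff_cvg (fun n => ch (a n)) (ch g) -> hausdorff_cvg (fun n => ch (b n)) (ch g) ->
  long_boundary (fun n => region L (c n)) (ch g) (fun n => ch (a n)) (fun n => ch (b n)).
Proof.
move=> gg h hr ha hb; split => //.
  apply: filterS h => n [ic aa ab ns]; split.
  - by apply/bcP => //; exists (a n).
  - by apply/bcP => //; exists (b n).
  - move=> E; apply: ns; apply: same_sym; apply: ch_inj => //; [exact: cl_geo (adj_cl aa)|exact: cl_geo (adj_cl ab)].
move=> e e0; have e2 : 0 < e / 2 by rewrite divr_gt0.
have [d [d0 H]] := long_pair gg e2.
have hr' := (hcvgP _ _).1 hr _ d0; have ha' := (hcvgP _ _).1 ha _ d0; have hb' := (hcvgP _ _).1 hb _ d0.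
apply: filterS (filterI h (filterI hr' (filterI ha' hb'))) => n [[ic aa ab ns] [r1 [r2 r3]]] x y cx cy.
move=> /(bcP PL _ ic) [l [al E]] na nb.
have lt : `|l.1 - l.2| < e / 2.
  apply: (H (c n) (a n) (b n)) => //; move=> /same_ch e'.
    by apply: na; rewrite E e'.
  by apply: nb; rewrite E e'.
have gl := cl_geo (adj_cl al).
have xy : x <> y.
  move=> exy; have : chord x y (mid l) by rewrite E; exact: ch_mid.
  rewrite -exy => -[t [_ mE]]; have := ch_disc gl (ch_mid l).
  have -> : mid l = x by rewrite mE -scalerDl subrK scale1r.
  by move=> /discP; rewrite (circ_n2 x).1// ltxx.
have gxy : geo (x, y) by [].
have := norm_edist lt; rewrite [2 * _]mulrC divfK//.
have sy (u v : pl) : Defs.edist u v = Defs.edist v u.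
  by rewrite /Defs.edist -(sqrrN (u.1 - v.1)) -(sqrrN (u.2 - v.2)) !opprB.
by case: (ch_inj gl gxy (esym E)) => -> //=; rewrite sy.
Qed.

End Fixed.
End Haus.

(** * Separation, and regions squeezed toward a chord *)

Section Sep.
Variable R : realType.
Notation pl := (plane R).
Implicit Types (p q w z c : plane R) (l m k g h r : plane R * plane R) (L M : set (plane R * plane R)).

Definition cuts h a b := splits h (ch a) (ch b).

Lemma cuts_sep h a b : geo h -> separates (ch h) (ch a) (ch b) <-> cuts h a b.
Proof. by move=> gh; apply: separatesP => //; [exists (mid a)|exists (mid b)]; exact: ch_mid. Qed.

Lemma cuts_side h a b p q : cuts h a b -> ch a p -> ch b q -> side h p * side h q < 0.
Proof.
by case=> -[s1 s2] hp hq; case: (s1 _ hp); case: (s2 _ hq) => _; rewrite side_flip => ? _ ?; nra.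
Qed.

Lemma cuts_sym h a b : cuts h a b -> cuts h b a.
Proof. by case=> -[s1 s2]; [right|left]. Qed.

Lemma cuts_nsame h a b : cuts h a b -> ~ same h a.
Proof.
move=> s n; have := cuts_side s (ch_mid a) (ch_mid b).
by rewrite (same_sd0 (same_sym n) (side_ch (ch_mid a))) mul0r ltxx.
Qed.

Lemma same_cuts h h' a b : same h h' -> cuts h a b -> cuts h' a b.
Proof. by case=> -> // [] [s1 s2]; [right|left]; rewrite ?flipK. Qed.
Lemma same_spcl h a a' b : same a a' -> cuts h a b -> cuts h a' b.
Proof. by move=> /same_ch e; rewrite /cuts e. Qed.

(** The vertical line through a point of the half-disc meets the circle in two
    points, and one of them is on the same side. *)
Lemma circle_above l : geo l -> exists s, circle s /\ 0 < side l s.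
Proof.
move=> gl; have [c [/discP ic sc]] := half_ex gl.
pose y := Num.sqrt (1 - c.1 ^+ 2).
have yy : y ^+ 2 = 1 - c.1 ^+ 2.
  by rewrite sqr_sqrtr// subr_ge0; move: ic; rewrite /n2; have := sqr_ge0 c.2; lra.
have y0 : 0 <= y by exact: sqrtr_ge0.
have cy : `|c.2| < y.
  rewrite -(@ltr_pXn2r _ 2)// ?nnegrE// real_normK ?num_real// yy; move: ic; rewrite /n2; lra.
move: cy; rewrite ltr_norml => /andP[c1 c2].
have C e : e ^+ 2 = 1 -> circle ((c.1, e * y) : pl).
  by move=> ee; apply/circ_n2; rewrite /n2 /= exprMn ee mul1r yy; lra.
case: (ltrP 0 (side l (c.1, y))) => h1.
  by exists (c.1, y); split => //; rewrite -[y]mul1r; apply: C; rewrite expr1n.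
case: (ltrP 0 (side l (c.1, - y))) => h2.
  by exists (c.1, - y); split => //; rewrite -mulN1r; apply: C; rewrite sqrrN expr1n.
have E : 2 * y * side l c = (y - c.2) * side l (c.1, - y) + (y + c.2) * side l (c.1, y).
  by rewrite /side /=; ring.
have : 0 < 2 * y * side l c by rewrite !mulr_gt0//; lra.
rewrite E; nra.
Qed.

Lemma closed_chordI l q : geo l -> n2 q <= 1 -> side l q = 0 -> closure (ch l) q.
Proof.
move=> gl nq /(side_line gl) [t E]; have D := d2_gt0 gl.
have : 0 <= t * (1 - t) by rewrite -(pmulr_lge0 _ D); move: nq; rewrite E n2_seg//; lra.
move=> tt; have t0 : 0 <= t by nra.
have t1 : t <= 1 by nra.
apply: (@closed_limit _ _ _ (mid l)) => s /andP[s0 s1]; apply/chP.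
exists ((1 - s) * t + s / 2).
  by apply/andP; split; nra.
by rewrite E; apply: plane_eq; rewrite ?(seg1E, seg2E); ring.
Qed.

(** Compactness: a point of the closed disc on the left of r and at distance at
    least e from r is strictly on the left of all chords close to r. *)
Lemma strip r (e : R) : geo r -> 0 < e -> \forall k \near r, forall q, n2 q <= 1 ->
  0 <= side r q -> side k q <= 0 -> exists q', closure (ch r) q' /\ `|q - q'| < e.
Proof.
move=> gr e0.
pose F := [set q : pl | n2 q <= 1] `&` [set q | 0 <= side r q] `&`
  \bigcap_(q' in closure (ch r)) [set q : pl | 0 <= `|q - q'| - e].
have cF : compact F.
  apply: (subclosed_compact _ (@cdisc_compact R)); last by move=> q [[]].
  apply: closedI; first apply: closedI; first exact: cdisc_closed.
    by apply: closed_ge0; exact: side_cont_p.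
  apply: closed_bigI => q' _; apply: closed_ge0; apply: cont_B; last exact: cont_c.
  move=> x; apply: (@continuous_comp _ _ _ (fun y => y - q') (fun y => `|y|)).
    by apply: cvgB; [exact: cvg_id|exact: cvg_cst].
  exact: norm_continuous.
have H := (compact_near_coveringP F).1 cF _ (nbhs r) (fun k q => 0 < side k q) _.
have : \forall k \near r, F `<=` [set q | 0 < side k q].
  apply: H => q [[nq sq] hq].
  have sq' : 0 < side r q.
    rewrite lt_neqAle sq andbT; apply/eqP => z.
    by have := hq _ (closed_chordI gr nq (esym z)); rewrite /= subrr normr0 add0r oppr_ge0 leNgt e0.
  have c : continuous (fun x : pl * (pl * pl) => side x.2 x.1).
    have -> : (fun x : pl * (pl * pl) => side x.2 x.1) = (fun x => side (x.2.1, x.2.2) x.1).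
      by apply/funext => -[? []].
    apply: side_cont => x.
    - by apply: (@continuous_comp _ _ _ snd fst); [exact: csnd|exact: cfst].
    - by apply: (@continuous_comp _ _ _ snd snd); [exact: csnd|exact: csnd].
    - exact: cfst.
  by have := near_gt0 c (x := (q, r)) sq'; apply.
apply: filterS => k hk q nq sq kq; apply: contrapT => no.
have : 0 < side k q.
  apply: hk; split => // q' hq' /=; rewrite subr_ge0 leNgt; apply/negP => h.
  by apply: no; exists q'.
by rewrite ltNge kq.
Qed.

Lemma strip_closed r k :
  closed [set q : pl | [/\ n2 q <= 1, 0 <= side r q & side k q <= 0]].
Proof.
have -> : [set q : pl | [/\ n2 q <= 1, 0 <= side r q & side k q <= 0]] =
  [set q : pl | n2 q <= 1] `&` [set q : pl | 0 <= side r q] `&` [set q | 0 <= side (flip k) q].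
  apply/seteqP; split=> q; first by case=> a b c; split; [split|rewrite /= side_flip oppr_ge0].
  by case=> -[a b]; rewrite /= side_flip oppr_ge0 => c; split.
apply: closedI; last by apply: closed_ge0; exact: side_cont_p.
by apply: closedI; [exact: cdisc_closed|apply: closed_ge0; exact: side_cont_p].
Qed.

(** A set between r and k is close to r by [strip]; conversely a point of r is
    close to one of k, and h crosses the segment joining them. *)
Lemma squeeze r (e : R) : geo r -> 0 < e -> \forall k \near r, geo k ->
  forall (B : set pl) h, B `<=` [set q | [/\ n2 q <= 1, 0 <= side r q & side k q <= 0]] ->
  geo h -> cuts h r k -> ch h `<=` closure B -> hnear B (ch r) e.
Proof.
move=> gr e0.
have e2 : 0 < e / 2 by rewrite divr_gt0.
have n1 := strip gr e0.
have n2' : \forall k \near r, `|r.1 - k.1| < e / 2 /\ `|r.2 - k.2| < e / 2.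
  by apply/nbhs_ballP; exists (e / 2) => //= k [a b]; move: a b; rewrite -!ball_normE.
apply: filterS (filterI n1 n2') => k [h1 [h2 h3]] gk B h BB gh s hB; split.
  by move=> p /(clos_min (@strip_closed r k) BB) [a b c]; exact: h1.
move=> q hq.
have [w [hw bw]] : ch r `&` ball q (e / 2) !=set0.
  by apply: hq; apply: open_nbhs_nbhs; split; [exact: ball_open|exact: ballxx].
have bw' : `|w - q| < e / 2 by move: bw; rewrite -ball_normE /ball_ /= distrC.
have [t t01 wE] := (chP _ _).1 hw.
pose z := seg k.1 k.2 t.
have hz : ch k z by apply/chP; exists t.
have wz : `|z - w| < e / 2.
  have -> : z - w = seg (k.1 - r.1) (k.2 - r.2) t - 0.
    rewrite subr0 /z wE /seg !scalerBr opprD addrACA; congr (_ + _).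
  apply: seg_norm; rewrite ?subr0 1?distrC//.
  by case/andP: t01 => *; rewrite !ltW.
have [u /andP[u0 u1] su] := affine_zero (cuts_side s hw hz).
exists (seg w z u); split.
  apply: hB; apply: disc_ch => //; apply: disc_seg; rewrite ?ltW//.
    exact: ch_disc gr hw.
  exact: ch_disc gk hz.
apply: le_lt_trans (ler_distD w _ _) _.
have b2 : `|seg w z u - w| < e / 2.
  by apply: seg_norm => //; rewrite ?ltW// subrr normr0.
by rewrite [ltRHS](splitr e) ltrD.
Qed.

Section Fixed.
Variable L : set (pl * pl).
Hypothesis PL : pre_lamination L.

Lemma spcI h a b p q : cl L h -> cl L a -> cl L b -> ch a p -> ch b q ->
  side h p * side h q < 0 -> cuts h a b.
Proof.
move=> ch_ ca cb hp hq n.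
case: (ltrgt0P (side h p)) n => [p0|p0|->]; last by rewrite mul0r ltxx.
  rewrite pmulr_rlt0// => q0; left; split; first exact: (cl_pos PL ch_ ca hp p0).
  exact: (cl_neg PL ch_ cb hq q0).
rewrite nmulr_rlt0// => q0; right; split; first exact: (cl_neg PL ch_ ca hp p0).
exact: (cl_pos PL ch_ cb hq q0).
Qed.

Lemma cuts_trans h k a b : cl L h -> cl L k -> cl L a -> cl L b ->
  cuts h a k -> cuts k a b -> cuts h a b.
Proof.
move=> hh hk ha hb s1 s2.
have [pa pb] := (ch_mid a, ch_mid b).
have [t /andP[t0 t1] z] := affine_zero (cuts_side s2 pa pb).
have hw : ch k (seg (mid a) (mid b) t).
  apply: disc_ch => //; first exact: cl_geo hk.
  by apply: disc_seg; rewrite ?ltW//; [exact: ch_disc (cl_geo ha) pa|exact: ch_disc (cl_geo hb) pb].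
apply: (spcI hh ha hb pa pb).
have := cuts_side s1 pa hw; rewrite side_seg.
move: (side h (mid a)) (side h (mid b)) => x y n.
case: (ltrgt0P x) n => [x0|x0|->]; last by rewrite mul0r ltxx.
  by rewrite !pmulr_rlt0// => n; nra.
by rewrite !nmulr_rlt0// => n; nra.
Qed.

(** On the segment from a to b, the affine function side h, if it has opposite
    signs at two interior points, has opposite signs at the ends. *)
Lemma cuts_between h h1 h2 a b : cl L h -> cl L h1 -> cl L h2 -> cl L a -> cl L b ->
  cuts h1 a b -> cuts h2 a b -> cuts h h1 h2 -> cuts h a b.
Proof.
move=> hh c1 c2 ca cb s1 s2 s; have [pa pb] := (ch_mid a, ch_mid b).
have [ia ib] := (ch_disc (cl_geo ca) pa, ch_disc (cl_geo cb) pb).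
have [t1 /andP[a1 b1] z1] := affine_zero (cuts_side s1 pa pb).
have [t2 /andP[a2 b2] z2] := affine_zero (cuts_side s2 pa pb).
have w1 : ch h1 (seg (mid a) (mid b) t1).
  by apply: disc_ch => //; [exact: cl_geo c1|apply: disc_seg => //; rewrite !ltW].
have w2 : ch h2 (seg (mid a) (mid b) t2).
  by apply: disc_ch => //; [exact: cl_geo c2|apply: disc_seg => //; rewrite !ltW].
apply: (spcI hh ca cb pa pb).
have := cuts_side s w1 w2; rewrite (side_seg _ _ _ t1) (side_seg _ _ _ t2).
move: (side h (mid a)) (side h (mid b)) => A B n; rewrite ltNge; apply/negP => AB.
have e1 : 0 < 1 - t1 by rewrite subr_gt0.
have e2 : 0 < 1 - t2 by rewrite subr_gt0.
move: n; rewrite ltNge => /negP; apply.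
have -> : ((1 - t1) * A + t1 * B) * ((1 - t2) * A + t2 * B) =
  (1 - t1) * (1 - t2) * A ^+ 2 + ((1 - t1) * t2 + t1 * (1 - t2)) * (A * B) + t1 * t2 * B ^+ 2 by ring.
by rewrite !addr_ge0// mulr_ge0 ?sqr_ge0// ?addr_ge0// ?mulr_ge0// ltW.
Qed.

(** Leaves cannot accumulate on h1 on the side of h2, since they would separate
    h1 from h2. So h1 is adjacent to a region there, and a leaf between this
    region and h2 would separate h1 from h2. *)
Lemma no_sep_region h1 h2 : L h1 -> L h2 -> ch h2 `<=` left_of h1 -> ch h1 `<=` left_of h2 ->
  (forall h, L h -> ~ cuts h h1 h2) -> exists c, [/\ inner L c, adj L c h1 & adj L c h2].
Proof.
move=> L1 L2 s12 s21 no.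
have [c1 c2] := (leaf_cl PL L1, leaf_cl PL L2).
have [p1 p2] := (ch_mid h1, ch_mid h2).
have [g1 g2] := (cl_geo c1, cl_geo c2).
have [_ pos] := s12 _ p2.
case: (accum_or_adj PL c1) => [ac|[c ic ac]].
  have [m [Lm s _ m1 m2]] := accum_near PL g1 ac pos filterT.
  case: (no m Lm); apply: (spcI (leaf_cl PL Lm) c1 c2 p1 p2).
  by rewrite nmulr_rlt0//; exact: m2.
exists c; split => //; apply: adjI => //.
  have := ac => -[_ _ h]; have := h h2 _ c2 p1; have [_ q] := s21 _ p1.
  by rewrite pmulr_lge0// => h0; rewrite lt_neqAle h0 andbT eq_sym; have [_] := ic; apply.
move=> m q Lm hq; have cm := leaf_cl PL Lm.
have [s1|ns1] := pselect (same h1 m).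
  have [_ a] := s12 _ hq; have b := adj_pos ac.
  by case: s1 => ->; rewrite ?side_flip ?mulrNN; apply: mulr_ge0; exact: ltW.
have [s2|ns2] := pselect (same m h2).
  by rewrite (same_sd0 (same_sym s2) (side_ch hq)) mulr0.
have ns1' : ~ same m h1 by move=> /same_sym.
have := cl_side_ne PL cm c1 ns1' p1; have := cl_side_ne PL cm c2 ns2 hq => n2_ n1_.
have nn : 0 <= side m (mid h1) * side m q.
  by rewrite leNgt; apply/negP => neg; apply: (no m Lm); exact: spcI cm c1 c2 p1 hq neg.
have [_ _ h] := ac; have a := h m _ cm p1.
apply: pos_ge_trans nn; rewrite lt_neqAle a andbT eq_sym mulf_neq0//.
by have [_] := ic; apply.
Qed.

Definition nearer r k h := [/\ L h, ch h `<=` left_of r & cuts h r k].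

(** Otherwise there would be, arbitrarily close to r, two leaves between r and a
    leaf k close to r that no leaf separates. They bound a common region by
    [no_sep_region]; it lies between r and k, hence is close to r by [squeeze],
    and these regions form a bad accumulation. *)
Lemma accum_dense r : (forall D, ~ bad_accumulation L D) -> geo r -> accum L r ->
  exists k, [/\ L k, ch k `<=` left_of r, (forall w, ch r w -> side k w < 0) &
   forall h1 h2, nearer r k h1 -> nearer r k h2 -> ~ same h1 h2 -> exists h, L h /\ cuts h h1 h2].
Proof.
move=> nobad gr ar; have cr := accum_cl gr ar.
have [c0 [_ c0p]] := half_ex gr.
apply: contrapT => nt.
have ex n : exists x : pl * ((pl * pl) * (pl * pl)), exists k,
   [/\ geo k, inner L x.1, adj L x.1 x.2.1, adj L x.1 x.2.2 & ~ same x.2.1 x.2.2] /\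
   [/\ ball r (n.+1%:R^-1) k, cuts x.2.1 r k, cuts x.2.2 r k & L x.2.1 /\ L x.2.2] /\
   region L x.1 `<=` [set q | [/\ n2 q <= 1, 0 <= side r q & side k q <= 0]].
  have nb : nbhs r (ball r (n.+1%:R^-1 : R)).
    by apply: nbhsx_ballx; rewrite invr_gt0.
  have [k [Lk sk bk kc kw]] := accum_near PL gr ar c0p nb.
  have ck := leaf_cl PL Lk.
  have [h1 [h2 [[L1 s1 b1] [L2 s2 b2] ns no]]] : exists h1 h2,
      [/\ nearer r k h1, nearer r k h2, ~ same h1 h2 & forall h, L h -> ~ cuts h h1 h2].
    apply: contrapT => h; apply: nt; exists k; split => // h1 h2 b1 b2 ns.
    by apply: contrapT => h'; apply: h; exists h1, h2; split => // x Lx sx; apply: h'; exists x.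
  have [c1 c2] := (leaf_cl PL L1, leaf_cl PL L2).
  have [h1' [so1 f1]] : exists h1', same h1 h1' /\ ch h2 `<=` left_of h1'.
    case: (cl_sides PL c1 c2) => // f; [exists h1|exists (flip h1)]; split => //.
      exact: same_refl.
    by right.
  have [h2' [so2 f2]] : exists h2', same h2 h2' /\ ch h1 `<=` left_of h2'.
    case: (cl_sides PL c2 c1) => [/same_sym //|f|f]; [exists h2|exists (flip h2)]; split => //.
      exact: same_refl.
    by right.
  have [L1' L2'] := (pl_same PL so1 L1, pl_same PL so2 L2).
  have [|||c [ic a1 a2]] := no_sep_region L1' L2'.
  - by rewrite (same_ch so2).
  - by rewrite (same_ch so1).
  - by move=> h Lh sh; apply: (no h Lh); move: sh; rewrite /cuts (same_ch so1) (same_ch so2).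
  exists (c, (h1', h2')), k; split; first split => //=.
  - exact: (cl_geo ck).
  - by move=> s; apply: ns; apply: same_trans so1 (same_trans s (same_sym so2)).
  split; first by split => //=; [exact: same_cuts so1 b1|exact: same_cuts so2 b2].
  have p1 := ch_mid h1'; have p1' : ch h1 (mid h1') by rewrite -(same_ch so1).
  have kp : side k (mid h1') < 0.
    have hr := ch_mid r; have hk := ch_mid k.
    have [t /andP[t0 t1] z] := affine_zero (cuts_side b1 hr hk).
    pose w := seg (mid r) (mid k) t.
    have hw : ch h1 w.
      apply: disc_ch => //; first exact: cl_geo c1.
      apply: disc_seg; rewrite ?ltW//; [exact: ch_disc gr hr|exact: ch_disc (cl_geo ck) hk].
    have kw' : side k w < 0.
      by rewrite /w side_seg (side_ch hk) mulr0 addr0 pmulr_rlt0 ?subr_gt0//; exact: kw.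
    by have [_] := cl_neg PL ck c1 hw kw' p1'; rewrite side_flip oppr_gt0.
  have kc' : side k c < 0.
    have := a1 => -[_ _ /(_ k _ ck p1)]; rewrite nmulr_lge0// => h.
    by rewrite lt_neqAle h andbT; have [_] := ic; apply.
  have rc : 0 < side r c.
    have [_ rp] := s1 _ p1'.
    have := a1 => -[_ _ /(_ r _ cr p1)]; rewrite pmulr_lge0// => h.
    by rewrite lt_neqAle h andbT eq_sym; have [_] := ic; apply.
  move=> q /(region_closed_region) [nq hq]; split => //.
    by have := hq r cr; rewrite pmulr_rge0.
  by have := hq k ck; rewrite nmulr_rge0.
have [x hx] := choice ex.
apply: (nobad (fun n => region L (x n).1)); split.
  move=> n; have [k [[gk ic a1 a2 ns] _]] := hx n; split.
    by apply/regionP => //; exists (x n).1; split => //; [case: ic|move=> m; exact: inner_off].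
  exists (x n).1; rewrite interior_open_region//; split; first by case: ic.
  by move=> m cm; apply: (inner_sq ic cm).
have conv (B : nat -> set pl) : (forall n, B n `<=` region L (x n).1 \/ B n `<=` ch (x n).2.1 \/ B n `<=` ch (x n).2.2) ->
   (forall n, ch (x n).2.1 `<=` closure (B n) \/ ch (x n).2.2 `<=` closure (B n)) ->
   hausdorff_cvg B (ch r).
  move=> up lo; apply/hcvgP => e e0.
  have /nbhs_ballP [d /= d0 H] := squeeze gr e0.
  have nd : \forall n \near \oo, n.+1%:R^-1 < d.
    exact: (near_infty_natSinv_lt (PosNum d0)).
  apply: filterS nd => n hn; have [k [[gk ic a1 a2 _] [[bk s1 s2 _] st]]] := hx n.
  have BB : B n `<=` [set q | [/\ n2 q <= 1, 0 <= side r q & side k q <= 0]].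
    have st' := clos_min (@strip_closed r k) st.
    have bd l : adj L (x n).1 l -> ch l `<=` closure (region L (x n).1).
      by move=> al; rewrite closure_region//; exact: adj_closed_region.
    case: (up n) => [u|[u|u]] q /u hq; apply: st'; [exact: subset_closure|exact: (bd _ a1)|exact: (bd _ a2)].
  have kd : ball r d k by apply: le_ball bk; exact: ltW.
  case: (lo n) => hB.
    exact: (H k kd gk _ _ BB (cl_geo (adj_cl a1)) s1 hB).
  exact: (H k kd gk _ _ BB (cl_geo (adj_cl a2)) s2 hB).
exists (ch r); split.
- by have [a b c] := gr; exists r.1, r.2.
- apply: conv => n; first by left.
  left; have [k [[gk ic a1 a2 ns] _]] := hx n; rewrite closure_region//; exact: adj_closed_region.
exists (fun n => ch (x n).2.1), (fun n => ch (x n).2.2); split; last first.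
  apply: nearW => n; have [k [_ [[_ _ _ [L1 L2]] _]]] := hx n.
  by split; apply/leafE; [exists (x n).2.1|exists (x n).2.2].
apply: (long_boundaryI PL (c := fun n => (x n).1) (a := fun n => (x n).2.1) (b := fun n => (x n).2.2)) => //.
- by apply: nearW => n; have [k [[gk ic a1 a2 ns] _]] := hx n.
- apply: conv => n; first by left.
  left; have [k [[gk ic a1 a2 ns] _]] := hx n; rewrite closure_region//; exact: adj_closed_region.
- by apply: conv => n; [right; left|left; exact: subset_closure].
- by apply: conv => n; [right; right|right; exact: subset_closure].
Qed.

End Fixed.
End Sep.

(** * Open intervals of leaves *)

Section PLam.
Variable R : realType.
Notation pl := (plane R).
Implicit Types (p q w z c : plane R) (l m k g h i j f r : plane R * plane R).
Variable L : set (pl * pl).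
Hypothesis PL : pre_lamination L.

Lemma inner_complementary c : inner L c -> complementary_region L (region L c).
Proof.
move=> ic; apply/regionP => //; exists c; split => //; first by case: ic.
by move=> m; exact: inner_off.
Qed.

Lemma cl_accum l : cl L l -> [\/ L l, accum L l | accum L (flip l)].
Proof.
move=> cll; have [Ll|nL] := pselect (L l); first exact: Or31.
have sub : L `<=` beyond L l `|` beyond L (flip l).
  move=> m Lm; case: (cl_sides PL cll (leaf_cl PL Lm)) => s.
  - by case: nL; apply: pl_same Lm => //; exact: same_sym.
  - by left.
  - by right.
have : closure (beyond L l `|` beyond L (flip l)) l by exact: closureS cll.2.
rewrite closureU => -[a|a]; first exact: Or32.
apply: Or33; apply: closure_flip a => m [Lm s]; split; first exact: pl_flip.
by rewrite ch_flip.
Qed.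

(** By density a leaf ends strictly on the left of r. The boundary chord that
    faces it is not r, so it is a leaf. *)
Lemma exists_leaf_bdry c r : dense_lamination L -> inner L c -> adj L c r ->
  (forall l, adj L c l -> ~ L l -> l = r) -> exists m, L m /\ adj L c m.
Proof.
move=> dL ic ar ur; have gr := cl_geo (adj_cl ar).
have [s0 [cs0 s0p]] := circle_above gr.
have [s [[t st] sp_]] := dL _ cs0 _ (near_gt0 (@side_cont_p R r) s0p).
have Lm : L (s, t) by case: st => // /(pl_flip PL).
have cm := leaf_cl PL Lm; pose m := (s, t).
have nn : 0 <= side r s * side r t by exact: closure_noncross (adj_cl ar).2 cm.2.
have tp : 0 <= side r t by rewrite -(pmulr_rge0 _ sp_).
have zp : 0 < side r (mid m) by rewrite /mid side_seg /=; move: sp_ => /=; lra.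
have [l [al lz]] := facing_leaf PL ic cm.
exists l; split => //; apply: contrapT => nl.
by move: lz; rewrite (ur l al nl) leNgt zp.
Qed.

(** The last chord before leaves accumulate, when one leaves the leaf f on its
    left: f itself, or the root of the shell that f borders, turned outwards. *)
Definition exit f r := [/\ geo r, accum L r & r = f \/
  exists c, [/\ inner L c, adj L c f, adj L c (flip r) & ~ L r]].

Lemma exit_cl f r : exit f r -> cl L r.
Proof. by case=> g a _; exact: accum_cl. Qed.

Lemma exit_left_of f r : L f -> exit f r -> left_of r `<=` left_of f.
Proof.
move=> Lf [gr ar [->//|[c [ic af ar' nr]]]] q [iq rq].
have gf := pl_geo PL Lf.
have ns : ~ same f (flip r) by move=> s; apply: nr; rewrite -(flipK r); apply: (pl_flip PL); exact: (pl_same PL s).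
have s1 := adj_facing PL af ar' ns.
have s2 : ch f `<=` left_of (flip r) by apply: (adj_facing PL ar' af) => /same_sym.
split => //; rewrite ltNge; apply/negP; rewrite le_eqVlt => /predU1P[z|n].
  have [_] := s2 q (disc_ch gf iq z); rewrite side_flip; lra.
apply: (facing_disjoint gf (geo_flip gr) s1 s2 _ n); first exact/ltW/discP.
by rewrite side_flip oppr_lt0.
Qed.

(** A leaf other than f has f and r on the same side, since f and r bound the
    same region when they differ. *)
Lemma exit_sign f r i p q : L f -> exit f r -> L i -> ~ same i f -> ch f p -> ch r q ->
  0 < side i p * side i q.
Proof.
move=> Lf ex Li ns hp hq; have cr := exit_cl ex.
have [ci cf] := (leaf_cl PL Li, leaf_cl PL Lf).
case: ex => gr ar [E|[c [ic [_ _ af] [_ _ ar'] nr]]].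
  by rewrite E in hq; exact: cl_sign ci cf ns hp hq.
have nr' : ~ same i r by move=> s; apply: nr; exact: (pl_same PL s).
have ip := cl_side_ne PL ci cf ns hp; have iq := cl_side_ne PL ci cr nr' hq.
have icn : side i c != 0 by have [_] := ic; apply.
have h1 : 0 < side i p * side i c.
  by rewrite lt_neqAle mulrC af// andbT eq_sym mulf_neq0.
have h2 : 0 < side i c * side i q.
  by rewrite lt_neqAle ar' ?ch_flip// andbT eq_sym mulf_neq0.
exact: pos_trans h1 h2.
Qed.

Lemma exit_cuts f r i k : L f -> exit f r -> L i -> cl L k -> cuts i f k -> cuts i r k.
Proof.
move=> Lf ex Li ck s; have cr := exit_cl ex.
have [[pf pr] pk] := (ch_mid f, ch_mid r, ch_mid k).
apply: (spcI PL (leaf_cl PL Li) cr ck pr pk).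
have := exit_sign Lf ex Li (cuts_nsame s) pf pr; have := cuts_side s pf pk.
move: (side i (mid f)) (side i (mid r)) (side i (mid k)) => a b d n h.
rewrite ltNge; apply/negP => h'; have := pos_ge_trans h h'; lra.
Qed.

Lemma exit_cuts' f r i k : L f -> exit f r -> L i -> cl L k -> ~ same i f -> cuts i r k -> cuts i f k.
Proof.
move=> Lf ex Li ck ns s; have cr := exit_cl ex.
have [[pf pr] pk] := (ch_mid f, ch_mid r, ch_mid k).
apply: (spcI PL (leaf_cl PL Li) (leaf_cl PL Lf) ck pf pk).
have := exit_sign Lf ex Li ns pf pr; have := cuts_side s pr pk.
move: (side i (mid f)) (side i (mid r)) (side i (mid k)) => a b d n; rewrite mulrC => h.
rewrite ltNge; apply/negP => h'; have := pos_ge_trans h h'; lra.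
Qed.

Lemma cuts_beyond i r k : cl L i -> cl L r -> cl L k -> ch k `<=` left_of r -> cuts i r k ->
  ch i `<=` left_of r.
Proof.
move=> ci cr ck s h; have [pr pk] := (ch_mid r, ch_mid k).
have [t /andP[t0 t1] z] := affine_zero (cuts_side h pr pk).
have [ik kp] := s _ pk.
apply: (cl_pos PL cr ci (p := seg (mid r) (mid k) t)).
  apply: disc_ch => //; first exact: cl_geo ci.
  by apply: disc_seg; rewrite ?ltW//; exact: ch_disc (cl_geo cr) pr.
by rewrite side_seg (side_ch pr) mulr0 add0r mulr_gt0.
Qed.

(** On the line from p to q the function side h is affine and vanishes at t, so
    signs of side h compare parameters. *)
Lemma seg_sign h p q t s1 s2 : side h (seg p q t) = 0 -> side h p != 0 -> 0 < t ->
  (side h (seg p q s1) * side h (seg p q s2) < 0) = ((t - s1) * (t - s2) < 0).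
Proof.
move=> z n t0; have t0' : t != 0 by rewrite gt_eqF.
have E s : side h (seg p q s) = side h p / t * (t - s).
  have B : t * side h q = (t - 1) * side h p by move: z; rewrite side_seg; lra.
  apply: (mulIf t0'); rewrite mulrAC divfK// side_seg mulrDl -[s * _ * t]mulrA [side h q * t]mulrC B; ring.
rewrite !E mulrACA -expr2.
have P : 0 < (side h p / t) ^+ 2 by rewrite lt_neqAle sqr_ge0 eq_sym sqrf_eq0 mulf_neq0// invr_eq0.
by rewrite pmulr_rlt0.
Qed.

Section P.
Hypothesis P : P_pre_lamination L.

Lemma P_root c : inner L c ->
  exists r, [/\ adj L c r, ~ L r & forall l, adj L c l -> ~ L l -> l = r].
Proof.
move=> ic; case: P => _ _ _ sh _.
have [_ _ [B [[/(bcP PL _ ic) [r [ar E]] nB] uB]]] := sh _ (inner_complementary ic).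
have gr := cl_geo (adj_cl ar).
exists r; split => //; first by move=> Lr; apply: nB; rewrite E; apply/leaf_ch.
move=> l al nl; have gl := cl_geo (adj_cl al).
apply: (adj_same al ar); apply: (ch_inj gr gl); rewrite -E; apply: uB; split.
  by apply/(bcP PL _ ic); exists l.
by move/(leaf_ch PL gl).
Qed.

(** A nonleaf limit chord with leaves accumulating on both sides would be a
    region with empty interior. *)
Lemma P_one_sided l : cl L l -> ~ L l -> accum L l -> accum L (flip l) -> False.
Proof.
move=> cll nl a1 a2; have pm := ch_mid l; have im := ch_disc (cl_geo cll) pm.
have off m : L m -> side m (mid l) != 0.
  by move=> Lm; apply: (cl_side_ne PL (leaf_cl PL Lm) cll) pm => s; apply: nl; exact: (pl_same PL s).
case: P => _ _ _ sh _; have [|_ [q]] := sh (region L (mid l)).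
  by apply/regionP => //; exists (mid l).
rewrite interior_region// => -[hq iq] _.
case: (closed_region_adj PL iq cll pm).
- by apply: region_closed_region; rewrite (region_eq hq); exact: region_refl.
- exact: accum_not_adj.
- exact: accum_not_adj.
Qed.

Lemma P_dense : dense_lamination L. Proof. by case: P. Qed.

Lemma exit_ex f : L f -> exists r, exit f r.
Proof.
move=> Lf; have cf := leaf_cl PL Lf.
case: (accum_or_adj PL cf) => [a|[c ic af]].
  by exists f; split; [exact: (pl_geo PL Lf)|exact: a|left].
have [r [ar nr ur]] := P_root ic.
have cr := adj_cl ar.
exists (flip r); split; first exact: (geo_flip (cl_geo cr)).
  case: (cl_accum cr) => // a; by case: (accum_not_adj PL a ar).
right; exists c; split => //.
by move=> /(pl_flip PL); rewrite flipK.
Qed.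

(** If r is not a leaf, it is the root of a shell on its right, and this shell
    has a leaf on its boundary. *)
Lemma entry_ex r : geo r -> accum L r -> exists m, L m /\ exit m r.
Proof.
move=> gr ar; have cr := accum_cl gr ar.
have [Lr|nr] := pselect (L r); first by exists r; split => //; split => //; left.
case: (accum_or_adj PL (cl_flip PL cr)) => [a|[c ic a]].
  by case: (P_one_sided cr nr ar a).
have nr' : ~ L (flip r) by move=> /(pl_flip PL); rewrite flipK.
have [r' [ar' _ ur]] := P_root ic.
have E := ur _ a nr'; rewrite -E in ur.
have [m [Lm am]] := exists_leaf_bdry P_dense ic a ur.
by exists m; split => //; split => //; right; exists c.
Qed.

Definition upto f k h := [/\ L h, ch h `<=` left_of f & cuts h f k \/ h = k].
(** Half of what makes the leaves around f an interval: the leaves from f to k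
    have no two consecutive elements, and f has no successor. *)
Definition dense_upto f k := [/\ L k, ch k `<=` left_of f,
  forall h, upto f k h -> exists i, [/\ L i, ch i `<=` left_of f & cuts i f h] &
  forall h1 h2, upto f k h1 -> upto f k h2 -> ~ same h1 h2 -> exists i, L i /\ cuts i h1 h2].

(** Leaves accumulate on r from beyond. *)
Lemma exit_near f r h : L f -> exit f r -> L h -> ch h `<=` left_of r ->
  exists i, [/\ L i, ch i `<=` left_of r, cuts i r h & cuts i f h].
Proof.
move=> Lf ex Lh s; have [gr ar _] := ex.
have [_ hp] := s _ (ch_mid h).
have [i [Li si _ i1 i2]] := accum_near PL gr ar hp filterT.
have [[ci cr] chh] := (leaf_cl PL Li, exit_cl ex, leaf_cl PL Lh).
have sr : cuts i r h.
  by apply: (spcI PL ci cr chh (ch_mid r) (ch_mid h)); rewrite nmulr_rlt0//; exact: i2 (ch_mid r).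
exists i; split => //; apply: (exit_cuts' Lf ex Li chh) => // /same_ch e.
have [_] := exit_left_of Lf ex (si _ (ch_mid i)); rewrite (side_ch (l := f)) ?ltxx// e.
exact: ch_mid.
Qed.

(** A leaf k beyond the exit of f and close enough to it, by [accum_dense]. *)
Lemma dense_upto_ex f : L f -> exists k, dense_upto f k.
Proof.
move=> Lf; have [r ex] := exit_ex Lf; have [gr ar _] := ex.
have [_ _ _ _ nobad] := P.
have [k0 [Lk0 sk0 k0w tg]] := accum_dense PL nobad gr ar.
have [k [Lk sk srk sfk]] := exit_near Lf ex Lk0 sk0.
have [[cr ck] ck0] := (exit_cl ex, leaf_cl PL Lk, leaf_cl PL Lk0).
have B h : upto f k h -> nearer L r k0 h.
  move=> [Lh sh [hs|->]]; last by [].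
  have chh := leaf_cl PL Lh.
  have hs' := exit_cuts Lf ex Lh ck hs.
  split => //; first exact: (cuts_beyond chh cr ck sk hs').
  exact: (cuts_trans PL chh ck cr ck0 hs' srk).
exists k; split => //.
- by move=> q /sk /(exit_left_of Lf ex).
- move=> h /B [Lh sh _]; have [i [Li si _ sf]] := exit_near Lf ex Lh sh.
  by exists i; split => // q /si /(exit_left_of Lf ex).
- by move=> h1 h2 /B b1 /B b2 ns; exact: tg.
Qed.

Definition leaves_between a b : set (set pl) := [set x | exists h, [/\ L h, x = ch h & cuts h a b]].

(** Each leaf that separates k from k' crosses the segment joining their
    midpoints once, and separation of such leaves is betweenness of the
    parameters of the crossing points. This turns the axioms of open intervals
    into statements on an ordered set of parameters. *)
Lemma dense_upto_interval f k k' : L f -> dense_upto f k -> dense_upto (flip f) k' ->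
  open_interval L (leaves_between k k') /\ cuts f k k'.
Proof.
move=> Lf [Lk sk g1 g2] [Lk' sk' g1' g2'].
have fk : cuts f k k' by left.
have geoL h : L h -> geo h := fun x => pl_geo PL x.
have clL h : L h -> cl L h := fun x => leaf_cl PL x.
have [pk pk'] := (ch_mid k, ch_mid k').
have [ik ik'] := (ch_disc (geoL _ Lk) pk, ch_disc (geoL _ Lk') pk').
have crossing h : L h -> cuts h k k' -> exists t, [/\ 0 < t < 1, ch h (seg (mid k) (mid k') t),
    side h (seg (mid k) (mid k') t) = 0 & side h (mid k) != 0].
  move=> Lh s; have n := cuts_side s pk pk'; have [t t01 z] := affine_zero n.
  exists t; split => //.
    apply: disc_ch => //; first exact: geoL.
    by apply: disc_seg => //; case/andP: t01 => *; rewrite !ltW.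
  by apply/eqP => e; move: n; rewrite e mul0r ltxx.
have [tf [/andP[tf0 tf1] hf zf nf]] := crossing f Lf fk.
have btI h t1 t2 h1 h2 t : L h -> L h1 -> L h2 -> 0 < t -> side h (seg (mid k) (mid k') t) = 0 ->
    side h (mid k) != 0 -> ch h1 (seg (mid k) (mid k') t1) -> ch h2 (seg (mid k) (mid k') t2) ->
    (t - t1) * (t - t2) < 0 -> cuts h h1 h2.
  move=> Lh L1 L2 t0 z n c1 c2 neg; apply: (spcI PL (clL _ Lh) (clL _ L1) (clL _ L2) c1 c2).
  by rewrite (seg_sign _ _ z n t0).
have btE h t1 t2 h1 h2 t : 0 < t -> side h (seg (mid k) (mid k') t) = 0 ->
    side h (mid k) != 0 -> ch h1 (seg (mid k) (mid k') t1) -> ch h2 (seg (mid k) (mid k') t2) ->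
    cuts h h1 h2 -> (t - t1) * (t - t2) < 0.
  by move=> t0 z n c1 c2 s; rewrite -(seg_sign _ _ z n t0); exact: cuts_side s c1 c2.
have k0 : ch k (seg (mid k) (mid k') 0) by rewrite seg0.
have k1 : ch k' (seg (mid k) (mid k') 1) by rewrite seg_1.
have diff h1 h2 t : L h1 -> L h2 -> ch h1 (seg (mid k) (mid k') t) -> ch h2 (seg (mid k) (mid k') t) -> same h1 h2.
  by move=> L1 L2; exact: (cl_meet PL (clL _ L1) (clL _ L2)).
have [_ f0] := sk _ pk.
have C0 : 0 < side f (mid k) / tf by exact: divr_gt0.
have feq s : side f (seg (mid k) (mid k') s) = side f (mid k) / tf * (tf - s).
  have B : tf * side f (mid k') = (tf - 1) * side f (mid k) by move: zf; rewrite side_seg; lra.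
  have tn : tf != 0 by rewrite gt_eqF.
  apply: (mulIf tn); rewrite mulrAC divfK// side_seg mulrDl -[s * _ * tf]mulrA [side f (mid k') * tf]mulrC B; ring.
have alt h : L h -> cuts h k k' -> [\/ same f h, upto f k h /\ cuts h f k | upto (flip f) k' h /\ cuts h f k'].
  move=> Lh s; have [t [/andP[t0 t1] ct zt nt]] := crossing h Lh s.
  case: (ltrgtP t tf) => tt; last by apply: Or31; apply: (diff f h t) => //; rewrite tt.
    have sp1 : cuts h f k by apply: (btI h tf 0 _ _ t) => //; nra.
    apply: Or32; split => //; split; [exact: Lh| |by left].
    by apply: (cl_pos PL (clL _ Lf) (clL _ Lh) ct); rewrite feq mulr_gt0// subr_gt0.
  have sp1 : cuts h f k' by apply: (btI h tf 1 _ _ t) => //; nra.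
  apply: Or33; split => //; split; [exact: Lh| |by left; rewrite /cuts ch_flip].
  by apply: (cl_neg PL (clL _ Lf) (clL _ Lh) ct); rewrite feq pmulr_rlt0// subr_lt0.
have kbt : upto f k k by split => //; right.
have kbt' : upto (flip f) k' k' by split => //; right.
split => //; split.
- by split; [exists (ch f), f|move=> _ [h [Lh -> _]]; apply/leafE; exists h].
- move=> _ _ _ [f1 [L1 -> s1]] [f2 [L2 -> s2]] [f3 [L3 -> s3]] n12 n23 n13.
  have [t1 [/andP[a1 b1] c1 z1 n1]] := crossing _ L1 s1.
  have [t2 [/andP[a2 b2] c2 z2 n2_]] := crossing _ L2 s2.
  have [t3 [/andP[a3 b3] c3 z3 n3]] := crossing _ L3 s3.
  have ne12 : t1 != t2 by apply/eqP => e; apply: n12; apply/esym/same_ch; apply: (diff _ _ t1) => //; rewrite e.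
  have ne23 : t2 != t3 by apply/eqP => e; apply: n23; apply/esym/same_ch; apply: (diff _ _ t2) => //; rewrite e.
  have ne13 : t1 != t3 by apply/eqP => e; apply: n13; apply/esym/same_ch; apply: (diff _ _ t1) => //; rewrite e.
  have G h h1 h2 t u1 u2 : L h -> L h1 -> L h2 -> 0 < t -> side h (seg (mid k) (mid k') t) = 0 ->
    side h (mid k) != 0 -> ch h1 (seg (mid k) (mid k') u1) -> ch h2 (seg (mid k) (mid k') u2) ->
    (t - u1) * (t - u2) < 0 -> separates (ch h) (ch h1) (ch h2).
    by move=> Lh ? ? ? ? ? ? ? ?; apply/cuts_sep; [exact: geoL|apply: (btI h u1 u2 _ _ t)].
  case/orP: (lt_total ne12) => o12; case/orP: (lt_total ne23) => o23; case/orP: (lt_total ne13) => o13;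
    (try (exfalso; lra));
    solve [apply: Or31; apply: (G f1 f2 f3 t1 t2 t3) => //; nra
          |apply: Or32; apply: (G f2 f1 f3 t2 t1 t3) => //; nra
          |apply: Or33; apply: (G f3 f1 f2 t3 t1 t2) => //; nra].
- move=> _ _ _ /leafE [h [Lh ->]] [f1 [L1 -> s1]] [f2 [L2 -> s2]] /(cuts_sep _ _ (geoL _ Lh)) s.
  exists h; split => //.
  exact: (cuts_between PL (clL _ Lh) (clL _ L1) (clL _ L2) (clL _ Lk) (clL _ Lk') s1 s2 s).
- move=> _ [h [Lh -> s]]; case: (alt h Lh s) => [sf|[bh hs]|[bh hs]].
  + have [i [Li si i1]] := g1 k kbt; have [i' [Li' si' i1']] := g1' k' kbt'.
    exists (ch i), (ch i'); split.
    * exists i; split => //; apply: (cuts_trans PL (clL _ Li) (clL _ Lf) (clL _ Lk) (clL _ Lk') (cuts_sym i1) fk).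
    * exists i'; split => //; apply: cuts_sym.
      apply: (cuts_trans PL (clL _ Li') (clL _ Lf) (clL _ Lk') (clL _ Lk) _ (cuts_sym fk)).
      by apply: cuts_sym; move: i1'; rewrite /cuts ch_flip.
    * by apply/cuts_sep; [exact: geoL|apply: (same_cuts sf); left].
  + have [i [Li i1]] : exists i, L i /\ cuts i h k.
      by apply: g2 => // n; apply: (cuts_nsame (cuts_sym hs)) ; exact: n.
    have si : cuts i k k' by apply: (cuts_trans PL (clL _ Li) (clL _ Lh) (clL _ Lk) (clL _ Lk') (cuts_sym i1) s).
    exists (ch i), (ch f); split; [by exists i|by exists f|].
    have [t [/andP[t0 t1] ct zt nt]] := crossing h Lh s.
    have [ti [/andP[ti0 ti1] cti zti nti]] := crossing i Li si.
    have u1 := btE h tf 0 _ _ t t0 zt nt hf k0 hs.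
    have u2 := btE i t 0 _ _ ti ti0 zti nti ct k0 i1.
    by apply/cuts_sep; [exact: geoL|apply: (btI h ti tf _ _ t) => //; nra].
  + have [i [Li i1]] : exists i, L i /\ cuts i h k'.
      by apply: g2' => // n; apply: (cuts_nsame (cuts_sym hs)) ; exact: n.
    have si : cuts i k k'.
      apply: cuts_sym; exact: (cuts_trans PL (clL _ Li) (clL _ Lh) (clL _ Lk') (clL _ Lk) (cuts_sym i1) (cuts_sym s)).
    exists (ch i), (ch f); split; [by exists i|by exists f|].
    have [t [/andP[t0 t1] ct zt nt]] := crossing h Lh s.
    have [ti [/andP[ti0 ti1] cti zti nti]] := crossing i Li si.
    have u1 := btE h tf 1 _ _ t t0 zt nt hf k1 hs.
    have u2 := btE i t 1 _ _ ti ti0 zti nti ct k1 i1.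
    have v1 : 0 < t - tf by move: u1; rewrite nmulr_llt0 ?subr_lt0.
    have v2 : 0 < ti - t by move: u2; rewrite nmulr_llt0 ?subr_lt0.
    apply/cuts_sep; [exact: geoL|apply: (btI h ti tf _ _ t) => //].
    by rewrite nmulr_rlt0// -opprB oppr_lt0.
- move=> _ _ [h1 [L1 -> s1]] [h2 [L2 -> s2]] ne.
  have ns : ~ same h1 h2 by move=> /same_ch e; apply: ne.
  suff [i [Li si]] : exists i, L i /\ cuts i h1 h2.
    by exists (ch i); split; [apply/leafE; exists i|apply/cuts_sep => //; exact: geoL].
  have F h : same f h1 -> upto f k h -> exists i, L i /\ cuts i h1 h.
    by move=> sf /g1 [i [Li _ si]]; exists i; split => //; exact: same_spcl sf si.
  have F' h : same f h1 -> upto (flip f) k' h -> exists i, L i /\ cuts i h1 h.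
    move=> sf /g1' [i [Li _ si]]; exists i; split => //; apply: (same_spcl sf).
    by move: si; rewrite /cuts ch_flip.
  have F2 h : same f h2 -> upto f k h -> exists i, L i /\ cuts i h h2.
    by move=> sf /g1 [i [Li _ si]]; exists i; split => //; apply: cuts_sym; exact: same_spcl sf si.
  have F2' h : same f h2 -> upto (flip f) k' h -> exists i, L i /\ cuts i h h2.
    move=> sf /g1' [i [Li _ si]]; exists i; split => //; apply: cuts_sym; apply: (same_spcl sf).
    by move: si; rewrite /cuts ch_flip.
  case: (alt _ L1 s1) => [e1|[e1 _]|[e1 _]]; case: (alt _ L2 s2) => [e2|[e2 _]|[e2 _]].
  + by case: ns; exact: same_trans (same_sym e1) e2.
  + exact: F.
  + exact: F'.
  + exact: F2.
  + exact: g2.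
  + by exists f; split => //; left; case: e1 => _ ? _; case: e2.
  + exact: F2'.
  + by exists f; split => //; right; case: e1 => _ ? _; case: e2.
  + exact: g2'.
Qed.

Lemma interval_through f : L f -> exists I, open_interval L I /\ I (ch f).
Proof.
move=> Lf; have [k gk] := dense_upto_ex Lf; have [k' gk'] := dense_upto_ex (pl_flip PL Lf).
have [oi s] := dense_upto_interval Lf gk gk'.
by exists (leaves_between k k'); split => //; exists f.
Qed.

End P.
End PLam.

(** * The topology of the leaf space *)

Section Intervals.
Variable R : realType.
Notation pl := (plane R).
Implicit Types (p q w z c : plane R) (l m k g h i j f r : plane R * plane R).

(** A subbase: a neighbourhood of a leaf contains a finite intersection of open
    intervals. *)
Lemma leaf_open L (U : set (leaf_space L)) : open U <->
  forall x, U x -> exists2 s : seq (set (set pl)),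
    (forall I, I \in s -> open_interval L I /\ I (sval x)) &
    forall y : leaf_space L, (forall I, I \in s -> I (sval y)) -> U y.
Proof.
split.
  move=> [D' sD <-] x [A D'A Ax].
  have [s sP E] := sD _ D'A; exists (enum_fset s).
    move=> I Is; split; first exact: (@set_mem _ (@open_interval R L) I (sP I Is)).
    by move: Ax => /=; rewrite /isBaseTopological.b /= -E => /(_ I Is).
  move=> y hy; exists A => //.
  by rewrite /isBaseTopological.b /= -E => I Is; exact: hy.
move=> h; exists [set A | finI_from (@open_interval R L)
  (fun I : set (set pl) => [set l : leaf_space L | I (sval l)]) A /\ A `<=` U].
  by move=> A [].
apply/seteqP; split=> [x [A [_ AU] /AU]//|x /h [s h1 h2]].
exists (\bigcap_(I in [set I | I \in s]) [set l : leaf_space L | I (sval l)]); last first.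
  by move=> I /= Is; case: (h1 I Is).
split; last by move=> y hy; apply: h2 => I Is; exact: hy.
exists [fset I | I in s]%fset.
  by move=> I; rewrite !inE => Is; apply: mem_set; case: (h1 I Is).
by apply/seteqP; split=> y hy I /= Is; apply: hy; move: Is; rewrite /= !inE.
Qed.

Lemma dense_interval L1 L2 I : dense (@leaf_image R L1 L2) -> open_interval L2 I ->
  exists l, L1 l /\ I (ch l).
Proof.
move=> dn oi; have [[[x Ix] sub] _ _ _ _] := oi.
pose x' : leaf_space L2 := exist _ x (mem_set (sub _ Ix)).
have [||y [Iy]] := dn [set y : leaf_space L2 | I (sval y)].
- by exists x'.
- apply/leaf_open => y Iy; exists [:: I] => [J|z hz]; first by rewrite inE => /eqP ->.
  by apply: hz; rewrite inE.
by move=> /leafE [l [Ll E]]; exists l; split => //; rewrite -E.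
Qed.

Lemma left_of_end l a : ch a `<=` left_of l -> 0 <= side l a.1 /\ 0 <= side l a.2.
Proof.
move=> s; have : closure (ch a) `<=` [set p | 0 <= side l p].
  apply: clos_min; first by apply: closed_ge0; exact: side_cont_p.
  by move=> p /s [_ /ltW].
by move=> h; split; apply: h; case: (end_closure a).
Qed.

Section Fixed.
Variable L : set (pl * pl).
Hypothesis PL : pre_lamination L.

Lemma cuts_trans' i h a b : cl L i -> cl L h -> cl L a -> cl L b ->
  cuts i a h -> cuts h a b -> cuts h i b.
Proof.
move=> hi hh ca cb s1 s2; have [pa pb] := (ch_mid a, ch_mid b).
have [ia ib] := (ch_disc (cl_geo ca) pa, ch_disc (cl_geo cb) pb).
have [t /andP[t0 t1] z] := affine_zero (cuts_side s2 pa pb).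
have w : ch h (seg (mid a) (mid b) t).
  by apply: disc_ch => //; [exact: cl_geo hh|apply: disc_seg => //; rewrite !ltW].
have iw := ch_disc (cl_geo hh) w.
have [u /andP[u0 u1] zu] := affine_zero (cuts_side s1 pa w).
have v : ch i (seg (mid a) (seg (mid a) (mid b) t) u).
  by apply: disc_ch => //; [exact: cl_geo hi|apply: disc_seg => //; rewrite !ltW].
apply: (spcI PL hh hi cb v pb).
rewrite (side_seg _ _ _ u) z mulr0 addr0 -mulrA pmulr_rlt0 ?subr_gt0//.
exact: cuts_side s2 pa pb.
Qed.

Lemma interval_side I f : open_interval L I -> L f -> I (ch f) ->
  exists j, [/\ L j, I (ch j) & ch j `<=` left_of f].
Proof.
move=> [[_ sub] _ _ sepr _] Lf If.
have [x [y [Ix Iy s]]] := sepr _ If.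
have /leafE [a [La xE]] := sub _ Ix; have /leafE [b [Lb yE]] := sub _ Iy.
rewrite xE yE in Ix Iy s; have := (cuts_sep _ _ (pl_geo PL Lf)).1 s.
by case=> -[s1 s2]; [exists a|exists b].
Qed.

(** The part of an open interval strictly between two of its leaves is an open
    interval; density inside I provides what the axioms ask at the new ends. *)
Lemma sub_interval I a b : open_interval L I -> L a -> L b -> I (ch a) -> I (ch b) ->
  ch a <> ch b ->
  open_interval L [set x | I x /\ exists h, [/\ L h, x = ch h & cuts h a b]].
Proof.
move=> [[_ sub] tri conv sepr den] La Lb Ia Ib ne.
have clL h : L h -> cl L h := fun x => leaf_cl PL x.
have geoL h : L h -> geo h := fun x => pl_geo PL x.
have ca := clL _ La; have cb := clL _ Lb.
have bet g h : L g -> L h -> I (ch g) -> I (ch h) -> ch g <> ch h ->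
    exists i, [/\ L i, cuts i g h & I (ch i)].
  move=> Lg Lh Ig Ih n; have [x [/leafE [i [Li xE]] s]] := den _ _ Ig Ih n.
  rewrite xE in s; exists i; split => //; first by apply/cuts_sep => //; exact: geoL.
  by apply: (conv _ _ _ _ Ig Ih s); apply/leafE; exists i.
split.
- split.
    have [i [Li si Ii]] := bet a b La Lb Ia Ib ne.
    by exists (ch i); split => //; exists i.
  by move=> x [/sub].
- by move=> x y z [Ix _] [Iy _] [Iz _]; exact: tri.
- move=> x f1 f2 /leafE [h [Lh ->]] [I1 [h1 [L1 E1 s1]]] [I2 [h2 [L2 E2 s2]]] s.
  rewrite E1 in I1 s; rewrite E2 in I2 s.
  have s' := (cuts_sep _ _ (geoL _ Lh)).1 s.
  split; first by apply: (conv _ _ _ _ I1 I2 s); apply/leafE; exists h.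
  by exists h; split => //; apply: (cuts_between PL (clL _ Lh) (clL _ L1) (clL _ L2) ca cb s1 s2 s').
- move=> x [Ix [h [Lh E s]]]; rewrite E in Ix *.
  have n1 : ch a <> ch h.
    by move=> e; apply: (cuts_nsame s); apply: ch_inj; [exact: geoL|exact: geoL|].
  have n2 : ch b <> ch h.
    by move=> e; apply: (cuts_nsame (cuts_sym s)); apply: ch_inj; [exact: geoL|exact: geoL|].
  have [i [Li si Ii]] := bet a h La Lh Ia Ix n1.
  have [j [Lj sj Ij]] := bet b h Lb Lh Ib Ix n2.
  have [[ci chh] cj] := (clL _ Li, clL _ Lh, clL _ Lj).
  exists (ch i), (ch j); split.
  + by split => //; exists i; split => //; exact: (cuts_trans PL ci chh ca cb si s).
  + by split => //; exists j; split => //; apply: cuts_sym; exact: (cuts_trans PL cj chh cb ca sj (cuts_sym s)).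
  + apply/cuts_sep; first exact: geoL.
    have hib := cuts_trans' ci chh ca cb si s.
    by apply: cuts_sym; apply: (cuts_trans' cj chh cb ci sj); exact: cuts_sym.
- by move=> x y [Ix _] [Iy _]; exact: den.
Qed.

Section P.
Hypothesis P : P_pre_lamination L.

(** When r is the root of the shell that m borders, j lies beyond a boundary
    chord of the shell. If that chord were a leaf m' it would be in I by
    convexity, and m and m' would be separated by a leaf, though they bound a
    common region. So it is r. *)
Lemma interval_beyond I m r j : L m -> exit L m r -> open_interval L I -> I (ch m) ->
  L j -> I (ch j) -> ch j `<=` left_of m -> ch j `<=` left_of r.
Proof.
move=> Lm ex [_ _ conv _ den] Im Lj Ij sj; have cr := exit_cl ex.
have [gr ar [->//|[c [ic am ar' nr]]]] := ex.
have clL h : L h -> cl L h := fun x => leaf_cl PL x.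
have pj := ch_mid j; have ij := ch_disc (pl_geo PL Lj) pj.
apply: (cl_pos PL cr (clL _ Lj) pj); rewrite ltNge; apply/negP => le.
have [m' [am' zm']] := facing_leaf PL ic (clL _ Lj).
have nr' : ~ L (flip r) by move=> /(pl_flip PL); rewrite flipK.
have Lm' : L m'.
  apply: contrapT => nm'; have [r0 [_ _ ur]] := P_root PL P ic.
  have E : m' = flip r by rewrite (ur _ am' nm') (ur _ ar' nr').
  move: zm'; rewrite E side_flip oppr_le0 => ge.
  have z : side r (mid j) = 0 by apply/eqP; rewrite eq_le le ge.
  apply: nr; apply: (pl_same PL _ Lj).
  by apply: (cl_meet PL (clL _ Lj) cr pj); apply: disc_ch.
have nmm : ~ same m m'.
  by move=> /(adj_same am am') e; have [_] := sj _ pj; rewrite e ltNge zm'.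
have Im' : I (ch m').
  have [s|ns] := pselect (same m' j); first by rewrite -(same_ch s).
  apply: (conv _ (ch m) (ch j)) => //; first by apply/leafE; exists m'.
  apply/cuts_sep; first exact: (pl_geo PL).
  apply: (spcI PL (clL _ Lm') (clL _ Lm) (clL _ Lj) (ch_mid m) pj).
  have [_ p0] : left_of m' (mid m) by apply: (adj_facing PL am' am _ (ch_mid m)) => /same_sym.
  rewrite pmulr_rlt0// lt_neqAle zm' andbT.
  exact: (cl_side_ne PL (clL _ Lm') (clL _ Lj) ns pj).
have ne : ch m <> ch m'.
  by move=> e; apply: nmm; apply: same_sym; apply: ch_inj => //; exact: (pl_geo PL).
have [x [/leafE [i [Li ->]] s]] := den _ _ Im Im' ne.
have s' := (cuts_sep _ _ (pl_geo PL Li)).1 s.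
have n := cuts_side s' (ch_mid m) (ch_mid m').
have [_ _ h1] := am; have [_ _ h2] := am'.
have u1 := h1 i _ (clL _ Li) (ch_mid m); have u2 := h2 i _ (clL _ Li) (ch_mid m').
have u3 := inner_sq ic (clL _ Li).
move: n; rewrite ltNge => /negP; apply.
rewrite -(pmulr_rge0 _ u3).
have -> : side i c * side i c * (side i (mid m) * side i (mid m')) =
  (side i c * side i (mid m)) * (side i c * side i (mid m')) by ring.
exact: mulr_ge0.
Qed.

(** I contains a leaf j on the left of m, which is beyond r; a leaf close to r
    and beyond it separates m from j. *)
Lemma interval_near I m r : L m -> exit L m r -> open_interval L I -> I (ch m) ->
  \forall l \near r, (L l -> ch l `<=` left_of r -> I (ch l)).
Proof.
move=> Lm ex oi Im; have [[_ sub] tri conv sepr den] := oi; have cr := exit_cl ex.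
have [j [Lj Ij sj]] := interval_side oi Lm Im.
have sr := interval_beyond Lm ex oi Im Lj Ij sj.
have [_ jp] := sr _ (ch_mid j).
have [gr ar _] := ex.
apply: filterS (beyond_near gr jp) => l hl Ll sl.
have [l1 l2] := hl (pl_geo PL Ll) sl.
apply: (conv _ (ch m) (ch j)) => //; first by apply/leafE; exists l.
have [cl_ cj] := (leaf_cl PL Ll, leaf_cl PL Lj).
apply/cuts_sep; first exact: (pl_geo PL).
apply: (exit_cuts' PL Lm ex Ll cj).
  move=> /same_ch e; have [_] := exit_left_of PL Lm ex (sl _ (ch_mid l)).
  by rewrite (side_ch (l := m)) ?ltxx// e; exact: ch_mid.
by apply: (spcI PL cl_ cr cj (ch_mid r) (ch_mid j)); rewrite nmulr_rlt0//; exact: l2 (ch_mid r).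
Qed.

End P.
End Fixed.
End Intervals.

(** * Leaves with a common end *)

Section Stereo.
Variable R : realType.
Notation pl := (plane R).
Implicit Types (p q w z c th : plane R) (l m k g h i j f r : plane R * plane R) (s t : R).

(** Stereographic projection from th, inverted: the points of the circle other
    than th, in counterclockwise order. *)
Definition stereo th s : pl :=
  (((s ^+ 2 - 1) * th.1 + 2 * s * th.2) / (s ^+ 2 + 1),
   ((s ^+ 2 - 1) * th.2 - 2 * s * th.1) / (s ^+ 2 + 1)).

Lemma den_gt0 s : 0 < s ^+ 2 + 1.
Proof. by rewrite ltr_wpDl ?sqr_ge0. Qed.
Lemma den_neq0 s : s ^+ 2 + 1 != 0.
Proof. by rewrite gt_eqF ?den_gt0. Qed.

Lemma stereo_circle th s : circle th -> circle (stereo th s).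
Proof.
move=> /circ_n2; rewrite /n2 => e; apply/circ_n2; rewrite /n2 /stereo /=.
have d := den_neq0 s.
transitivity ((th.1 ^+ 2 + th.2 ^+ 2) * (s ^+ 2 + 1) ^+ 2 / (s ^+ 2 + 1) ^+ 2); first by field.
by rewrite e mul1r divff// expf_neq0.
Qed.

(** For chords ending at th, being on the left is comparing parameters. *)
Lemma side_stereo th s t : circle th ->
  side (th, stereo th s) (stereo th t) = 4 * (t - s) / ((s ^+ 2 + 1) * (t ^+ 2 + 1)).
Proof.
move=> /circ_n2; rewrite /n2 => e; rewrite /side /stereo /=.
have d := den_neq0 s; have d' := den_neq0 t.
transitivity ((th.1 ^+ 2 + th.2 ^+ 2) * (4 * (t - s) / ((s ^+ 2 + 1) * (t ^+ 2 + 1)))).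
  by field; rewrite d d'.
by rewrite e mul1r.
Qed.

Lemma side_stereo_gt0 th s t : circle th -> (0 < side (th, stereo th s) (stereo th t)) = (s < t).
Proof.
have D : 0 < ((s ^+ 2 + 1) * (t ^+ 2 + 1))^-1 by rewrite invr_gt0 mulr_gt0 ?den_gt0.
by move=> c; rewrite side_stereo// pmulr_lgt0// pmulr_rgt0// subr_gt0.
Qed.

Lemma side_stereo_lt0 th s t : circle th -> (side (th, stereo th s) (stereo th t) < 0) = (t < s).
Proof.
have D : 0 < ((s ^+ 2 + 1) * (t ^+ 2 + 1))^-1 by rewrite invr_gt0 mulr_gt0 ?den_gt0.
by move=> c; rewrite side_stereo// pmulr_llt0// pmulr_rlt0// subr_lt0.
Qed.

Lemma stereo_neq th s : circle th -> stereo th s <> th.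
Proof.
move=> c e; have := side_stereo_gt0 s (s + 1) c.
by rewrite e /side /= !subrr !mul0r subrr ltxx ltrDl ltr01.
Qed.

Lemma stereo_geo th s : circle th -> geo (th, stereo th s).
Proof.
by move=> c; split => //=; [exact: stereo_circle|move=> /esym; exact: stereo_neq].
Qed.

Lemma stereo_inj th s t : circle th -> stereo th s = stereo th t -> s = t.
Proof.
have z u : side (th, stereo th u) (stereo th u) = 0 := side_2 (th, stereo th u).
move=> c e; case: (ltgtP s t) => // h.
  by have := side_stereo_gt0 s t c; rewrite h e z ltxx.
by have := side_stereo_gt0 t s c; rewrite h e z ltxx.
Qed.

Lemma stereo_surj th z : circle th -> circle z -> z <> th -> exists s, z = stereo th s.
Proof.
move=> /circ_n2; rewrite /n2 => e /circ_n2; rewrite /n2 => e' ne.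
pose d := 1 - (th.1 * z.1 + th.2 * z.2).
have d0 : d != 0.
  apply/eqP => d0; apply: ne.
  have : (th.1 - z.1) ^+ 2 + (th.2 - z.2) ^+ 2 = 0.
    transitivity ((th.1 ^+ 2 + th.2 ^+ 2) + (z.1 ^+ 2 + z.2 ^+ 2) - 2 * (1 - d)); first by rewrite /d; ring.
    by rewrite e e' d0; ring.
  move=> /eqP; rewrite paddr_eq0 ?sqr_ge0// !sqrf_eq0 !subr_eq0 => /andP[/eqP a /eqP b].
  exact: plane_eq.
pose x := th.1 * z.2 - th.2 * z.1.
have xx : x ^+ 2 = 1 - (1 - d) ^+ 2.
  transitivity ((th.1 ^+ 2 + th.2 ^+ 2) * (z.1 ^+ 2 + z.2 ^+ 2) - (1 - d) ^+ 2); first by rewrite /x /d; ring.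
  by rewrite e e' mulr1.
have dn : (- x / d) ^+ 2 + 1 = 2 / d.
  rewrite expr_div_n sqrrN xx; have : d ^+ 2 != 0 by rewrite expf_neq0.
  by move=> d2; field.
have dm : (- x / d) ^+ 2 - 1 = 2 / d - 2 by rewrite -dn; ring.
exists (- x / d); apply: plane_eq; rewrite /stereo /= dn dm.
  have -> : z.1 = (1 - d) * th.1 - x * th.2.
    transitivity (z.1 * (th.1 ^+ 2 + th.2 ^+ 2)); first by rewrite e mulr1.
    by rewrite /d /x; ring.
  by field.
have -> : z.2 = (1 - d) * th.2 + x * th.1.
  transitivity (z.2 * (th.1 ^+ 2 + th.2 ^+ 2)); first by rewrite e mulr1.
  by rewrite /d /x; ring.
by field.
Qed.

Lemma stereo_cont th : continuous (stereo th).
Proof.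
have sq : continuous (fun s : R => s ^+ 2).
  by move=> s; have -> : (fun s : R => s ^+ 2) = (fun s => s * s) by [apply/funext => u; rewrite expr2]; apply: cvgM; exact: cvg_id.
have inv : continuous (fun s : R => (s ^+ 2 + 1)^-1).
  by move=> s; apply: cvgV; [exact: den_neq0|apply: cvgD; [exact: sq|exact: cvg_cst]].
apply: pl_cont => /=.
  by apply: (cont_M (f := fun s => (s ^+ 2 - 1) * th.1 + 2 * s * th.2)) => //; cont.
by apply: (cont_M (f := fun s => (s ^+ 2 - 1) * th.2 - 2 * s * th.1)) => //; cont.
Qed.

Lemma stereo_near th s (U : set (pl * pl)) : nbhs (th, stereo th s) U ->
  exists e : R, 0 < e /\ forall t, `|t - s| < e -> U (th, stereo th t).
Proof.
move=> nU.
have c : continuous (fun t => (th, stereo th t)).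
  by move=> t; have H := cvg_pair (F := nbhs t) (cvg_cst th) (@stereo_cont th t); exact: H.
have /nbhs_ballP [e /= e0 he] : \forall t \near s, U (th, stereo th t) by exact: c.
exists e; split => // t h; apply: he; rewrite -ball_normE /ball_ /= distrC//.
Qed.

Definition ends_at th l := l.1 = th \/ l.2 = th.

Lemma stereo_ch_pos th s t p : circle th -> ch (th, stereo th t) p ->
  (0 < side (th, stereo th s) p) = (s < t).
Proof.
move=> c /chP [u /andP[u0 u1] ->]; rewrite side_seg /= (side_1 (th, stereo th s)) mulr0 add0r.
by rewrite pmulr_rgt0// side_stereo_gt0.
Qed.
Lemma stereo_ch_neg th s t p : circle th -> ch (th, stereo th t) p ->
  (side (th, stereo th s) p < 0) = (t < s).
Proof.
move=> c /chP [u /andP[u0 u1] ->]; rewrite side_seg /= (side_1 (th, stereo th s)) mulr0 add0r.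
by rewrite pmulr_rlt0// side_stereo_lt0.
Qed.

Section Fixed.
Variable L : set (pl * pl).
Hypothesis PL : pre_lamination L.

Lemma ends_at_stereo th l : circle th -> geo l -> ends_at th l -> exists s, same (th, stereo th s) l.
Proof.
move=> c [g1 g2 n] [e|e].
  have [s E] := stereo_surj c g2 (fun E0 => n (etrans e (esym E0))).
  by exists s; left; rewrite -E -e; case: (l).
have [s E] := stereo_surj c g1 (fun E0 => n (etrans E0 (esym e))).
by exists s; right; rewrite /flip /= -E -e; case: (l).
Qed.

Lemma cuts_same_end th h a b : circle th -> L h -> ends_at th a -> ends_at th b -> cuts h a b ->
  ends_at th h.
Proof.
move=> cth Lh ea eb s.
have [lo hi] : 0 <= side h th /\ side h th <= 0.
  case: s => -[/left_of_end [u1 u2] /left_of_end [v1 v2]]; move: u1 u2 v1 v2; rewrite !side_flip;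
    case: ea => ->; case: eb => -> *; lra.
have z : side h th = 0 by apply/eqP; rewrite eq_le hi lo.
by case: (circle_ends (pl_geo PL Lh) cth z) => ->; [left|right].
Qed.

(** The facing chord g has k, which ends at th, on its right, and the region,
    which has th in its closure, on its left. So th is an end of g. *)
Lemma facing_end th c l k : circle th -> inner L c -> adj L c l -> ends_at th l -> L k ->
  ends_at th k -> exists2 g, adj L c g & ends_at th g /\ side g (mid k) <= 0.
Proof.
move=> cth ic al el Lk ek.
have ck := leaf_cl PL Lk; have pk := ch_mid k.
have [g [ag gk]] := facing_leaf PL ic ck.
exists g => //; split => //; have gp := adj_pos ag.
have cg := adj_cl ag.
have lo : 0 <= side g th.
  have ct : closure (ch l) th by case: el => <-; case: (end_closure l).
  by have [_ /(_ g cg)] := adj_cl_closed_region al ct; rewrite pmulr_rge0.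
have hi : side g th <= 0.
  have [s|ns] := pselect (same g k).
    by case: s ek => -> /= [<-|<-]; rewrite ?side_1 ?side_2.
  have n : side g (mid k) < 0.
    by rewrite lt_neqAle gk andbT; exact: (cl_side_ne PL cg ck ns pk).
  have := left_of_end (cl_neg PL cg ck pk n); rewrite !side_flip !oppr_ge0.
  by case: ek => -> [].
have z : side g th = 0 by apply/eqP; rewrite eq_le hi lo.
by case: (circle_ends (cl_geo cg) cth z) => ->; [left|right].
Qed.

Lemma accum_flip l : closure (beyond L (flip l)) l -> accum L (flip l).
Proof.
apply: closure_flip => m [Lm s]; split; first exact: pl_flip.
by rewrite ch_flip.
Qed.

Lemma stereo_accum_left th x : circle th ->
  (forall e : R, 0 < e -> exists2 s, L (th, stereo th s) & x - e < s < x) ->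
  accum L (flip (th, stereo th x)).
Proof.
move=> c h; apply: accum_flip => U /stereo_near [e [e0 he]].
have [s Ls /andP[s1 s2]] := h e e0.
exists (th, stereo th s); split; last by apply: he; rewrite ltr_norml; apply/andP; split; lra.
split => // p hp; split; first exact: (ch_disc (pl_geo PL Ls) hp).
by rewrite side_flip oppr_gt0 (stereo_ch_neg _ c hp).
Qed.

Lemma stereo_accum_right th x : circle th ->
  (forall e : R, 0 < e -> exists2 s, L (th, stereo th s) & x < s < x + e) ->
  accum L (th, stereo th x).
Proof.
move=> c h U /stereo_near [e [e0 he]].
have [s Ls /andP[s1 s2]] := h e e0.
exists (th, stereo th s); split; last by apply: he; rewrite ltr_norml; apply/andP; split; lra.
split => // p hp; split; first exact: (ch_disc (pl_geo PL Ls) hp).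
by rewrite (stereo_ch_pos _ c hp).
Qed.

Section P.
Hypothesis P : P_pre_lamination L.

(** Nested intervals with ends in K, the n-th one avoiding the element of K
    numbered n by f. Their left ends converge to a point x that is not in K; an
    element of K next to x on its right would be in all the intervals. *)
Lemma countable_gap (K : set R) (f : R -> nat) (a b : R) : K a -> K b -> a < b ->
  {in K &, injective f} ->
  (forall s t, K s -> K t -> s < t -> exists2 u, K u & s < u < t) ->
  exists x : R, [/\ a < x < b, forall e, 0 < e -> exists2 s, K s & x - e < s < x,
    ~ K x & forall u, K u -> x < u -> exists2 v, K v & x < v < u].
Proof.
move=> Ka Kb ab finj den.
have step (n : nat) (x : R * R) : exists y : R * R, K x.1 -> K x.2 -> x.1 < x.2 ->
   [/\ K y.1, K y.2, x.1 < y.1, y.1 < y.2 & y.2 < x.2 /\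
     forall k : R, K k -> f k = n -> ~ (y.1 <= k <= y.2)].
  have [[K1 [K2 lt]]|no] := pselect (K x.1 /\ (K x.2 /\ x.1 < x.2)); last first.
    by exists x => K1 K2 lt; case: no.
  have [u Ku /andP[u1 u2]] := den _ _ K1 K2 lt.
  have [p Kp /andP[p1 p2]] := den _ _ K1 Ku u1.
  have [q Kq /andP[q1 q2]] := den _ _ Ku K2 u2.
  (* The element numbered n cannot be in both halves of the interval. *)
  have [[k [Kk fk /andP[k1 k2]]]|no] := pselect (exists k : R, [/\ K k, f k = n & p <= k <= u]).
    have [v Kv /andP[v1 v2]] := den _ _ Ku Kq q1.
    exists (v, q) => _ _ _; split => //=; first by rewrite (lt_trans _ v1)// (lt_trans p1).
    split => // k' Kk' fk' /andP[k1' _].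
    have e : k' = k by apply: finj; [exact: mem_set|exact: mem_set|rewrite fk fk'].
    by have := lt_le_trans v1 k1'; rewrite e ltNge k2.
  exists (p, u) => _ _ _; split => //=; split => // k Kk fk h; apply: no; by exists k.
have [nxt hn] := choice (fun x => step x.1 x.2 : exists y, _) .
pose F := fix F n := if n is m.+1 then nxt (m, F m) else (a, b).
have inv n : [/\ K (F n).1, K (F n).2 & (F n).1 < (F n).2].
  elim: n => [//|n [k1 k2 lt]]; by have [] := hn (n, F n) k1 k2 lt.
have st n : [/\ (F n).1 < (F n.+1).1, (F n.+1).2 < (F n).2 &
    forall k : R, K k -> f k = n -> ~ ((F n.+1).1 <= k <= (F n.+1).2)].
  by have [k1 k2 lt] := inv n; have [? ? ? ? []] := hn (n, F n) k1 k2 lt.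
have mono1 (n m : nat) : (n <= m)%N -> (F n).1 <= (F m).1.
  move=> /subnKC <-; elim: (m - n)%N => [|d IH]; first by rewrite addn0.
  by rewrite addnS; apply: (le_trans IH); apply: ltW; case: (st (n + d)%N).
have mono2 (n m : nat) : (n <= m)%N -> (F m).2 <= (F n).2.
  move=> /subnKC <-; elim: (m - n)%N => [|d IH]; first by rewrite addn0.
  by rewrite addnS; apply: le_trans _ IH; apply: ltW; case: (st (n + d)%N).
have cross (n m : nat) : (F n).1 < (F m).2.
  have [_ _ lt] := inv (maxn n m).
  exact: (le_lt_trans (mono1 _ _ (leq_maxl n m)) (lt_le_trans lt (mono2 _ _ (leq_maxr n m)))).
pose A := [set y | exists n, y = (F n).1].
have ub (m : nat) : ubound A (F m).2 by move=> _ [n ->]; apply/ltW/cross.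
have A0 : A !=set0 by exists (F 0%N).1, 0%N.
have hsA : has_sup A by split => //; exists (F 0%N).2; exact: ub.
pose x := sup A.
have xl n : (F n).1 <= x by apply: ub_le_sup; [case: hsA|exists n].
have xr (m : nat) : x <= (F m).2 by apply: ge_sup.
have xl' n : (F n).1 < x by apply: lt_le_trans (xl n.+1); case: (st n).
have xr' n : x < (F n).2 by apply: (le_lt_trans (xr n.+1)); case: (st n).
have nK (k : R) : K k -> (forall n, (F n).1 <= k <= (F n).2) -> False.
  by move=> Kk h; have [_ _ /(_ k Kk erefl)] := st (f k); apply; exact: h.
exists x; split.
- by rewrite (xl' 0%N) (xr' 0%N).
- move=> e e0; have [_ [n ->] h] := sup_adherent e0 hsA.
  by exists (F n).1; [case: (inv n)|rewrite h xl'].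
- by move=> Kx; apply: (nK x Kx) => n; rewrite xl xr.
move=> u Ku xu; apply: contrapT => no; apply: (nK u Ku) => n.
rewrite (le_trans (xl n) (ltW xu)) /= leNgt; apply/negP => lt; apply: no.
by exists (F n).2; [case: (inv n)|rewrite xr'].
Qed.

(** If m1 and m2 were distinct, their parameters would be the ends of a densely
    ordered countable set K of parameters of leaves, since a leaf separating two
    leaves ending at th ends at th. At a gap z of K the limit chord l is not a
    leaf, and leaves accumulate on its right; so it is the root of a shell on
    its left. The boundary chord of the shell facing the leaf of parameter y is
    a leaf ending at th, of parameter u between z and y. But there are leaves
    with parameter strictly between z and u: they separate two boundary chords
    of the shell. *)
Lemma one_end_per_interval th I m1 m2 : circle th -> open_interval L I ->
  L m1 -> L m2 -> I (ch m1) -> I (ch m2) -> ends_at th m1 -> ends_at th m2 -> ch m1 = ch m2.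
Proof.
move=> c [_ _ conv _ den] L1 L2 I1 I2 e1 e2.
have [a sa] := ends_at_stereo c (pl_geo PL L1) e1; have [b sb] := ends_at_stereo c (pl_geo PL L2) e2.
pose S : set R := [set s | L (th, stereo th s)].
have Sa : S a by apply: (pl_same PL (same_sym sa)).
have Sb : S b by apply: (pl_same PL (same_sym sb)).
have Ia : I (ch (th, stereo th a)) by rewrite -(same_ch sa).
have Ib : I (ch (th, stereo th b)) by rewrite -(same_ch sb).
rewrite (same_ch sa) (same_ch sb).
suff main x y : S x -> S y -> I (ch (th, stereo th x)) -> I (ch (th, stereo th y)) -> x < y -> False.
  by case: (ltgtP a b) => [h|h|->//]; [case: (main a b)|case: (main b a)].
move=> Sx Sy Ix Iy xy.
have [f finj] : exists f : R -> nat, {in S &, injective f}.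
  have [_ _ /(_ th c) /countable_injP [f hf] _ _] := P.
  exists (f \o stereo th) => s t /set_mem Ss /set_mem St /= e; apply: (stereo_inj c).
  by apply: hf => //; apply: mem_set; split => //; exact: stereo_neq.
pose K := S `&` [set s | x <= s <= y].
have sepK s t u : s < u -> u < t -> S s -> S t -> S u -> cuts (th, stereo th u) (th, stereo th s) (th, stereo th t).
  move=> su ut Ss St Su; right; split=> p hp.
    split; first exact: (ch_disc (pl_geo PL Ss) hp).
    by rewrite side_flip oppr_gt0 (stereo_ch_neg _ c hp).
  split; first exact: (ch_disc (pl_geo PL St) hp).
  by rewrite (stereo_ch_pos _ c hp).
have KI s : K s -> I (ch (th, stereo th s)).
  move=> [Ss /andP[]]; rewrite le_eqVlt => /predU1P[<-//|h1].
  rewrite le_eqVlt => /predU1P[->//|h2].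
  apply: (conv _ _ _ _ Ix Iy); first by apply/leafE; exists (th, stereo th s).
  by apply/cuts_sep; [exact: (pl_geo PL Ss)|exact: sepK].
have Kx : K x by split => //=; rewrite lexx ltW.
have Ky : K y by split => //=; rewrite lexx ltW.
have denK s t : K s -> K t -> s < t -> exists2 u, K u & s < u < t.
  move=> Ks Kt st; have ne : ch (th, stereo th s) <> ch (th, stereo th t).
    move=> e; have hp : ch (th, stereo th s) (mid (th, stereo th t)) by rewrite e; exact: ch_mid.
    by have := stereo_ch_pos s c (ch_mid (th, stereo th t)); rewrite st (side_ch hp) ltxx.
  have [_ [/leafE [h [Lh ->]] sp_]] := den _ _ (KI _ Ks) (KI _ Kt) ne.
  have sp' := (cuts_sep _ _ (pl_geo PL Lh)).1 sp_.
  have [Ss /andP[s1 s2]] := Ks; have [St /andP[t1 t2]] := Kt.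
  have eh : ends_at th h by apply: (cuts_same_end c Lh _ _ sp'); left.
  have [u su] := ends_at_stereo c (pl_geo PL Lh) eh.
  have := cuts_side (same_cuts (same_sym su) sp') (ch_mid _) (ch_mid _) => n.
  have Su : S u by apply: (pl_same PL (same_sym su)).
  have U1 := stereo_ch_pos u c (ch_mid (th, stereo th s)).
  have U2 := stereo_ch_pos u c (ch_mid (th, stereo th t)).
  have V1 := stereo_ch_neg u c (ch_mid (th, stereo th s)).
  have V2 := stereo_ch_neg u c (ch_mid (th, stereo th t)).
  case: (ltrgt0P (side (th, stereo th u) (mid (th, stereo th s)))) n U1 V1 => [g0|g0|->]; last by rewrite mul0r ltxx.
    by rewrite pmulr_rlt0// V2 => tu /esym us _; have := lt_trans (lt_trans tu us) st; rewrite ltxx.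
  rewrite nmulr_rlt0// U2 => ut _ /esym su'; exists u; last by rewrite su' ut.
  by split => //=; rewrite (le_trans s1 (ltW su')) (le_trans (ltW ut) t2).
have finjK : {in K &, injective f}.
  by move=> s t /set_mem [Ks _] /set_mem [Kt _]; apply: finj; exact: mem_set.
have [z [/andP[xz zy] zl nz zr]] := countable_gap Kx Ky xy finjK denK.
have nS : ~ S z by move=> Sz; apply: nz; split => //=; rewrite !ltW.
pose l := (th, stereo th z); have gl : geo l := stereo_geo z c.
have al : accum L (flip l).
  apply: stereo_accum_left => // e e0; have [s [Ss _] h] := zl e e0; by exists s.
have cl_ : cl L l by rewrite -(flipK l); apply: (cl_flip PL); exact: (accum_cl (geo_flip gl) al).
case: (accum_or_adj PL cl_) => [a1|[c0 ic a1]]; first exact: (P_one_sided PL P cl_ nS a1 al).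
have [g ag [eg gk]] := facing_end c ic a1 (or_introl erefl : ends_at th l) Sy (or_introl erefl).
have [r0 [_ _ ur]] := P_root PL P ic.
have lk : 0 < side l (mid (th, stereo th y)) by rewrite (stereo_ch_pos _ c (ch_mid _)).
have Lg : L g.
  apply: contrapT => ng; move: gk; rewrite (ur _ ag ng) -(ur _ a1 nS) leNgt.
  by rewrite lk.
have gg := pl_geo PL Lg.
have [u su] := ends_at_stereo c gg eg.
have Su : S u by apply: (pl_same PL (same_sym su)).
have ngl : ~ same l g by move=> s; apply: nS; exact: (pl_same PL (same_sym s)).
have [_ lp] := adj_facing PL a1 ag ngl (ch_mid g).
have zu : z < u.
  by rewrite -(stereo_ch_pos z c (_ : ch (th, stereo th u) (mid g))) // -(same_ch su); exact: ch_mid.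
have uy : u <= y.
  rewrite leNgt; apply/negP => yu.
  have [_ gp] : left_of g (mid l) by apply: (adj_facing PL ag a1 _ (ch_mid l)) => /same_sym.
  have E1 := stereo_ch_neg u c (ch_mid l); have E2 := stereo_ch_neg u c (ch_mid (th, stereo th y)).
  rewrite zu in E1; rewrite yu in E2.
  by case: su gp gk => ->; rewrite ?side_flip; move: E1 E2; rewrite -/l; lra.
have [v [Sv _] /andP[zv vu]] := zr u (conj Su (introT andP (conj (ltW (lt_trans xz zu)) uy))) zu.
have cv := leaf_cl PL Sv.
have [_ _ h1] := a1; have [_ _ h2] := ag.
have u1 := h1 _ _ cv (ch_mid l); have u2 := h2 _ _ cv (ch_mid g).
have v1 : side (th, stereo th v) (mid l) < 0 by rewrite (stereo_ch_neg _ c (ch_mid _)).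
have v2 : 0 < side (th, stereo th v) (mid g).
  by rewrite (stereo_ch_pos (t := u) _ c) // -(same_ch su); exact: ch_mid.
have v3 : side (th, stereo th v) c0 != 0 by have [_] := ic; apply.
move: u1 u2; rewrite nmulr_lge0// pmulr_lge0// => w1 w2.
by case/negP: v3; rewrite eq_le w1 w2.
Qed.

(** There is a leaf m ending at th with exit flip l: l itself, or else the
    boundary chord facing k of the shell of root l. An open interval through m
    contains the given leaves close to l, which also end at th, against
    [one_end_per_interval]. *)
Lemma no_limit_end th l k : circle th -> cl L l -> ends_at th l -> accum L (flip l) ->
  (forall U, nbhs (flip l) U -> exists2 i, L i /\ ends_at th i & ch i `<=` left_of (flip l) /\ U i) ->
  L k -> ends_at th k -> 0 <= side l (mid k) -> False.
Proof.
move=> c cll el ar lim Lk ek lk.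
have [m [Lm em ex sm]] : exists m, [/\ L m, ends_at th m, exit L m (flip l) & ch m `<=` [set p | 0 <= side l p]].
  have [Ll|nL] := pselect (L l).
    exists (flip l); split; [exact: pl_flip|by case: el; [right|left]| |].
      by split; [exact: (geo_flip (cl_geo cll))|exact: ar|left].
    by move=> p; rewrite ch_flip => /side_ch /= ->.
  case: (accum_or_adj PL cll) => [a1|[c0 ic a1]]; first by case: (P_one_sided PL P cll nL a1 ar).
  have lk' : 0 < side l (mid k).
    rewrite lt_neqAle lk andbT eq_sym; apply: (cl_side_ne PL cll (leaf_cl PL Lk) _ (ch_mid k)).
    by move=> s; apply: nL; exact: (pl_same PL (same_sym s)).
  have [g ag [eg gk]] := facing_end c ic a1 el Lk ek.
  have [r0 [_ _ ur]] := P_root PL P ic.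
  have Lg : L g.
    by apply: contrapT => ng; move: gk; rewrite (ur _ ag ng) -(ur _ a1 nL) leNgt lk'.
  have ngl : ~ same l g by move=> s; apply: nL; exact: (pl_same PL (same_sym s)).
  have nf : ~ L (flip l) by move=> /(pl_flip PL); rewrite flipK.
  have a1' : adj L c0 (flip (flip l)) by rewrite flipK.
  exists g; split => //.
    by split; [exact: (geo_flip (cl_geo cll))|exact: ar|right; exists c0].
  by move=> p hp; have [_ /ltW] := adj_facing PL a1 ag ngl hp.
have [I [oi Im]] := interval_through PL P Lm.
have [i [Li ei] [si Ui]] := lim _ (interval_near PL P Lm ex oi Im).
have := one_end_per_interval c oi Lm Li Im (Ui Li si) em ei => E.
have [_] := si _ (ch_mid i); rewrite side_flip oppr_gt0 ltNge.
by have := sm (mid i); rewrite E => /(_ (ch_mid i)) /= ->.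
Qed.

(** An infinite bounded set of parameters has a limit point, from the left or
    from the right. The chord of that parameter is excluded by [no_limit_end],
    with k the leaf of parameter b or a. *)
Lemma ends_discrete th a b : circle th -> L (th, stereo th a) -> L (th, stereo th b) ->
  finite_set ([set s | L (th, stereo th s)] `&` `[a, b]).
Proof.
move=> c La Lb; apply: contrapT => inf.
have bd : bounded_set ([set s | L (th, stereo th s)] `&` `[a, b]).
  exists (`|a| + `|b|); split; first exact: num_real.
  move=> M hM s [_] /=; rewrite in_itv /= => /andP[s1 s2]; apply: (le_trans _ (ltW hM)).
  have := ler_norm (- a); have := ler_norm b; have := normr_ge0 a; have := normr_ge0 b.
  by rewrite normrN ler_norml => *; apply/andP; split; lra.
have [x lx] := infinite_bounded_limit_point_nonempty inf bd.
pose l := (th, stereo th x); have gl : geo l := stereo_geo x c.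
have fl (e : R) : 0 < e -> exists s, [/\ s != x, L (th, stereo th s), a <= s <= b & `|s - x| < e].
  move=> e0; have [|y [yx [Ly]]] := lx (ball x e); first exact: nbhsx_ballx.
  rewrite /= in_itv /= => aby; rewrite -ball_normE /ball_ /= distrC => h.
  by exists y.
have [xa xb] : a <= x /\ x <= b.
  split; rewrite leNgt; apply/negP => h.
    have [|s [_ _ /andP[s1 s2]]] := fl (a - x); first by rewrite subr_gt0.
    by rewrite ltr_norml => /andP[_]; lra.
  have [|s [_ _ /andP[s1 s2]]] := fl (x - b); first by rewrite subr_gt0.
  by rewrite ltr_norml => /andP[h1 _]; lra.
have [left_|nleft] := pselect (forall e : R, 0 < e -> exists2 s, L (th, stereo th s) & x - e < s < x).
  have ar := stereo_accum_left c left_.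
  have cll : cl L l by rewrite -(flipK l); apply: (cl_flip PL); exact: (accum_cl (geo_flip gl) ar).
  apply: (no_limit_end c cll (or_introl erefl) ar _ Lb (or_introl erefl)); last first.
    by rewrite leNgt (stereo_ch_neg _ c (ch_mid _)) -leNgt.
  move=> U /(@flip_cont R l) /stereo_near [e [e0 he]].
  have [s Ls /andP[s1 s2]] := left_ e e0.
  exists (flip (th, stereo th s)); first by split; [exact: pl_flip|right].
  split; last by apply: he; rewrite ltr_norml; apply/andP; split; lra.
  move=> p; rewrite ch_flip => hp; split; first exact: (ch_disc (pl_geo PL Ls) hp).
  by rewrite side_flip oppr_gt0 (stereo_ch_neg _ c hp).
have right_ (e : R) : 0 < e -> exists2 s, L (th, stereo th s) & x < s < x + e.
  move=> e0; move/existsNP: nleft => [e' /not_implyP [e'0 h]].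
  have [|s [sx Ls sab]] := fl (Num.min e e'); first by rewrite lt_min e0.
  rewrite lt_min !ltr_norml => /andP[/andP[u1 u2] /andP[v1 v2]]; exists s => //.
  case/orP: (lt_total sx) => o; last by rewrite o /=; lra.
  by exfalso; apply: h; exists s => //; rewrite o andbT; lra.
have ar := stereo_accum_right c right_.
have cll : cl L l := accum_cl gl ar.
apply: (no_limit_end (l := flip l) c (cl_flip PL cll) (or_intror erefl) _ _ La (or_introl erefl)).
- by rewrite flipK.
- rewrite flipK => U /stereo_near [e [e0 he]].
  have [s Ls /andP[s1 s2]] := right_ e e0.
  exists (th, stereo th s); first by split; [|left].
  split; last by apply: he; rewrite ltr_norml; apply/andP; split; lra.
  move=> p hp; split; first exact: (ch_disc (pl_geo PL Ls) hp).
  by rewrite (stereo_ch_pos _ c hp).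
- by rewrite side_flip oppr_ge0 leNgt (stereo_ch_pos _ c (ch_mid _)) -leNgt.
Qed.

End P.
End Fixed.
End Stereo.

(** * Few common ends *)

Section IntEmb.
Variable R : realType.
Variable S : set R.
Hypothesis fin : forall a b, S a -> S b -> finite_set (S `&` `[a, b]).

Let seg_ (a b : R) : set R := S `&` [set s | a <= s < b].
(* The rank function to the integers is s |-> cnt s0 s, continued by - cnt s s0
   below a base point s0. *)
Let cnt (a b : R) : nat := #|` fset_set (seg_ a b)|.

Lemma fin_seg a b : S a -> S b -> finite_set (seg_ a b).
Proof.
move=> Sa Sb; apply: sub_finite_set (fin Sa Sb) => s [Ss /= /andP[h1 h2]].
by split => //=; rewrite in_itv /= h1 ltW.
Qed.

Lemma cnt_add a b c : S a -> S b -> S c -> a <= b -> b <= c ->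
  cnt a c = (cnt a b + cnt b c)%N.
Proof.
move=> Sa Sb Sc ab bc; rewrite /cnt.
have -> : seg_ a c = seg_ a b `|` seg_ b c.
  apply/seteqP; split=> s.
    move=> [Ss /= /andP[h1 h2]]; case: (ltrP s b) => h; [left|right]; split => //=.
      by rewrite h1.
    by rewrite h.
  by move=> [[Ss /= /andP[h1 h2]]|[Ss /= /andP[h1 h2]]]; split => //=;
    apply/andP; split => //; [apply: (lt_le_trans h2)|apply: (le_trans ab)].
have [f1 f2] := (fin_seg Sa Sb, fin_seg Sb Sc).
rewrite fset_setU// cardfsU -fset_setI//.
have -> : seg_ a b `&` seg_ b c = set0.
  apply/seteqP; split => // s [[_ /= /andP[_ h1]] [_ /= /andP[h2 _]]].
  by have := lt_le_trans h1 h2; rewrite ltxx.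
by rewrite fset_set0 cardfs0 subn0.
Qed.

Lemma cnt_refl a : cnt a a = 0%N.
Proof.
rewrite /cnt (_ : seg_ a a = set0) ?fset_set0 ?cardfs0//.
by apply/seteqP; split => // s [_ /= /andP[h1 h2]]; have := le_lt_trans h1 h2; rewrite ltxx.
Qed.

Lemma cnt_gt0 a b : S a -> S b -> a < b -> (0 < cnt a b)%N.
Proof.
move=> Sa Sb ab; rewrite cardfs_gt0; apply/fset0Pn; exists a.
by rewrite in_fset_set; [apply: mem_set; split => //=; rewrite lexx|exact: fin_seg].
Qed.

Lemma cnt_step a b : S a -> S b -> a < b -> exists t, [/\ S t, a < t, t <= b & cnt a t = 1%N].
Proof.
move=> Sa Sb ab.
pose Q (n : nat) := `[< exists t, [/\ S t, a < t, t <= b & cnt a t = n] >].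
have exQ : exists n, Q n by exists (cnt a b); apply/asboolP; exists b.
have [n /asboolP [t [St at_ tb tn]] nmin] := ex_minnP exQ.
exists t; split => //.
have sE : seg_ a t = [set a].
  apply/seteqP; split=> s; last by move=> ->; split => //=; rewrite lexx.
  move=> [Ss /= /andP[]]; rewrite le_eqVlt => /predU1P[->//|as_] st.
  have : (n <= cnt a s)%N.
    by apply: nmin; apply/asboolP; exists s; split => //; exact: (le_trans (ltW st) tb).
  have := cnt_add Sa Ss St (ltW as_) (ltW st); have := cnt_gt0 Ss St st; rewrite tn.
  lia.
by rewrite /cnt sE fset_set1 cardfs1.
Qed.

Lemma cnt_ivt a b (k : nat) : S a -> S b -> a <= b -> (k <= cnt a b)%N ->
  exists s, [/\ S s, a <= s <= b & cnt a s = k].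
Proof.
move=> Sa Sb ab; elim: k => [_|k IH hk].
  by exists a; rewrite lexx ab cnt_refl.
have [s [Ss /andP[h1 h2] hs]] := IH (ltnW hk).
have sb : s < b.
  by rewrite lt_neqAle h2 andbT; apply/eqP => e; move: hk; rewrite -e hs ltnn.
have [t [St st tb h]] := cnt_step Ss Sb sb.
exists t; split => //; first by rewrite tb andbT (le_trans h1)// ltW.
by rewrite (cnt_add Sa Ss St h1 (ltW st)) hs h addn1.
Qed.

Lemma int_embedding : exists (J : set int) (f : R -> int),
  [/\ is_interval J, set_bij S J f & forall s t, S s -> S t -> (s < t <-> f s < f t)].
Proof.
have [[s0 S0]|e] := pselect (S !=set0); last first.
  exists set0, (fun=> 0); split.
  - by move=> x y [].
  - split; [by move=> s Ss; case: e; exists s|by move=> s t /set_mem Ss; case: e; exists s|by []].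
  - by move=> s t Ss; exfalso; apply: e; exists s.
pose f (s : R) : int := if s0 <= s then (cnt s0 s)%:Z else - (cnt s s0)%:Z.
have fD s t : S s -> S t -> s <= t -> f t = f s + (cnt s t)%:Z.
  move=> Ss St st; rewrite /f; case: (lerP s0 s) => h1.
    by rewrite (le_trans h1 st) (cnt_add S0 Ss St h1 st) PoszD.
  case: (lerP s0 t) => h2.
    by rewrite (cnt_add Ss S0 St (ltW h1) h2) PoszD addKr.
  by rewrite (cnt_add Ss St S0 st (ltW h2)) PoszD; lia.
have fmono s t : S s -> S t -> s < t -> f s < f t.
  by move=> Ss St st; rewrite (fD s t Ss St (ltW st)) ltrDl ltz_nat cnt_gt0.
exists (f @` S), f; split.
- move=> _ _ [a Sa <-] [b Sb <-] z /andP[h1 h2].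
  have ab : a <= b.
    rewrite leNgt; apply/negP => ba; have := fmono b a Sb Sa ba; rewrite ltNge => /negP; apply.
    exact: (le_trans h1 h2).
  have E := fD a b Sa Sb ab.
  have [s [Ss /andP[as_ sb] hs]] : exists s, [/\ S s, a <= s <= b & cnt a s = `|z - f a|%N].
    by apply: cnt_ivt => //; lia.
  by exists s => //; rewrite (fD a s Sa Ss as_) hs; lia.
- split; [by move=> s Ss; exists s| |by []].
  move=> s t /set_mem Ss /set_mem St e; case: (ltgtP s t) => // h.
    by have := fmono _ _ Ss St h; rewrite e ltxx.
  by have := fmono _ _ St Ss h; rewrite e ltxx.
- move=> s t Ss St; split; first exact: fmono.
  case: (ltgtP s t) => // [h|->]; last by rewrite ltxx.
  by move=> h'; have := lt_trans (fmono _ _ St Ss h) h'; rewrite ltxx.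
Qed.
End IntEmb.

Section Order.
Variable R : realType.
Notation pl := (plane R).
Implicit Types (th y z : pl).

(** The parameter of the point at angle a + 2 x from th is the opposite of the
    cotangent of x, which increases from -oo to +oo on ]0, pi[. This relates the
    order by parameters to the order of [arc_lt]. *)
Lemma stereo_angle (a x : R) : sin x != 0 ->
  stereo (circle_pt a) (- (cos x / sin x)) = circle_pt (a + (x + x)).
Proof.
move=> sn; have cs := cos2Dsin2 x.
have d : (- (cos x / sin x)) ^+ 2 + 1 = (sin x ^+ 2)^-1.
  transitivity ((cos x ^+ 2 + sin x ^+ 2) / sin x ^+ 2); first by field.
  by rewrite cs mul1r.
have d' : (- (cos x / sin x)) ^+ 2 - 1 = (cos x ^+ 2 - sin x ^+ 2) / sin x ^+ 2 by field.
rewrite /stereo d d' /circle_pt /= cosD sinD !cosD !sinD invrK.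
by congr (_, _); rewrite ?cosD; field.
Qed.

Lemma angle_of th : circle th -> exists a : R, th = circle_pt a.
Proof.
move=> /circ_n2; rewrite /n2 => e.
have b : -1 <= th.1 <= 1.
  by rewrite -ler_norml -(@ler_pXn2r _ 2)// ?nnegrE// expr1n real_normK ?num_real//; have := sqr_ge0 th.2; lra.
have c : cos (acos th.1) = th.1 by apply: acosK; rewrite in_itv.
have s : sin (acos th.1) = `|th.2|.
  by rewrite sin_acos// -sqrtr_sqr; congr Num.sqrt; lra.
case: (lerP 0 th.2) => h.
  by exists (acos th.1); apply: plane_eq; rewrite /circle_pt /= ?c ?s ?ger0_norm.
exists (- acos th.1); apply: plane_eq; rewrite /circle_pt /=.
  by rewrite cosN c.
by rewrite sinN s ltr0_norm// opprK.
Qed.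

Lemma half_angle (s : R) : exists x : R, [/\ 0 < x, x < pi, 0 < sin x & s = - (cos x / sin x)].
Proof.
exists (atan s + pi / 2); have h1 := atan_gtNpi2 s; have h2 := atan_ltpi2 s.
have x0 : 0 < atan s + pi / 2 by lra.
have x1 : atan s + pi / 2 < pi by rewrite [ltRHS](splitr pi) ltrD2r.
have sp_ : 0 < sin (atan s + pi / 2) by apply: sin_gt0_pi; rewrite x0.
split => //; rewrite cosDpihalf sinDpihalf mulNr opprK.
by have := atanK s; rewrite /tan => ->.
Qed.

Lemma cot_lt (x y : R) : 0 < x -> x < y -> y < pi -> - (cos x / sin x) < - (cos y / sin y).
Proof.
move=> x0 xy y1.
have sx : 0 < sin x by apply: sin_gt0_pi; rewrite x0 (lt_trans xy).
have sy : 0 < sin y by apply: sin_gt0_pi; rewrite y1 (lt_trans x0).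
have : 0 < sin (y - x) by apply: sin_gt0_pi; apply/andP; split; lra.
rewrite sinB => h; rewrite ltrN2 ltr_pdivrMr// mulrAC ltr_pdivlMr//; lra.
Qed.

Lemma arc_ltP th (s t : R) : circle th -> arc_lt th (stereo th s) (stereo th t) <-> s < t.
Proof.
move=> c; have [b thE] := angle_of c; split.
  move=> [a [u [v [[u0 uv v1] [e1 e2 e3]]]]].
  have P2 : pi *+ 2 = pi + pi :> R by rewrite mulr2n.
  have su : 0 < sin (u / 2) by apply: sin_gt0_pi; apply/andP; split; lra.
  have sv : 0 < sin (v / 2) by apply: sin_gt0_pi; apply/andP; split; lra.
  have E1 := stereo_angle a (lt0r_neq0 su); have E2 := stereo_angle a (lt0r_neq0 sv).
  rewrite -splitr -e1 -e2 in E1; rewrite -splitr -e1 -e3 in E2.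
  rewrite -(stereo_inj c E1) -(stereo_inj c E2); apply: cot_lt; lra.
move=> st; have [x [x0 x1 sx sE]] := half_angle s; have [y [y0 y1 sy tE]] := half_angle t.
have xy : x < y.
  case: (ltgtP x y) => // [h|h]; last by move: st; rewrite sE tE h ltxx.
  by have := cot_lt y0 h x1; rewrite -sE -tE => h'; have := lt_trans st h'; rewrite ltxx.
exists b, (x + x), (y + y); split; first by rewrite mulr2n; split; lra.
split => //; rewrite thE ?sE ?tE stereo_angle ?gt_eqF//.
Qed.

Lemma few_common_ends_of (L : set (pl * pl)) : pre_lamination L ->
  (forall th a b, circle th -> L (th, stereo th a) -> L (th, stereo th b) ->
    finite_set ([set s | L (th, stereo th s)] `&` `[a, b])) -> few_common_ends L.
Proof.
move=> PL fin th c.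
have [J [f [iJ bf of_]]] := int_embedding (fun a b => fin th a b c).
have exs z : common_ends L th z -> exists2 s, L (th, stereo th s) & z = stereo th s.
  move=> [zn Lz]; have [_ c2 _] := pl_geo PL Lz; have [s E] := stereo_surj c c2 zn.
  by exists s => //; rewrite -E.
pose sg z := xget 0 [set s | z = stereo th s].
have sgE s : sg (stereo th s) = s.
  have : [set u | stereo th s = stereo th u] (sg (stereo th s)) by apply: (xgetI (P := [set u | stereo th s = stereo th u]) 0 (x := s)).
  by move=> /(stereo_inj c).
have [b1 b2 b3] := bf.
exists J, (f \o sg); split => //.
- split.
  + by move=> z /exs [s Ls ->] /=; rewrite sgE; exact: b1.
  + move=> y z /set_mem /exs [s Ls ->] /set_mem /exs [t Lt ->] /=; rewrite !sgE => e.
    by congr stereo; apply: b2 => //; exact: mem_set.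
  + move=> j /b3 [s Ls <-]; exists (stereo th s); last by rewrite /= sgE.
    by split => //; exact: stereo_neq.
- move=> y z /exs [s Ls ->] /exs [t Lt ->] /=; rewrite !sgE.
  by rewrite (propext (arc_ltP s t c)); exact: of_.
Qed.
End Order.

(** * From L2 to L1: accumulation, roots and shells *)

Section Forward.
Variable R : realType.
Notation pl := (plane R).
Implicit Types (p q w z c x : plane R) (l m k g h i j r : plane R * plane R).
Variables L1 L2 : set (pl * pl).
Hypothesis PL1 : pre_lamination L1.
Hypothesis P2 : P_pre_lamination L2.
Hypothesis L12 : L1 `<=` L2.
Hypothesis dn : dense (leaf_image L1 L2).

Let PL2 : pre_lamination L2. Proof. by case: P2. Qed.

Lemma cl_sub l : cl L1 l -> cl L2 l.
Proof. by move=> [gl cl_]; split => //; exact: (closureS L12 cl_). Qed.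

Lemma leaf_between I m l : open_interval L2 I -> L2 m -> L2 l -> I (ch m) -> I (ch l) ->
  ch m <> ch l -> exists i, L1 i /\ cuts i m l.
Proof.
move=> oi Lm Ll Im Il ne.
have [i [Li [_ [h [Lh E s]]]]] := dense_interval dn (sub_interval PL2 oi Lm Ll Im Il ne).
exists i; split => //; apply: (same_cuts _ s).
by apply: ch_inj => //; [exact: (pl_geo PL1)|exact: (pl_geo PL2)].
Qed.

(** Let m be a leaf with exit r and I an open interval through m. Leaves of L2
    close to r and beyond it are in I; between m and each of them there is a
    leaf of L1, which is beyond r and meets the short segment joining their
    midpoints. *)
Lemma accum_transfer r : geo r -> accum L2 r -> accum L1 r.
Proof.
move=> gr ar; have cr := accum_cl gr ar.
have [m [Lm ex]] := entry_ex PL2 P2 gr ar.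
have [I [oi Im]] := interval_through PL2 P2 Lm.
have hr := ch_mid r; have ir := ch_disc gr hr.
have lim : closure (carrier (beyond L1 r)) (mid r).
  move=> U /nbhs_ballP [e /= e0 he].
  have nb : \forall l \near r, ball (mid r) e (mid l).
    have c : continuous (fun l : pl * pl => mid l).
      by apply: seg_cont; [exact: cfst|exact: csnd|exact: cont_c].
    by apply: c; apply: nbhsx_ballx.
  have [l [[Ll sl] [bl Il]]] := ar _ (filterI nb (interval_near PL2 P2 Lm ex oi Im)).
  have {}Il := Il Ll sl.
  have ne : ch m <> ch l.
    move=> E; have [_] := exit_left_of PL2 Lm ex (sl _ (ch_mid l)).
    by rewrite (side_ch (l := m)) ?ltxx// E; exact: ch_mid.
  have [i [Li si]] := leaf_between oi Lm Ll Im Il ne.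
  have cl_ := leaf_cl PL2 Ll; have Li2 := L12 Li; have ci := leaf_cl PL2 Li2.
  have sr := exit_cuts PL2 Lm ex Li2 cl_ si.
  have ir' := cuts_beyond PL2 ci cr cl_ sl sr.
  have hl := ch_mid l.
  have [t /andP[t0 t1] zt] := affine_zero (cuts_side sr hr hl).
  exists (seg (mid r) (mid l) t); split.
    exists i; first by split.
    apply: disc_ch => //; first exact: (pl_geo PL1).
    by apply: disc_seg => //; [exact: (ch_disc (cl_geo cl_) hl)|rewrite !ltW].
  apply: he; rewrite -ball_normE /ball_ /= distrC; apply: seg_norm.
  - by rewrite !ltW.
  - by rewrite subrr normr0.
  - by move: bl; rewrite -ball_normE /ball_ /= distrC.
have [|m' [cm gm hm]] := carrier_limit _ ir lim.
  by move=> k [/(pl_geo PL1) []].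
have cm' : cl L2 m' by split => //; apply: closureS cm => k [/L12].
case: (cl_meet PL2 cr cm' hr hm) => E; first by rewrite E in cm.
have pf k : beyond L1 r k -> beyond L1 r (flip k).
  by move=> [Lk sk]; split; [exact: (pl_flip PL1)|rewrite ch_flip].
by have := closure_flip pf cm; rewrite E flipK.
Qed.

Lemma nonleaf_cl l : cl L2 l -> ~ L2 l -> cl L1 l.
Proof.
move=> cl_ nl; have gl := cl_geo cl_.
case: (cl_accum PL2 cl_) => // a.
  by apply: accum_cl => //; exact: accum_transfer.
rewrite -(flipK l); apply: (cl_flip PL1); apply: accum_cl; first exact: geo_flip.
by apply: accum_transfer => //; exact: geo_flip.
Qed.

(** If c is not interior for L2, it lies on a limit chord m of L2. Leaves of L2
    do not accumulate on m, for leaves of L1 would; so m borders a shell of L2,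
    which is in the region of c. *)
Lemma inner_shell c : inner L1 c -> exists c', inner L2 c' /\ region L1 c c'.
Proof.
move=> ic; have [i2|n2] := pselect (inner L2 c).
  by exists c; split => //; exact: inner_region.
have [m [cm hm]] : exists m, cl L2 m /\ ch m c.
  apply: contrapT => h; apply: n2; split; first by case: ic.
  move=> m cm; apply/eqP => z; apply: h; exists m; split => //.
  by apply: disc_ch => //; [exact: (cl_geo cm)|case: ic].
case: (accum_or_adj PL2 cm) => [a|[c' ic' a']].
  have a1 := accum_transfer (cl_geo cm) a; have := ic.2 m (accum_cl (cl_geo cm) a1).
  by rewrite (side_ch hm) eqxx.
exists c'; split => //; split; first by case: ic'.
move=> l Ll; have cl1 := leaf_cl PL1 Ll; have cl2 := cl_sub cl1.
have [_ _ h] := a'; have := h l _ cl2 hm; rewrite mulrC => ge.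
by rewrite lt_neqAle ge andbT eq_sym mulf_neq0//; [exact: (ic.2 l cl1)|exact: (ic'.2 l cl2)].
Qed.

Lemma inner_sub c : inner L2 c -> inner L1 c.
Proof. by move=> [i h]; split => // m /cl_sub; exact: h. Qed.

Lemma adj_sub c r : inner L1 c -> adj L2 c r -> cl L1 r -> adj L1 c r.
Proof. by move=> ic [_ rc h] cr; split => // m p /cl_sub; exact: h. Qed.

Lemma sub_nonleaf_boundary A : complementary_region L1 A ->
  exists B, boundary_component A B /\ ~ leaves L1 B.
Proof.
move=> /(regionP PL1) [p [ip op ->]].
have [[q [hq iq]]|no] := pselect (exists q, region L1 p q /\ inner L1 q); last first.
  have [|l [cl_ nl E]] := thin_region PL1 ip op.
    by move=> q hq iq; apply: no; exists q.
  have gl := cl_geo cl_; exists (ch l); split; last by move/(leaf_ch PL1 gl).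
  rewrite E; apply/(thin_bc _ gl) => //; rewrite -E interior_region//.
  by apply/seteqP; split => // q [h1 h2]; apply: no; exists q.
rewrite -(region_eq hq).
have [c [ic hc]] := inner_shell iq; rewrite -(region_eq hc).
have [r [ar nr _]] := P_root PL2 P2 ic.
have ic1 := inner_sub ic; have cr := nonleaf_cl (adj_cl ar) nr.
exists (ch r); split; last by move/(leaf_ch PL1 (cl_geo cr)) => /L12.
by apply/(bcP PL1 _ ic1); exists r; split => //; exact: adj_sub.
Qed.

(** Leaves of L2 do not accumulate on a on the side of c0, as those of L1 do
    not; so a borders a shell there. Its boundary chord k facing b is a leaf: if
    it were not, leaves of L1 would accumulate on k from the side of b and
    separate c from b. *)
Lemma sub_shell c0 a b : inner L1 c0 -> adj L1 c0 a -> adj L1 c0 b -> L1 a -> L1 b -> ~ same a b ->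
  exists c k, [/\ inner L2 c, adj L2 c a, adj L2 c k, ~ same a k & L2 k] /\
    region L2 c `<=` region L1 c0 /\ (same k b \/ cuts k a b).
Proof.
move=> ic0 aa ab La Lb ns.
have [La2 Lb2] := (L12 La, L12 Lb).
have [ca cb] := (leaf_cl PL2 La2, leaf_cl PL2 Lb2).
case: (accum_or_adj PL2 ca) => [accum_a|[c ic ac]].
  by case: (accum_not_adj PL1 (accum_transfer (cl_geo ca) accum_a) aa).
have hc : region L1 c0 c.
  split; first by case: ic.
  move=> m Lm; have cm1 := leaf_cl PL1 Lm; have cm2 := cl_sub cm1.
  have [s|nsm] := pselect (same a m).
    have := adj_pos aa; have := adj_pos ac.
    by case: s => ->; rewrite ?side_flip ?mulrNN => *; exact: mulr_gt0.
  have pa := ch_mid a; have [_ _ h1] := aa; have [_ _ h2] := ac.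
  have n := cl_side_ne PL2 cm2 ca (fun s => nsm (same_sym s)) pa.
  have u1 : 0 < side m c0 * side m (mid a).
    by rewrite lt_neqAle h1// andbT eq_sym mulf_neq0//; exact: (ic0.2 m cm1).
  have u2 : 0 < side m (mid a) * side m c.
    by rewrite mulrC lt_neqAle h2// andbT eq_sym mulf_neq0//; exact: (ic.2 m cm2).
  exact: pos_trans u1 u2.
have pb := ch_mid b; have [_ bpos] := adj_facing PL1 aa ab ns pb.
have [k [ak kz]] := facing_leaf PL2 ic cb.
have ck := adj_cl ak.
have nsk : ~ same a k by move=> /(adj_same ac ak) e; rewrite e ltNge kz in bpos.
have neg : same k b \/ side k (mid b) < 0.
  have [s|nskb] := pselect (same k b); first by left.
  by right; rewrite lt_neqAle kz andbT; exact: (cl_side_ne PL2 ck cb nskb pb).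
exists c, k; split; first split => //.
  apply: contrapT => nk; have n : 0 < side (flip k) (mid b).
    by rewrite side_flip oppr_gt0; case: neg => // s; case: nk; apply: (pl_same PL2 (same_sym s)).
  have gk := geo_flip (cl_geo ck).
  case: (cl_accum PL2 ck) => // ak'; first exact: (accum_not_adj PL2 ak' ak).
  have [i [Li _ _ i1 i2]] := accum_near PL1 gk (accum_transfer gk ak') n filterT.
  have ci1 := leaf_cl PL1 Li; have ci2 := cl_sub ci1.
  have w : side i (mid k) < 0 by apply: i2; rewrite ch_flip; exact: ch_mid.
  have [_ _ h] := ak; have := h i _ ci2 (ch_mid k); rewrite nmulr_lge0// => ic_le.
  have ic_lt : side i c < 0 by rewrite lt_neqAle ic_le andbT; exact: (ic.2 i ci2).
  have [_ _ h'] := ab; have := h' i _ ci1 pb; rewrite pmulr_lge0// => ge.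
  by have [_ /(_ i Li)] := hc; rewrite nmulr_lgt0// ltNge ge.
split; first by rewrite -(region_eq hc) => q [iq hq]; split => // m /L12; exact: hq.
case: neg => n; [by left|right].
apply: (spcI PL2 ck ca cb (ch_mid a) pb).
have [_ pos] : left_of k (mid a) by apply: (adj_facing PL2 ak ac _ (ch_mid a)) => /same_sym.
by rewrite pmulr_rlt0.
Qed.

(** Replace each region of the sequence by the shell of [sub_shell]. One long
    boundary component is kept, and the other is replaced by a chord between the
    two. *)
Lemma sub_no_bad D : ~ bad_accumulation L1 D.
Proof.
move=> [hD [_ [[gx [gy [g1 g2 gne ->]]] hcD [a [b [[nab hca hcb _] nl]]]]]].
pose g := (gx, gy); have gg : geo g by [].
have [N _ hN] := filterI nab nl.
have ex n : exists x : pl * ((pl * pl) * ((pl * pl) * (pl * pl))),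
   [/\ inner L2 x.1, adj L2 x.1 x.2.1, adj L2 x.1 x.2.2.1 & ~ same x.2.1 x.2.2.1] /\
   [/\ L2 x.2.1, L2 x.2.2.1, geo x.2.2.2 & same x.2.2.1 x.2.2.2 \/ cuts x.2.2.1 x.2.1 x.2.2.2] /\
   [/\ region L2 x.1 `<=` D (n + N)%N, a (n + N)%N = ch x.2.1 & b (n + N)%N = ch x.2.2.2].
  have [[ba bb ne] [la lb]] := hN _ (leq_addl n N).
  have [/(regionP PL1) [p [ip op DE]] [c0]] := hD (n + N)%N.
  rewrite DE interior_region// => -[hc ic].
  rewrite DE -(region_eq hc) in ba bb *.
  have /(bcP PL1 _ ic) [al [aal aE]] := ba; have /(bcP PL1 _ ic) [be [abe bE]] := bb.
  have Lal : L1 al by apply/(leaf_ch PL1 (cl_geo (adj_cl aal))); rewrite -aE.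
  have Lbe : L1 be by apply/(leaf_ch PL1 (cl_geo (adj_cl abe))); rewrite -bE.
  have ns : ~ same al be by move=> /same_ch e; apply: ne; rewrite aE bE e.
  have [c [k [[ic2 a1 a2 ns2 Lk] [sub alt]]]] := sub_shell ic aal abe Lal Lbe ns.
  by exists (c, (al, (k, be))); split => //; split => //; split => //=; [exact: L12|exact: (pl_geo PL1)].
have [x hx] := choice ex.
have sh (A : nat -> set pl) B (e : R) : 0 < e -> hausdorff_cvg A B -> \forall n \near \oo, hnear (A (n + N)%N) B e.
  move=> e0 /hcvgP /(_ _ e0) [M _ hM]; exists M => // n /= Mn; apply: hM => /=.
  exact: leq_trans Mn (leq_addr _ _).
have bdcl n l : adj L2 (x n).1 l -> ch l `<=` closure (region L2 (x n).1).
  have [[ic _ _ _] _] := hx n => al; rewrite closure_region//; exact: adj_closed_region.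
have hreg : hausdorff_cvg (fun n => region L2 (x n).1) (ch g).
  apply/hcvgP => e e0; apply: filterS (filterI (sh D _ e e0 hcD) (sh a _ e e0 hca)) => n [[d1 d2] [a1 a2]].
  have [[ic aa ak ns] [_ [rD aE bE]]] := hx n; split.
    by move=> p /(closureS rD); exact: d1.
  move=> q /a2 [p [hp hpq]]; exists p; split => //.
  by move: hp; rewrite aE; apply: clos_min; [exact: closed_closure|exact: bdcl].
have hca' : hausdorff_cvg (fun n => ch (x n).2.1) (ch g).
  apply/hcvgP => e e0; apply: filterS (sh a _ e e0 hca) => n.
  by have [_ [_ [_ aE bE]]] := hx n; rewrite aE.
have hck : hausdorff_cvg (fun n => ch (x n).2.2.1) (ch g).
  apply/hcvgP => e e0; have e2 : 0 < e / 2 by rewrite divr_gt0.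
  apply: filterS (filterI ((hcvgP _ _).1 hreg _ e0) (filterI (sh a _ _ e2 hca) (sh b _ _ e2 hcb))) => n.
  move=> [[r1 _] [[_ a2] [_ b2]]].
  have [[ic aa ak ns] [[La Lk gb alt] [rD aE bE]]] := hx n; split.
    move=> p hp; apply: r1; move: hp; apply: clos_min; [exact: closed_closure|exact: bdcl].
  move=> q hq; have [p1 [hp1 d1]] := a2 q hq; have [p2 [hp2 d2]] := b2 q hq.
  rewrite aE in hp1; rewrite bE in hp2.
  case: alt => [s|s].
    exists p2; rewrite -(same_ch s); split => //; lra.
  have near_pt (l : pl * pl) p : closure (ch l) p -> `|p - q| < e / 2 -> exists2 p', ch l p' & `|p' - q| < e.
    move=> hp d; have [p' [h1 h2]] := hp _ (nbhsx_ballx p (e / 2) e2).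
    exists p' => //; apply: le_lt_trans (ler_distD p _ _) _.
    move: h2; rewrite -ball_normE /ball_ /= distrC; lra.
  have [p1' h1 e1] := near_pt _ _ hp1 d1; have [p2' h2 e2'] := near_pt _ _ hp2 d2.
  have [t /andP[t0 t1] zt] := affine_zero (cuts_side s h1 h2).
  exists (seg p1' p2' t); split; last by apply: seg_norm => //; rewrite !ltW.
  apply: subset_closure; apply: disc_ch => //; first exact: (pl_geo PL2).
  apply: disc_seg; [exact: (ch_disc (pl_geo PL2 La) h1)|exact: (ch_disc gb h2)|by rewrite !ltW].
have [_ _ _ _ nobad] := P2; apply: (nobad (fun n => region L2 (x n).1)); split.
  move=> n; have [[ic _ _ _] _] := hx n; split; first exact: inner_complementary.
  exists (x n).1; rewrite interior_open_region//; split; first by case: ic.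
  by move=> m cm; apply: (inner_sq ic cm).
exists (ch g); split => //; first by exists gx, gy.
exists (fun n => ch (x n).2.1), (fun n => ch (x n).2.2.1); split; last first.
  apply: nearW => n; have [_ [[La Lk _ _] _]] := hx n.
  by split; apply/leafE; [exists (x n).2.1|exists (x n).2.2.1].
apply: (long_boundaryI PL2 (c := fun n => (x n).1) (a := fun n => (x n).2.1) (b := fun n => (x n).2.2.1)) => //.
by apply: nearW => n; have [h _] := hx n.
Qed.

End Forward.

(** * From L2 to L1: density of the endpoints *)

Section Cap.
Variable R : realType.
Notation pl := (plane R).
Implicit Types (p q w z c x : plane R) (l m k g h i j r : plane R * plane R).

Lemma noncross_sym l m : geo l -> geo m -> noncross l m -> noncross m l.
Proof.
move=> gl gm h; rewrite /noncross leNgt; apply/negP => neg.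
have [t /andP[t0 t1] z] := affine_zero neg.
have hw : ch l (seg l.1 l.2 t) by apply/chP; exists t => //; rewrite t0 t1.
have hm : ch m (seg l.1 l.2 t) by apply: disc_ch => //; exact: (ch_disc gl hw).
case: (noncross_sides gl gm h) => s.
- by move: neg; rewrite (same_sd0 s (side_1 l)) mul0r ltxx.
- by have [_] := s _ hm; rewrite (side_ch hw) ltxx.
- by have [_] := s _ hm; rewrite side_flip (side_ch hw) oppr0 ltxx.
Qed.

Lemma cross_sym l m : geo l -> geo m -> side l m.1 * side l m.2 < 0 -> side m l.1 * side m l.2 < 0.
Proof.
move=> gl gm h; rewrite ltNge; apply/negP => h'.
by have := noncross_sym gm gl h'; rewrite /noncross leNgt h.
Qed.

(** The chord perpendicular to the radius through x at distance a from the
    origin, with 1 - a = e^2 / 4: the squared distance from x of a point of the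
    circle beyond it is at most e^2 / 2. *)
Lemma cap x (U : set pl) : circle x -> nbhs x U -> exists k,
  [/\ geo k, 0 < side k x & forall z, circle z -> 0 <= side k z -> U z].
Proof.
move=> /circ_n2; rewrite /n2 => cx /nbhs_ballP [e0 /= e00 he0].
pose e := Num.min e0 1.
have e_gt0 : 0 < e by rewrite lt_min e00 ltr01.
have e1 : e <= 1 by rewrite ge_min lexx orbT.
have ee0 : e <= e0 by rewrite ge_min lexx.
have eq1 : e ^+ 2 <= 1 by rewrite expr_le1// ltW.
have eq0 : 0 < e ^+ 2 by rewrite exprn_gt0.
pose a := 1 - e ^+ 2 / 4.
have a1 : 0 < 1 - a ^+ 2.
  rewrite /a; have -> : 1 - (1 - e ^+ 2 / 4) ^+ 2 = e ^+ 2 / 4 * (2 - e ^+ 2 / 4) by field.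
  by rewrite mulr_gt0//; lra.
pose b := Num.sqrt (1 - a ^+ 2).
have b0 : 0 < b by rewrite sqrtr_gt0.
have bb : b ^+ 2 = 1 - a ^+ 2 by rewrite sqr_sqrtr// ltW.
pose k : pl * pl := ((a * x.1 - b * x.2, a * x.2 + b * x.1), (a * x.1 + b * x.2, a * x.2 - b * x.1)).
have c1 : circle k.1.
  apply/circ_n2; rewrite /n2 /=.
  transitivity ((a ^+ 2 + b ^+ 2) * (x.1 ^+ 2 + x.2 ^+ 2)); first by ring.
  by rewrite cx bb; ring.
have c2 : circle k.2.
  apply/circ_n2; rewrite /n2 /=.
  transitivity ((a ^+ 2 + b ^+ 2) * (x.1 ^+ 2 + x.2 ^+ 2)); first by ring.
  by rewrite cx bb; ring.
have kE z : side k z = 2 * b * (x.1 * z.1 + x.2 * z.2 - a).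
  transitivity (2 * b * (x.1 * z.1 + x.2 * z.2 - a * (x.1 ^+ 2 + x.2 ^+ 2))); first by rewrite /side /=; ring.
  by rewrite cx mulr1.
have kx : 0 < side k x.
  rewrite kE; have -> : x.1 * x.1 + x.2 * x.2 = 1 by rewrite -cx; ring.
  by rewrite !mulr_gt0// /a; lra.
exists k; split => //.
  split => // E; move: kx; rewrite /side E; rewrite !subrr !mul0r subrr ltxx //.
move=> z /circ_n2; rewrite /n2 => cz; rewrite kE pmulr_rge0 ?mulr_gt0// subr_ge0 => h.
apply: he0; rewrite -ball_normE /ball_ /=; apply: (@lt_le_trans _ _ e) => //.
have S : (x.1 - z.1) ^+ 2 + (x.2 - z.2) ^+ 2 < e ^+ 2.
  have -> : (x.1 - z.1) ^+ 2 + (x.2 - z.2) ^+ 2 = (x.1 ^+ 2 + x.2 ^+ 2) + (z.1 ^+ 2 + z.2 ^+ 2) - 2 * (x.1 * z.1 + x.2 * z.2) by ring.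
  by rewrite cx cz; move: h; rewrite /a; lra.
have F (u v : R) : u ^+ 2 + v ^+ 2 < e ^+ 2 -> `|u| < e.
  move=> h'; rewrite -(@ltr_pXn2r _ 2)// ?nnegrE ?(ltW e_gt0)// real_normK ?num_real//.
  by apply: le_lt_trans h'; rewrite lerDl sqr_ge0.
by apply/norm_ltP; split; [exact: (F _ _ S)|apply: (F _ (x.1 - z.1)); rewrite addrC].
Qed.

(** The points of large parameter are close to x. *)
Lemma stereo_far l x : 0 < side l x -> circle x -> exists B : R, forall s, B < s -> 0 < side l (stereo x s).
Proof.
move=> lx cx; pose A := side l x.
pose al1 := - (l.2.2 - l.1.2); pose al2 := l.2.1 - l.1.1.
pose be := side l ((0, 0) : pl).
have sdE z : side l z = al1 * z.1 + al2 * z.2 + be by rewrite /be /al1 /al2 /side /=; ring.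
pose ga := al1 * x.2 - al2 * x.1; pose de := be - (al1 * x.1 + al2 * x.2).
have E s : side l (stereo x s) * (s ^+ 2 + 1) = s ^+ 2 * A + 2 * s * ga + de.
  have d := den_neq0 s; rewrite /A !sdE /stereo /= /ga /de; by field.
pose B := Num.max 1 ((2 * `|ga| + `|de|) / A).
exists B => s; rewrite gt_max => /andP[s1]; rewrite ltr_pdivrMr// => s2.
rewrite -(pmulr_lgt0 _ (den_gt0 s)) E.
have g1 := ler_norm (- ga); have d1 := ler_norm (- de); rewrite !normrN in g1 d1.
have gn := normr_ge0 ga; have dn := normr_ge0 de.
have s0 : 0 < s by lra.
have P1 : 0 < s * (s * A - (2 * `|ga| + `|de|)) by rewrite mulr_gt0// subr_gt0.
have P2 : 0 <= s * (`|ga| + ga) by rewrite mulr_ge0//; lra.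
have P3 : 0 <= (s - 1) * `|de| by rewrite mulr_ge0//; lra.
rewrite expr2; lra.
Qed.

Variables L1 L2 : set (pl * pl).
Hypothesis PL1 : pre_lamination L1.
Hypothesis P2 : P_pre_lamination L2.
Hypothesis L12 : L1 `<=` L2.
Hypothesis dn : dense (leaf_image L1 L2).

Let PL2 : pre_lamination L2. Proof. by case: P2. Qed.

Section OneCap.
Variable k : pl * pl.
Hypothesis gk : geo k.
Hypothesis noend : forall l, L1 l -> side k l.1 < 0.

(** An open interval through l contains a leaf of L1 on the side of l included
    in the cap, and that leaf has both ends in the cap. *)
Lemma no_leaf_in_cap l : L2 l -> 0 <= side k l.1 -> 0 <= side k l.2 -> False.
Proof.
move=> Ll h1 h2; have gl := pl_geo PL2 Ll; have cl_ := leaf_cl PL2 Ll.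
have nkl : noncross k l by exact: mulr_ge0.
have nlk := noncross_sym gk gl nkl.
have [s [ss sub]] : exists s, same l s /\ left_of s `<=` left_of k.
  have [sm|nsm] := pselect (same k l); first by exists k; split => //; exact: same_sym.
  have lk : ch l `<=` left_of k.
    case: (noncross_sides gk gl nkl) => // f; have [_] := f _ (ch_mid l).
    by rewrite side_flip /mid side_seg; lra.
  have [s [ss ks]] : exists s, same l s /\ ch k `<=` left_of (flip s).
    case: (noncross_sides gl gk nlk) => [sm|f|f].
    - by case: nsm; exact: same_sym.
    - by exists (flip l); rewrite flipK; split => //; right.
    - by exists l; split => //; left.
  exists s; split => // p [ip sp_]; split => //.
  have gs : geo s by case: ss => ->; [|exact: geo_flip].
  have sk : ch (flip s) `<=` left_of k by rewrite ch_flip (same_ch ss).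
  rewrite ltNge; apply/negP; rewrite le_eqVlt => /predU1P[z|n].
    by have [_] := ks p (disc_ch gk ip z); rewrite side_flip; lra.
  apply: (facing_disjoint (geo_flip gs) gk ks sk _ _ n); first exact/ltW/discP.
  by rewrite side_flip oppr_lt0.
have Ls := pl_same PL2 ss Ll; have cs := leaf_cl PL2 Ls.
have [I [oi Is]] := interval_through PL2 P2 Ls.
have [j [Lj Ij sj]] := interval_side PL2 oi Ls Is.
have ne : ch s <> ch j.
  by move=> E; have [_] := sj _ (ch_mid j); rewrite (side_ch (l := s)) ?ltxx// E; exact: ch_mid.
have [i [Li si]] := leaf_between PL1 P2 dn oi Ls Lj Is Ij ne.
have ci := leaf_cl PL2 (L12 Li).
have bi := cuts_beyond PL2 ci cs (leaf_cl PL2 Lj) sj si.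
have [ge _] : 0 <= side k i.1 /\ 0 <= side k i.2 by apply: left_of_end => p /bi /sub.
by have := noend Li; rewrite ltNge ge.
Qed.

Lemma no_accum_in_cap l : geo l -> accum L2 l -> side k l.1 <= 0 /\ side k l.2 <= 0.
Proof.
move=> gl al; have a1 := accum_transfer PL1 P2 L12 dn gl al.
split; rewrite leNgt; apply/negP => h.
  have c : continuous (fun l : pl * pl => side k l.1).
    by move=> y; apply: (continuous_comp (f := fst) (g := side k)); [exact: cfst|exact: side_cont_p].
  have [i [[Li _] si]] := a1 _ (near_gt0 c h).
  by have := noend Li; rewrite ltNge => /negP; apply; exact: ltW.
have c : continuous (fun l : pl * pl => side k l.2).
  by move=> y; apply: (continuous_comp (f := snd) (g := side k)); [exact: csnd|exact: side_cont_p].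
have [i [[Li _] si]] := a1 _ (near_gt0 c h).
by have := noend (pl_flip PL1 Li); rewrite ltNge => /negP; apply; exact: ltW.
Qed.

(** A nonleaf limit chord is accumulated by leaves of L1, so has no end in the
    open cap; and a leaf with one end in the cap has the other outside. *)
Lemma cap_crossing c g : inner L2 c -> adj L2 c g -> 0 < side k g.1 \/ 0 < side k g.2 ->
  L2 g /\ side g k.1 * side g k.2 < 0.
Proof.
move=> ic ag h; have cg := adj_cl ag; have gg := cl_geo cg.
have Lg : L2 g.
  case: (cl_accum PL2 cg) => // a.
    by have [u v] := no_accum_in_cap gg a; case: h; lra.
  by have [u v] := no_accum_in_cap (geo_flip gg) a; move: u v => /=; case: h; lra.
split => //; apply: (cross_sym gk gg).
case: h => h.
  rewrite pmulr_rlt0// ltNge; apply/negP => h'; exact: (no_leaf_in_cap Lg (ltW h) h').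
rewrite pmulr_llt0// ltNge; apply/negP => h'; exact: (no_leaf_in_cap Lg h' (ltW h)).
Qed.

(** Take a leaf of L2 with an end x in the open cap and let l be the extreme
    chord from x towards the points of large parameter. It is a leaf and borders
    a shell on its left. The points of the cap on that side which are close to x
    are cut off from the shell by boundary leaves, all of which cross k like l;
    by [no_three_cut] there is only one such leaf g. As it cuts off points
    arbitrarily close to x, it ends at x, against the choice of l. *)
Lemma cap_absurd x0 : circle x0 -> 0 < side k x0 -> False.
Proof.
move=> cx0 kx0; have dL2 := P_dense P2.
have [x [[y xy] kx]] := dL2 _ cx0 _ (near_gt0 (@side_cont_p R k) kx0).
have Lxy : L2 (x, y) by case: xy => // /(pl_flip PL2).
have [cx cy nxy] := pl_geo PL2 Lxy; rewrite /= in cx cy nxy.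
have [s1 ys] := stereo_surj cx cy (fun E0 => nxy (esym E0)).
pose S : set R := [set s | L2 (x, stereo x s)].
have S1 : S s1 by rewrite /S /= -ys.
have Sneg s : S s -> side k (stereo x s) < 0.
  by move=> Ss; rewrite ltNge; apply/negP => ge; exact: (no_leaf_in_cap Ss (ltW kx) ge).
have [B hB] := stereo_far kx cx.
have ubB : ubound S B.
  move=> s Ss; rewrite leNgt; apply/negP => /hB; have := Sneg s Ss; lra.
have hsS : has_sup S by split; [exists s1|exists B].
pose s := sup S; pose l := (x, stereo x s).
have gl : geo l := stereo_geo s cx.
have us t : S t -> t <= s by move=> St; apply: ub_le_sup => //; case: hsS.
have Ll : L2 l.
  apply: contrapT => nl.
  have al : accum L2 (flip l).
    apply: (stereo_accum_left PL2 cx) => e e0; have [t St ht] := sup_adherent e0 hsS.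
    exists t => //; rewrite ht lt_neqAle us// andbT /=.
    by apply/eqP => E; apply: nl; rewrite /l -/s -E.
  by have [_ /=] := no_accum_in_cap (geo_flip gl) al; rewrite leNgt kx.
have cl_ := leaf_cl PL2 Ll.
have klx : side k l.2 < 0 by exact: Sneg.
case: (accum_or_adj PL2 cl_) => [a|[c ic al]].
  by have [/= u _] := no_accum_in_cap gl a; move: u; rewrite leNgt kx.
have crl : side l k.1 * side l k.2 < 0.
  by have [] := cap_crossing ic al (or_introl kx).
have [n1 n2'] : n2 k.1 <= 1 /\ n2 k.2 <= 1 by case: gk => *; split; exact: circle_le.
(* Density of L2 moves z to the end z' of a leaf. The boundary chord facing that
   leaf separates z' from x, so it has an end in the cap. *)
have cut z : circle z -> 0 < side k z -> 0 < side l z -> forall h, (side h z <= 0 \/ 0 < side h z) ->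
   exists z' g, [/\ adj L2 c g, ~ same l g, side g z' <= 0, 0 < side h z -> 0 < side h z' &
     L2 g /\ side g k.1 * side g k.2 < 0].
  move=> cz kz lz h hz.
  have nb : \forall z' \near z, [/\ 0 < side k z', 0 < side l z' & 0 < side h z -> 0 < side h z'].
    have nk := near_gt0 (@side_cont_p R k) kz; have nl := near_gt0 (@side_cont_p R l) lz.
    case: hz => hz.
      by apply: filterS (filterI nk nl) => z' [u v]; split => // hz'; move: hz; rewrite leNgt hz'.
    by apply: filterS (filterI nk (filterI nl (near_gt0 (@side_cont_p R h) hz))) => z' [u [v w]].
  have [z' [[y' zy] [kz' lz' hz']]] := dL2 _ cz _ nb.
  have Lm : L2 (z', y') by case: zy => // /(pl_flip PL2).
  have cm := leaf_cl PL2 Lm; pose m := (z', y').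
  have nn : 0 <= side l z' * side l y' by exact: (closure_noncross PL2 cl_.2 cm.2).
  have ty : 0 <= side l y' by rewrite -(pmulr_rge0 _ lz').
  have lm : 0 < side l (mid m) by rewrite /mid side_seg /=; move: lz' ty; lra.
  have [g [ag gm]] := facing_leaf PL2 ic cm.
  have cg := adj_cl ag.
  have nlg : ~ same l g by move=> /(adj_same al ag) E; move: gm; rewrite -E leNgt lm.
  have gz' : side g z' <= 0.
    have [sm|nsm] := pselect (same g m).
      by rewrite (same_sd0 (same_sym sm) (side_1 m)).
    have n : side g (mid m) < 0.
      by rewrite lt_neqAle gm andbT; exact: (cl_side_ne PL2 cg cm nsm (ch_mid m)).
    by have [u _] := left_of_end (cl_neg PL2 cg cm (ch_mid m) n); move: u; rewrite side_flip oppr_ge0.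
  have gx : 0 <= side g x.
    have ct : closure (ch l) x by have [u _] := end_closure l.
    by have [_ /(_ g cg)] := adj_cl_closed_region al ct; rewrite pmulr_rge0// (adj_pos ag).
  have [t [t01 zt]] : exists t, 0 <= t <= 1 /\ side g (seg x z' t) = 0.
    move: gx; rewrite le_eqVlt => /predU1P[E|gx].
      by exists 0; rewrite lexx ler01 seg0.
    move: gz'; rewrite le_eqVlt => /predU1P[E|gz'].
      by exists 1; rewrite lexx ler01 seg_1.
    have [t /andP[t0 t1] zt] : exists2 t, 0 < t < 1 & side g (seg x z' t) = 0.
      by apply: affine_zero; rewrite pmulr_rlt0.
    by exists t; rewrite !ltW.
  have kw : 0 < side k (seg x z' t) by rewrite side_seg; exact: conv_pos.
  have nw : n2 (seg x z' t) <= 1.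
    apply: (le_trans (n2_segle _ _ t01)).
    by have [cz' _ _] := cl_geo cm; rewrite /= in cz'; rewrite ((circ_n2 _).1 cx) ((circ_n2 _).1 cz'); lra.
  have [u /andP[u0 u1] wE] := closure_chord (closed_chordI (cl_geo cg) nw zt).
  have hg : 0 < side k g.1 \/ 0 < side k g.2.
    case: (ltrP 0 (side k g.1)) => h1; first by left.
    case: (ltrP 0 (side k g.2)) => h2; first by right.
    by move: kw; rewrite wE side_seg; have : 0 <= 1 - u by [lra|]; nra.
  exists z', g; split => //; exact: (cap_crossing ic ag hg).
have [B1 hB1] := stereo_far kx cx.
pose t0 := Num.max s B1 + 1.
have pt t : t0 < t -> [/\ circle (stereo x t), 0 < side k (stereo x t) & 0 < side l (stereo x t)].
  rewrite -ltrBrDr gt_max => /andP[u v]; split; first exact: stereo_circle.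
    by apply: hB1; lra.
  by rewrite side_stereo_gt0//; lra.
have [c1 k1 l1] := pt (t0 + 1) (ltr_pwDr ltr01 (lexx _)).
have [z1 [g [ag nlg _ _ [Lg gcr]]]] := cut _ c1 k1 l1 l (or_intror l1).
have cg := adj_cl ag; have gg := cl_geo cg.
(* The leaf that cuts off a point beyond t0 is always g. *)
have gneg t : t0 < t -> side g (stereo x t) <= 0.
  move=> ht; have [ct kt lt_] := pt t ht; rewrite leNgt; apply/negP => gt_.
  have [z2 [g' [ag' nlg' gz2 gz2' [Lg' gcr']]]] := cut _ ct kt lt_ g (or_intror gt_).
  have ngg : ~ same g g'.
    by move=> /(adj_same ag ag') E; move: gz2; rewrite -E leNgt gz2'.
  exact: (no_three_cut PL2 al ag ag' nlg nlg' ngg n1 n2' crl gcr gcr').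
have gx0 : 0 <= side g x.
  have ct : closure (ch l) x by have [u _] := end_closure l.
  by have [_ /(_ g cg)] := adj_cl_closed_region al ct; rewrite pmulr_rge0// (adj_pos ag).
have gx1 : side g x <= 0.
  rewrite leNgt; apply/negP => gx; have [B2 hB2] := stereo_far gx cx.
  have := gneg (Num.max t0 B2 + 1); have := hB2 (Num.max t0 B2 + 1).
  have m1 : B2 <= Num.max t0 B2 by rewrite le_max lexx orbT.
  have m2 : t0 <= Num.max t0 B2 by rewrite le_max lexx.
  by move=> /(_ (le_lt_trans m1 (ltr_pwDr ltr01 (lexx _)))) u /(_ (le_lt_trans m2 (ltr_pwDr ltr01 (lexx _)))); rewrite leNgt u.
have gx : side g x = 0 by apply/eqP; rewrite eq_le gx1 gx0.
have eg : ends_at x g.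
  by case: (circle_ends gg cx gx) => E; [left|right]; rewrite E.
have [u su] := ends_at_stereo cx gg eg.
have Su : S u by apply: (pl_same PL2 (same_sym su)).
have [_] := adj_facing PL2 al ag nlg (ch_mid g).
rewrite (stereo_ch_pos (t := u) s cx); last by rewrite -(same_ch su); exact: ch_mid.
by rewrite ltNge us.
Qed.

End OneCap.

Lemma sub_dense : dense_lamination L1.
Proof.
move=> x cx U nU; apply: contrapT => no.
have [k [gk kx hk]] := cap cx nU.
apply: (@cap_absurd k gk _ x cx kx) => l Ll; rewrite ltNge; apply/negP => h.
apply: no; exists l.1; split; last by apply: hk => //; case: (pl_geo PL1 Ll).
by exists l.2; left; case: l Ll {h}.
Qed.

Lemma sub_few_common_ends : few_common_ends L1.
Proof.
apply: (few_common_ends_of PL1) => th a b c La Lb.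
apply: sub_finite_set (ends_discrete PL2 P2 c (L12 La) (L12 Lb)).
by move=> s [Ls h]; split => //; exact: L12.
Qed.

End Cap.

(** * From L1 to L2: the completion *)

Section Backward.
Variable R : realType.
Notation pl := (plane R).
Implicit Types (p q w z c x th : plane R) (l m k g h i j r : plane R * plane R).
Variable L1 : set (pl * pl).
Hypothesis PL1 : pre_lamination L1.

Lemma adj_same_region c c' l m : inner L1 c -> inner L1 c' -> adj L1 c l -> adj L1 c' m -> same l m ->
  ~ L1 l -> region L1 c c'.
Proof.
move=> ic ic' al am s nl; split; first by case: ic'.
move=> k Lk; have ck := leaf_cl PL1 Lk; have cl_ := adj_cl al.
have nk : ~ same k l by move=> sk; apply: nl; exact: (pl_same PL1 sk).
have hl := ch_mid l; have hm : ch m (mid l) by rewrite (same_ch s).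
have n := cl_side_ne PL1 ck cl_ nk hl.
have [_ _ h1] := al; have [_ _ h2] := am.
have u1 : 0 < side k c * side k (mid l).
  by rewrite lt_neqAle h1// andbT eq_sym mulf_neq0//; exact: (ic.2 k ck).
have u2 : 0 < side k (mid l) * side k c'.
  by rewrite mulrC lt_neqAle h2// andbT eq_sym mulf_neq0//; exact: (ic'.2 k ck).
exact: pos_trans u1 u2.
Qed.

Lemma adj_region c c' l : inner L1 c -> inner L1 c' -> region L1 c c' -> adj L1 c l -> adj L1 c' l.
Proof.
move=> ic ic' [_ h] [cl_ lc h2].
have key m : cl L1 m -> 0 < side m c * side m c'.
  move=> cm; rewrite lt_neqAle (cl_ge0 _ cm.2) ?andbT; last by move=> k Lk; exact: (ltW (h k Lk)).
  by rewrite eq_sym mulf_neq0//; [exact: (ic.2 m cm)|exact: (ic'.2 m cm)].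
split => //; first by have := key l cl_; rewrite pmulr_rgt0.
by move=> m p cm hp; apply: (pos_ge_trans _ (h2 m p cm hp)); rewrite mulrC; exact: key.
Qed.

(** The supremum of the lengths need not be attained, whence the factor 2. *)
Definition longest_root (A : set pl) r := exists c, [/\ inner L1 c, A = region L1 c, adj L1 c r, ~ L1 r &
  forall l, adj L1 c l -> ~ L1 l -> `|l.1 - l.2| <= 2 * `|r.1 - r.2|].
Definition root_of (A : set pl) : pl * pl := xget point (longest_root A).

Definition filler l := [/\ cl L1 l, ~ L1 l &
  forall c, inner L1 c -> adj L1 c l \/ adj L1 c (flip l) -> ~ same l (root_of (region L1 c))].
Definition completion : set (pl * pl) := L1 `|` filler.

Lemma completion_sub : L1 `<=` completion. Proof. by move=> l; left. Qed.
Lemma completion_cl l : completion l -> cl L1 l.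
Proof. by case=> [/(leaf_cl PL1)//|[]]. Qed.

Lemma cl_completion : cl completion = cl L1.
Proof.
apply/seteqP; split=> l [gl cl_]; split => //.
  by apply: (clos_min (@closed_closure _ L1) _ cl_) => m /completion_cl [].
exact: (closureS completion_sub cl_).
Qed.

Lemma completion_pl : pre_lamination completion.
Proof.
split.
- by move=> x y /completion_cl [[a b c] _].
- move=> x y [Lxy|[cl_ nl h]]; first by left; exact: (pl_flip PL1 Lxy).
  right; split; first exact: (cl_flip PL1 cl_).
    by move=> /(pl_flip PL1).
  move=> c ic [a|a] s; apply: (h c ic); [by right| |by left|].
    exact: (iffLR (same_flipl (x, y) _) s).
  exact: (iffLR (same_flipl (x, y) _) s).
- move=> a b /completion_cl ca /completion_cl cb [u [p [hp hq]]].
  have s := cl_meet PL1 ca cb hp hq.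
  by move: u; case: s => -> /=; rewrite !inE eqxx ?orbT.
Qed.

Lemma inner_completion c : inner completion c <-> inner L1 c.
Proof. by rewrite /inner cl_completion. Qed.
Lemma adj_completion c l : adj completion c l <-> adj L1 c l.
Proof. by split=> -[a b h]; split; rewrite ?cl_completion // in a h *. Qed.
Lemma closed_region_completion c : closed_region completion c = closed_region L1 c.
Proof. by rewrite /closed_region cl_completion. Qed.

Hypothesis D1 : dense_lamination L1.
Hypothesis H2 : forall A, complementary_region L1 A -> exists B, boundary_component A B /\ ~ leaves L1 B.
Hypothesis H3 : forall D, ~ bad_accumulation L1 D.
Hypothesis H4 : few_common_ends L1.

Lemma circle_dist x y : circle x -> circle y -> `|x - y| <= 2.
Proof.
move=> /circle_le /coord_le [/andP[a1 a2] /andP[b1 b2]] /circle_le /coord_le [/andP[c1 c2] /andP[d1 d2_]].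
rewrite prod_normE ge_max !ler_norml; apply/andP; split; apply/andP; split => /=; lra.
Qed.

Lemma root_of_longest c : inner L1 c -> longest_root (region L1 c) (root_of (region L1 c)).
Proof.
move=> ic; suff [r hr] : exists r, longest_root (region L1 c) r by exact: (xgetI point hr).
have [_ [/(bcP PL1 _ ic) [r0 [a0 ->]] n0]] := H2 (inner_complementary PL1 ic).
have g0 := cl_geo (adj_cl a0).
have nr0 : ~ L1 r0 by move/(leaf_ch PL1 g0).
pose E : set R := [set e | exists l, [/\ adj L1 c l, ~ L1 l & e = `|l.1 - l.2|]].
have hsE : has_sup E.
  split; first by exists `|r0.1 - r0.2|, r0.
  by exists 2 => _ [l [/adj_cl [[a b _] _] _ ->]]; exact: circle_dist.
have ub l : adj L1 c l -> ~ L1 l -> `|l.1 - l.2| <= sup E.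
  by move=> al nl; apply: ub_le_sup; [case: hsE|exists l].
have pos : 0 < sup E.
  apply: lt_le_trans (ub r0 a0 nr0); rewrite normr_gt0 subr_eq0; apply/eqP.
  by case: g0.
have [_ [r [ar nr ->]] hr] := sup_adherent (divr_gt0 pos (ltr0n _ 2)) hsE.
exists r, c; split => // l al nl; apply: (le_trans (ub l al nl)).
by move: hr; lra.
Qed.

Lemma root_props c : inner L1 c -> [/\ adj L1 c (root_of (region L1 c)), ~ completion (root_of (region L1 c)),
  forall l, adj L1 c l -> ~ L1 l -> `|l.1 - l.2| <= 2 * `|(root_of (region L1 c)).1 - (root_of (region L1 c)).2| &
  forall l, adj L1 c l -> ~ completion l -> l = root_of (region L1 c)].
Proof.
move=> ic; have [c' [ic' E ar nr hr]] := root_of_longest ic.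
set r := root_of _ in ar nr hr *.
have cc' : region L1 c c' by rewrite E; exact: inner_region.
have c'c : region L1 c' c by rewrite -E; exact: inner_region.
have ar' := adj_region ic' ic c'c ar.
split => //.
- by case=> // -[_ _ /(_ c ic (or_introl ar'))]; apply; exact: same_refl.
- by move=> l al nl; apply: hr => //; exact: (adj_region ic ic' cc' al).
- move=> l al nc; have nl : ~ L1 l by move=> Ll; apply: nc; left.
  have [d [id ad s]] : exists d, [/\ inner L1 d, adj L1 d l \/ adj L1 d (flip l) & same l (root_of (region L1 d))].
    apply: contrapT => h; apply: nc; right; split => //; first exact: (adj_cl al).
    by move=> d id ad s; apply: h; exists d.
  have rd : region L1 c d.
    case: ad => ad; first exact: (adj_same_region ic id al ad (same_refl l) nl).
    by apply: (adj_same_region ic id al ad _ nl); right.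
  by rewrite (region_eq rd) -/r in s; exact: (adj_same al ar' s).
Qed.

Let PL2 := completion_pl.

Lemma completion_region A : complementary_region completion A ->
  exists c, inner L1 c /\ A = region completion c.
Proof.
move=> /(regionP PL2) [w [iw ow ->]].
have [i|n] := pselect (inner L1 w); first by exists w.
have [l [cl_ hl]] : exists l, cl L1 l /\ ch l w.
  apply: contrapT => h; apply: n; split => // m cm; apply/eqP => z; apply: h; exists m.
  by split => //; apply: disc_ch => //; exact: (cl_geo cm).
have nc : ~ completion l by move=> /ow; rewrite (side_ch hl) eqxx.
have [c [ic ac]] : exists c, inner L1 c /\ (adj L1 c l \/ adj L1 c (flip l)).
  apply: contrapT => h; apply: (nc); right; split; [exact: cl_|by move=> Ll; apply: nc; left|].
  by move=> c ic ac s; apply: h; exists c.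
exists c; split => //; apply/esym/region_eq; split; first by case: ic.
move=> m Lm; have cm := completion_cl Lm.
rewrite lt_neqAle eq_sym mulf_neq0 ?ow//; last exact: (ic.2 m cm).
by rewrite mulrC; case: ac => -[_ _ h]; apply: h; rewrite ?ch_flip.
Qed.

Lemma completion_shell A : complementary_region completion A -> shell completion A.
Proof.
move=> hA; have [c [ic E]] := completion_region hA.
have ic2 := (inner_completion c).2 ic; have [ar nr _ ur] := root_props ic.
rewrite E in hA *; split => //.
  exists c; rewrite interior_open_region//; split; first by case: ic.
  by move=> m cm; apply: (inner_sq ic2 cm).
have gr := cl_geo (adj_cl ar).
exists (ch (root_of (region L1 c))); split.
  split; last by move/(leaf_ch PL2 gr).
  by apply/(bcP PL2 _ ic2); eexists; split; [apply/adj_completion; exact: ar|].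
move=> B [/(bcP PL2 _ ic2) [l [/adj_completion al ->]] nB].
have nl : ~ completion l by move=> Ll; apply: nB; apply/(leaf_ch PL2 (cl_geo (adj_cl al))).
by rewrite (ur l al nl).
Qed.

(** The regions with interior of the completion have the same closures and
    boundary components as those of L1. It remains to see that the two long
    boundary components are leaves of L1. *)
Lemma completion_no_bad D : ~ bad_accumulation completion D.
Proof.
move=> [hD [_ [[gx [gy [g1 g2 gne ->]]] hcD [a [b [[nab hca hcb short] nl]]]]]].
pose g := (gx, gy).
have gn : 0 < `|gx - gy| by rewrite normr_gt0 subr_eq0; apply/eqP.
have exc n : exists c, inner L1 c /\ D n = region completion c.
  by case: (hD n) => hn _; exact: (completion_region hn).
have [c hc] := choice exc.
have ic n : inner L1 (c n) by case: (hc n).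
have ic2 n : inner completion (c n) by apply/inner_completion.
have clE n : closure (region L1 (c n)) = closure (D n).
  by case: (hc n) => _ ->; rewrite !closure_region// closed_region_completion.
have bcE n B : boundary_component (region L1 (c n)) B <-> boundary_component (D n) B.
  case: (hc n) => _ ->; split=> [/(bcP PL1 _ (ic n))|/(bcP PL2 _ (ic2 n))] [l [al E]].
    by apply/(bcP PL2 _ (ic2 n)); exists l; split => //; apply/adj_completion.
  by apply/(bcP PL1 _ (ic n)); exists l; split => //; apply/adj_completion.
(* A boundary component u n converging to g that is in the completion but not in
   L1 has length at most twice that of the root. The root is not a leaf of the
   completion, so it is none of a n and b n and is short, whereas u n is about
   as long as g. *)
have long (u : nat -> set pl) : hausdorff_cvg u (ch g) ->
   (\forall n \near \oo, boundary_component (D n) (u n) /\ leaves completion (u n)) ->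
   (\forall n \near \oo, leaves completion (a n) /\ leaves completion (b n)) ->
   \forall n \near \oo, leaves L1 (u n).
  move=> hu bu lab; have e0 : 0 < `|gx - gy| / 8 by rewrite divr_gt0.
  apply: filterS (filterI bu (filterI lab (filterI ((hcvgP _ _).1 hu _ e0) (short _ e0)))).
  move=> n [[bun lu] [[la lb] [[_ hn] sh]]]; apply: contrapT => nL.
  have /(bcE n) /(bcP PL1 _ (ic n)) [al [aal uE]] := bun.
  have gal := cl_geo (adj_cl aal).
  have nal : ~ L1 al by move=> L; apply: nL; rewrite uE; apply/(leaf_ch PL1 gal).
  have [ar nr big _] := root_props (ic n).
  set r := root_of _ in ar nr big; have gr := cl_geo (adj_cl ar); have [r1 r2 rn] := gr.
  have nleaf v : leaves completion v -> chord r.1 r.2 <> v.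
    by move=> lv E; apply: nr; apply/(leaf_ch PL2 gr); rewrite /ch E.
  have br : boundary_component (D n) (chord r.1 r.2).
    by apply/(bcE n); apply/(bcP PL1 _ (ic n)); exists r.
  have := edist_norm (sh _ _ r1 r2 br (nleaf _ la) (nleaf _ lb)).
  have := big al aal nal.
  have [p1 [hp1 d1]] := hn gx (end_closure g).1; have [p2 [hp2 d2_]] := hn gy (end_closure g).2.
  rewrite uE in hp1 hp2.
  have [t1 t101 p1E] := closure_chord hp1; have [t2 t201 p2E] := closure_chord hp2.
  have dp : `|p1 - p2| <= `|al.1 - al.2|.
    have -> : p1 - p2 = (t2 - t1) *: (al.1 - al.2).
      have sb (u' v : pl) : (u' - v).1 = u'.1 - v.1 /\ (u' - v).2 = u'.2 - v.2 by [].
      have sc (t : R) (v : pl) : (t *: v).1 = t * v.1 /\ (t *: v).2 = t * v.2 by [].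
      by apply: plane_eq; rewrite ?(sb _ _).1 ?(sb _ _).2 ?(sc _ _).1 ?(sc _ _).2 ?(sb _ _).1 ?(sb _ _).2 p1E p2E
        !(seg1E, seg2E); ring.
    rewrite normrZ ler_piMl// ler_norml; case/andP: t101 => *; case/andP: t201 => *.
    by apply/andP; split; lra.
  have t : `|gx - gy| <= `|p1 - gx| + `|p1 - p2| + `|p2 - gy|.
    apply: (le_trans (ler_distD p1 _ _)); rewrite (distrC gx) -addrA lerD2l.
    exact: ler_distD.
  by move: dp t d1 d2_; lra.
have lab := nl; have bab := nab.
have la1 : \forall n \near \oo, leaves L1 (a n).
  apply: long => //; apply: filterS (filterI nl nab) => n [[la lb] [ba bb _]]; by split.
have lb1 : \forall n \near \oo, leaves L1 (b n).
  apply: long => //; apply: filterS (filterI nl nab) => n [[la lb] [ba bb _]]; by split.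
apply: (H3 (D := fun n => region L1 (c n))); split.
  move=> n; split; first exact: inner_complementary.
  exists (c n); rewrite interior_open_region//; split; first by case: (ic n).
  by move=> m cm; apply: (inner_sq (ic n) cm).
exists (ch g); split; first by exists gx, gy.
  by move=> e e0; apply: filterS (hcD e e0) => n; rewrite clE.
exists a, b; split; last by apply: filterS (filterI la1 lb1).
split => //.
  by apply: filterS nab => n [ba bb ne]; split => //; apply/bcE.
move=> e e0; apply: filterS (short e e0) => n h x y cx cy /(bcE n); exact: h.
Qed.

Lemma countable_subsingleton (T : Type) (A : set T) : (forall x y : T, A x -> A y -> x = y) -> countable A.
Proof.
move=> h; have [[x Ax]|n] := pselect (A !=set0).
  by rewrite (_ : A = [set x]); [exact: countable1|apply/seteqP; split=> [y Ay|y ->//]; exact: h].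
by rewrite (_ : A = set0) //; apply/seteqP; split => // x Ax; apply: n; exists x.
Qed.

Lemma side_ster3 th a b t : circle th -> side (stereo th a, stereo th b) (stereo th t) =
  4 * (b - a) * (t - a) * (t - b) / ((a ^+ 2 + 1) * (b ^+ 2 + 1) * (t ^+ 2 + 1)).
Proof.
move=> /circ_n2; rewrite /n2 => e; rewrite /side /stereo /=.
have d := den_neq0 a; have d' := den_neq0 b; have d'' := den_neq0 t.
transitivity ((th.1 ^+ 2 + th.2 ^+ 2) * (4 * (b - a) * (t - a) * (t - b) / ((a ^+ 2 + 1) * (b ^+ 2 + 1) * (t ^+ 2 + 1)))).
  by field; rewrite d d' d''.
by rewrite e mul1r.
Qed.

(** A leaf close to the chord of parameter s and on its left has an end close to
    th. It does not cross the chord of parameter s', so this end is in the angle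
    at th between both chords; as it is on the side of th of the line through
    their other ends, it is th. *)
Lemma sector_right th (s s' u : R) : circle th -> accum L1 (th, stereo th s) -> cl L1 (th, stereo th s') ->
  s < s' -> s < u -> exists2 t, L1 (th, stereo th t) & s < t < u.
Proof.
move=> c al cl' ss su; pose l := (th, stereo th s); have gl : geo l := stereo_geo s c.
pose e := (stereo th s, stereo th s').
have e_th : 0 < side e th.
  have -> : side e th = side (th, stereo th s) (stereo th s') by rewrite /side /=; ring.
  by rewrite side_stereo_gt0.
have c1 : continuous (fun i => side e i.1).
  by move=> y; apply: (continuous_comp (f := fst) (g := side e)); [exact: cfst|exact: side_cont_p].
have c2 (v : R) : continuous (fun i => side (th, stereo th v) i.2).
  by move=> y; apply: (continuous_comp (f := snd) (g := side (th, stereo th v))); [exact: csnd|exact: side_cont_p].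
have n1 : \forall i \near l, 0 < side e i.1 by apply: (near_gt0 c1).
have n2' : \forall i \near l, side (th, stereo th u) i.2 < 0.
  by apply: (near_lt0 (c2 u)); rewrite /= side_stereo_lt0.
have n3 : \forall i \near l, side (th, stereo th s') i.2 < 0.
  by apply: (near_lt0 (c2 s')); rewrite /= side_stereo_lt0.
have [i [[Li si] [i1 [i2 i3]]]] := al _ (filterI n1 (filterI n2' n3)).
have ci := leaf_cl PL1 Li; have [ci1 ci2 nei] := cl_geo ci.
have [lo1 lo2] := left_of_end si.
have hi : ch i `<=` left_of (flip (th, stereo th s')).
  case: (cl_sides PL1 cl' ci) => // h.
    by case: h => E; move: i3 i1; rewrite E /= ?side_2 ?side_1 ?ltxx// => _; rewrite /e side_2 ltxx.
  by have [_] := left_of_end h; rewrite leNgt i3.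
have [] := left_of_end hi; rewrite !side_flip !oppr_ge0 => hi1 hi2.
have i1th : i.1 = th.
  apply: contrapT => ne; have [t tE] := stereo_surj c ci1 ne.
  move: lo1 hi1 i1; rewrite tE leNgt side_stereo_lt0// -leNgt => st.
  rewrite leNgt side_stereo_gt0// -leNgt => ts; rewrite side_ster3// ltNge => /negP; apply.
  have D : 0 <= ((s ^+ 2 + 1) * (s' ^+ 2 + 1) * (t ^+ 2 + 1))^-1.
    by rewrite invr_ge0 !mulr_ge0// ltW// den_gt0.
  rewrite mulr_le0_ge0// mulr_ge0_le0 ?subr_le0// !mulr_ge0 ?subr_ge0// ltW//.
have ne : i.2 <> th by rewrite -i1th => /esym.
have [t tE] := stereo_surj c ci2 ne.
have iE : i = (th, stereo th t) by rewrite [LHS]surjective_pairing i1th tE.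
exists t; first by rewrite -iE.
have [_ ip] := si _ (ch_mid i); rewrite iE (stereo_ch_pos _ c (ch_mid _)) in ip.
by rewrite ip /=; move: i2; rewrite tE side_stereo_lt0.
Qed.

(** The mirror image of [sector_right]. *)
Lemma sector_left th (s s' u : R) : circle th -> accum L1 (flip (th, stereo th s)) -> cl L1 (th, stereo th s') ->
  s' < s -> u < s -> exists2 t, L1 (th, stereo th t) & u < t < s.
Proof.
move=> c al cl' ss su; pose l := (th, stereo th s); have gl : geo l := stereo_geo s c.
pose e := (stereo th s', stereo th s).
have e_th : 0 < side e th.
  have -> : side e th = side (th, stereo th s') (stereo th s) by rewrite /side /=; ring.
  by rewrite side_stereo_gt0.
have c1 : continuous (fun i => side e i.2).
  by move=> y; apply: (continuous_comp (f := snd) (g := side e)); [exact: csnd|exact: side_cont_p].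
have c2 (v : R) : continuous (fun i => side (th, stereo th v) i.1).
  by move=> y; apply: (continuous_comp (f := fst) (g := side (th, stereo th v))); [exact: cfst|exact: side_cont_p].
have n1 : \forall i \near flip l, 0 < side e i.2 by apply: (near_gt0 c1).
have n2' : \forall i \near flip l, 0 < side (th, stereo th u) i.1.
  by apply: (near_gt0 (c2 u)); rewrite /= side_stereo_gt0.
have n3 : \forall i \near flip l, 0 < side (th, stereo th s') i.1.
  by apply: (near_gt0 (c2 s')); rewrite /= side_stereo_gt0.
have [i [[Li si] [i1 [i2 i3]]]] := al _ (filterI n1 (filterI n2' n3)).
have ci := leaf_cl PL1 Li; have [ci1 ci2 nei] := cl_geo ci.
have [lo1 lo2] := left_of_end si; rewrite !side_flip !oppr_ge0 in lo1 lo2.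
have hi : ch i `<=` left_of (th, stereo th s').
  case: (cl_sides PL1 cl' ci) => // h.
    by case: h => E; move: i3 i1; rewrite E /= ?side_2 ?side_1 ?ltxx// => _; rewrite /e side_1 ltxx.
  by have [] := left_of_end h; rewrite side_flip oppr_ge0 leNgt i3.
have [hi1 hi2] := left_of_end hi.
have i2th : i.2 = th.
  apply: contrapT => ne; have [t tE] := stereo_surj c ci2 ne.
  move: lo2 hi2 i1; rewrite tE leNgt side_stereo_gt0// -leNgt => st.
  rewrite leNgt side_stereo_lt0// -leNgt => ts; rewrite side_ster3// ltNge => /negP; apply.
  have D : 0 <= ((s' ^+ 2 + 1) * (s ^+ 2 + 1) * (t ^+ 2 + 1))^-1.
    by rewrite invr_ge0 !mulr_ge0// ltW// den_gt0.
  rewrite mulr_le0_ge0// mulr_ge0_le0 ?subr_le0// !mulr_ge0 ?subr_ge0// ltW//.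
have ne : i.1 <> th by rewrite -i2th.
have [t tE] := stereo_surj c ci1 ne.
have iE : flip i = (th, stereo th t) by rewrite /flip i2th tE.
exists t; first by rewrite -iE; exact: (pl_flip PL1).
have hm : ch (th, stereo th t) (mid i) by rewrite -iE ch_flip; exact: ch_mid.
have [_] := si _ (ch_mid i); rewrite side_flip oppr_gt0 (stereo_ch_neg _ c hm) => ts.
by rewrite ts andbT; move: i2; rewrite tE side_stereo_gt0.
Qed.

(** The index set of F lists the possible kinds of ends: an end of a leaf of L1,
    by its rank; a chord bounding a region with interior, by a rational point of
    the region and the side on which it is; and the least and greatest
    parameters in T, the set of the chords accumulated on both sides. *)
Lemma completion_countable th : circle th -> countable (common_ends completion th).
Proof.
move=> c; have [J [f [_ [_ finj _] ford]]] := H4 c.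
pose S : set R := [set s | L1 (th, stereo th s)].
have fo s t : S s -> S t -> s < t -> f (stereo th s) < f (stereo th t).
  move=> Ss St st; apply/ford; [by split; [exact: stereo_neq|]|by split; [exact: stereo_neq|]|].
  exact/arc_ltP.
pose T : set R := [set s | filler (th, stereo th s) /\
  forall d, inner L1 d -> ~ (adj L1 d (th, stereo th s) \/ adj L1 d (flip (th, stereo th s)))].
have Tacc s : T s -> [/\ cl L1 (th, stereo th s), accum L1 (th, stereo th s) & accum L1 (flip (th, stereo th s))].
  move=> [[cl_ _ _] h]; split => //.
    by case: (accum_or_adj PL1 cl_) => // -[d id ad]; case: (h d id); left.
  by case: (accum_or_adj PL1 (cl_flip PL1 cl_)) => // -[d id ad]; case: (h d id); right.
(* There would be leaves of L1 of parameters decreasing to s2, and another one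
   of parameter t1 < s2. The ranks of the former are bounded below by that of
   the latter, so one of them has least rank. *)
have three s1 s2 s3 : T s1 -> T s2 -> T s3 -> s1 < s2 -> s2 < s3 -> False.
  move=> /Tacc [c1 _ _] /Tacc [c2 r2 l2] /Tacc [c3 _ _] s12 s23.
  have [t1 St1 /andP[_ t1s]] := sector_left c l2 c1 s12 s12.
  pose Q (n : nat) := `[< exists t, [/\ S t, s2 < t & `|f (stereo th t) - f (stereo th t1)|%N = n] >].
  have exQ : exists n, Q n.
    have [t St /andP[st _]] := sector_right c r2 c3 s23 s23.
    by eexists; apply/asboolP; exists t; split => //.
  have [n /asboolP [t [St st tn]] nmin] := ex_minnP exQ.
  have [t' St' /andP[st' tt']] := sector_right c r2 c3 s23 st.
  have := fo _ _ St' St tt'; have := fo _ _ St1 St' (lt_trans t1s st').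
  have : (n <= `|f (stereo th t') - f (stereo th t1)|)%N by apply: nmin; apply/asboolP; exists t'.
  rewrite -tn; lia.
pose F (x : int + ((rat * rat) * bool + bool)) : set pl := match x with
  | inl n => [set z | common_ends L1 th z /\ f z = n]
  | inr (inl (q, b)) => [set z | [/\ z <> th, filler (th, z) &
      inner L1 ((ratr q.1, ratr q.2) : pl) /\
      adj L1 ((ratr q.1, ratr q.2) : pl) (if b then (th, z) else flip (th, z))]]
  | inr (inr b) => [set z | exists s, [/\ z = stereo th s, T s &
      forall t, T t -> if b then t <= s else s <= t]]
  end.
have sub : common_ends completion th `<=` \bigcup_(x in setT) F x.
  move=> z [zn [Lz|fz]]; first by exists (inl (f z)).
  have [cz _ _] := fz; have [_ c2 _] := cl_geo cz.
  have [s sE] := stereo_surj c c2 zn; rewrite /= in sE.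
  have [[d [id ad]]|no] := pselect (exists d, inner L1 d /\ (adj L1 d (th, z) \/ adj L1 d (flip (th, z)))).
    have op : open (open_region L1 d) by rewrite -(interior_open_region PL1 id); exact: open_interior.
    have : nbhs d (open_region L1 d).
      apply: open_nbhs_nbhs; split => //; split; first by case: id.
      by move=> m cm; apply: (inner_sq id cm).
    case/nbhs_ballP => e /= e0 he.
    have rq (a : R) : exists q : rat, `|a - ratr q| < e.
      have [|q] := @rat_in_itvoo R (a - e) (a + e); first by lra.
      by rewrite in_itv /= => /andP[q1 q2]; exists q; rewrite ltr_norml; apply/andP; split; lra.
    have [q1 h1] := rq d.1; have [q2 h2] := rq d.2.
    pose q : pl := (ratr q1, ratr q2).
    have hq : open_region L1 d q by apply: he; rewrite -ball_normE /ball_ /=; apply/norm_ltP.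
    have iq := open_region_inner id hq.
    have rdq := open_region_region PL1 id hq.
    by case: ad => ad; [exists (inr (inl ((q1, q2), true)))|exists (inr (inl ((q1, q2), false)))] => //=;
      split => //; split => //; exact: (adj_region id iq rdq ad).
  have Ts : T s by split; rewrite /= -sE // => d id ad; apply: no; exists d.
  have [[t [Tt ts]]|nlow] := pselect (exists t, T t /\ t < s); last first.
    exists (inr (inr false)) => //; exists s; split => // t Tt.
    by rewrite leNgt; apply/negP => ts; apply: nlow; exists t.
  exists (inr (inr true)) => //; exists s; split => // t' Tt'.
  by rewrite leNgt; apply/negP => st; exact: (three t s t').
apply: sub_countable (subset_card_le sub) _; apply: bigcup_countable; first exact: countableP.
move=> [n|[[q b]|b]] _; apply: countable_subsingleton => z z' /=.
- by move=> [cz fz] [cz' fz']; apply: finj; [exact: mem_set|exact: mem_set|rewrite fz fz'].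
- move=> [zn [cz nz _] [iq aq]] [zn' [cz' nz' _] [_ aq']].
  set d : pl := (_, _) in iq aq aq'.
  have [_ c2 _] := cl_geo cz; have [_ c2' _] := cl_geo cz'.
  have [s sE] := stereo_surj c c2 zn; have [s' sE'] := stereo_surj c c2' zn'; rewrite /= in sE sE'.
  have main (u v : R) : u < v -> forall b, adj L1 d (if b then (th, stereo th u) else flip (th, stereo th u)) ->
      adj L1 d (if b then (th, stereo th v) else flip (th, stereo th v)) -> False.
    move=> uv b' au av.
    have gu := stereo_geo u c; have gv := stereo_geo v c.
    have ns : ~ same (th, stereo th u) (th, stereo th v).
      move=> /same_ch E; have := stereo_ch_pos u c (ch_mid (th, stereo th v)).
      by rewrite uv (side_ch (l := (th, stereo th u))) ?ltxx// -E; exact: ch_mid.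
    case: b' au av => au av.
      have := adj_facing PL1 av au (fun E => ns (same_sym E)) (ch_mid _).
      by case=> _; rewrite (stereo_ch_pos _ c (ch_mid _)) ltNge (ltW uv).
    have ns' : ~ same (flip (th, stereo th u)) (flip (th, stereo th v)).
      by move=> /same_flipl /same_flipr.
    have hm : ch (flip (th, stereo th v)) (mid (th, stereo th v)) by rewrite ch_flip; exact: ch_mid.
    have := adj_facing PL1 au av ns' hm.
    by case=> _; rewrite side_flip oppr_gt0 (stereo_ch_neg _ c (ch_mid _)) ltNge (ltW uv).
  rewrite sE sE' in aq aq' *; case: (ltgtP s s') => [h|h|->//].
    by case: (main _ _ h b aq aq').
  by case: (main _ _ h b aq' aq).
- move=> [s [-> Ts hs]] [s' [-> Ts' hs']]; congr stereo; apply/eqP.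
  by have := hs _ Ts'; have := hs' _ Ts; case: b {hs hs'} => u v; rewrite eq_le u v.
Qed.

Lemma completion_P : P_pre_lamination completion.
Proof.
split; [exact: PL2| | | |exact: completion_no_bad].
- move=> x cx; apply: closureS (D1 cx) => y [z [h|h]]; exists z; [left|right]; by left.
- exact: completion_countable.
- exact: completion_shell.
Qed.

Lemma completion_dense : dense (leaf_image L1 completion).
Proof.
move=> U [x Ux] /leaf_open oU; have [s sI sU] := oU _ Ux.
have /leafE [f0 [Lf0 xE]] : leaves completion (sval x) := set_mem (svalP x).
have [Lf|nf] := pselect (L1 f0).
  by exists x; split => //; apply/leafE; exists f0.
have cf0 := completion_cl Lf0.
have [f [sf af]] : exists f, same f0 f /\ accum L1 f.
  case: (cl_accum PL1 cf0) => // a; first by exists f0; split => //; exact: same_refl.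
  by exists (flip f0); split => //; right.
have Lf := pl_same PL2 sf Lf0; have gf := pl_geo PL2 Lf.
have xE' : sval x = ch f by rewrite (same_ch sf).
have near_s : \forall i \near f, forall I, I \in s -> L1 i -> ch i `<=` left_of f -> I (ch i).
  have af2 : accum completion f.
    by apply: closureS af => k [Lk sk]; split => //; left.
  have ex : exit completion f f by split => //; left.
  have : forall I, I \in s -> \forall i \near f, L1 i -> ch i `<=` left_of f -> I (ch i).
    move=> I Is; have [oi Ix] := sI I Is; rewrite xE' in Ix.
    apply: filterS (interval_near PL2 completion_P Lf ex oi Ix) => i h Li; exact: (h (or_introl Li)).
  elim: (s) => [|I0 s0 IH] h; first by apply: filterS (@filterT _ (nbhs f) _) => i _ I; rewrite in_nil.
  have h0 := h I0 (mem_head _ _).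
  have h1 := IH (fun I Is => h I (mem_behead (s := I0 :: s0) Is)).
  apply: filterS (filterI h0 h1) => i [u v] I; rewrite inE => /predU1P[->|]; [exact: u|exact: v].
have [i [[Li si] hi]] := af _ near_s.
have li : leaves completion (ch i) by apply/leafE; exists i; split => //; left.
pose y : leaf_space completion := exist _ (ch i) (mem_set li).
exists y; split; last by apply/leafE; exists i.
by apply: sU => I Is; apply: (hi I Is Li si).
Qed.

End Backward.

Theorem theorem7p3 (R : realType) (L1 : set (plane R * plane R))
    (hL1 : pre_lamination L1) :
  (exists L2 : set (plane R * plane R),
     [/\ P_pre_lamination L2, L1 `<=` L2 & dense (leaf_image L1 L2)]) <->
  [/\ dense_lamination L1,
      forall A, complementary_region L1 A ->
        exists B, boundary_component A B /\ ~ leaves L1 B,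
      forall D, ~ bad_accumulation L1 D &
      few_common_ends L1].
Proof.
split=> [[L2 [P2 L12 dn]]|[D1 H2 H3 H4]].
  split.
  - exact: (sub_dense hL1 P2 L12 dn).
  - exact: (sub_nonleaf_boundary hL1 P2 L12 dn).
  - exact: (sub_no_bad hL1 P2 L12 dn).
  - exact: (sub_few_common_ends hL1 P2 L12).
exists (completion L1); split.
- exact: completion_P.
- exact: completion_sub.
- exact: completion_dense.
Qed.
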